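(* Let $A$, $B$ be $C^{k,\alpha}$ convex bodies in $\mathbb{R}^n$, where $k\ge 2$ is an integer, $\infty$ or $\omega$, and $\alpha\in[0,1]$. If either $Z_A$ or $Z_B$ is countable, then the set of rotations $R\in SO(n)$ such that $R(A)+B$ is $C^{k,\alpha}$ is comeager in $SO(n)$ (i.e. $R(A)+B$ is $C^{k,\alpha}$ for generic $R\in SO(n)$).
   Context: A convex body in $\mathbb{R}^n$ is a compact convex set with non-empty interior; it is $C^{k,\alpha}$ if its boundary is a $C^{k,\alpha}$ submanifold of $\mathbb{R}^n$ ($C^\omega$ = real analytic; $C^{k,\alpha}$ means $k$th derivatives continuous for $\alpha=0$, Lipschitz for $\alpha=1$, $\alpha$-Hölder for $0<\alpha<1$). $R(A)+B$ is the Minkowski sum $\{x+y: x\in R(A), y\in B\}$. For a $C^2$ convex body $C$ with Gauss map $\nu_C\colon\partial C\to S^{n-1}$ (unit outer normal) and Gaussian curvature $G_C$, set $Z_C=\{\nu_C(x): x\in\partial C,\ G_C(x)=0\}$. A subset of $SO(n)$ is comeager if it contains a countable intersection of open dense subsets. *)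

(* Defs.v *)
From HB Require Import structures.
From mathcomp Require Import all_boot all_order all_algebra.
From mathcomp Require Import all_classical all_reals all_analysis.
Set Implicit Arguments. Unset Strict Implicit. Unset Printing Implicit Defensive.
Import Order.TTheory GRing.Theory Num.Theory.
Import numFieldNormedType.Exports.
Local Open Scope classical_set_scope.
Local Open Scope ring_scope.

Inductive reg := Fin of nat | Inf | Omega.

Definition reg_ge2 (c : reg) : Prop :=
  match c with Fin k => (2 <= k)%N | _ => True end.

Section Defs.
Variables (R : realType) (n : nat).
Notation V := 'rV[R]_n.

Definition evec (i : 'I_n) : V := delta_mx 0 i.

Definition dotv (u v : V) : R := (u *m v^T) 0 0.

Fixpoint iter_partial (s : seq 'I_n) (f : V -> R) : V -> R :=
  match s with
  | [::] => f
  | i :: s' => fun x => derive (iter_partial s' f) x (evec i)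
  end.

Definition Ck_on (k : nat) (U : set V) (f : V -> R) : Prop :=
  forall s : seq 'I_n, (size s <= k)%N -> forall x, U x ->
    {for x, continuous (iter_partial s f)} /\
    ((size s < k)%N -> forall i, derivable (iter_partial s f) x (evec i)).

(* g is locally alpha-Hoelder on U (alpha = 1: locally Lipschitz;
   alpha = 0: locally bounded) *)
Definition holder_on (alpha : R) (U : set V) (g : V -> R) : Prop :=
  forall x, U x -> exists r : R, 0 < r /\ exists C : R,
    forall y z, ball x r y -> ball x r z ->
      `|g y - g z| <= C * powR `|y - z| alpha.

Definition monom (beta : 'I_n -> nat) (x : V) : R :=
  \prod_(i < n) (x 0 i) ^+ (beta i).

(* f is real analytic on U: near every point x0 of U, f is the sum of an
   absolutely convergent power series centred at x0 (terms grouped by total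
   degree d; absolute convergence makes the order irrelevant). *)
Definition analytic_on (U : set V) (f : V -> R) : Prop :=
  forall x0, U x0 -> exists r : R, 0 < r /\
    exists a : ('I_n -> nat) -> R, forall x, ball x0 r x ->
      let term d (beta : {ffun 'I_n -> 'I_d.+1}) :=
          a (fun i => nat_of_ord (beta i)) *
          monom (fun i => nat_of_ord (beta i)) (x - x0) in
      let habs d := \sum_(beta : {ffun 'I_n -> 'I_d.+1} |
                           (\sum_(i < n) nat_of_ord (beta i) == d)%N)
                       `|term d beta| in
      let hsum d := \sum_(beta : {ffun 'I_n -> 'I_d.+1} |
                           (\sum_(i < n) nat_of_ord (beta i) == d)%N)
                       term d beta in
      cvgn (series habs) /\ series hsum @ \oo --> f x.

Definition of_class (c : reg) (alpha : R) (U : set V) (f : V -> R) : Prop :=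
  match c with
  | Fin k => Ck_on k U f /\
             forall s : seq 'I_n, size s = k -> holder_on alpha U (iter_partial s f)
  | Inf => forall k, Ck_on k U f
  | Omega => analytic_on U f
  end.

Definition gradient (F : V -> R) (x : V) : V := \row_i iter_partial [:: i] F x.

Definition local_defining (c : reg) (alpha : R) (S W : set V) (F : V -> R) :=
  open W /\ of_class c alpha W F /\
  (forall x, W x -> gradient F x != 0) /\
  S `&` W = [set x | W x /\ F x = 0].

Definition hypersurface (c : reg) (alpha : R) (S : set V) : Prop :=
  forall p, S p -> exists W F, W p /\ local_defining c alpha S W F.

Definition convex_set (C : set V) : Prop :=
  forall x y (t : R), C x -> C y -> 0 <= t <= 1 ->
    C (t *: x + (1 - t) *: y).

Definition convex_body (C : set V) : Prop :=
  convex_set C /\ compact C /\ interior C !=set0.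

Definition bdry (C : set V) : set V := closure C `\` interior C.

Definition reg_convex_body (c : reg) (alpha : R) (C : set V) : Prop :=
  convex_body C /\ hypersurface c alpha (bdry C).

Definition outer_unit_normal (C : set V) (x u : V) : Prop :=
  dotv u u = 1 /\ forall y, C y -> dotv u (y - x) <= 0.

(* Gaussian curvature at x of the level hypersurface {F = 0}:
   nu = grad F / |grad F| extends the Gauss map near x; J is its Jacobian
   (v |-> v *m J is d nu(x)), P the projection onto the tangent space
   nu(x)^perp. L acts as d nu(x) on the tangent space and as the identity on
   the normal line, so det L = det (d nu(x) restricted to T_x) = G(x). *)
Definition gauss_curv (F : V -> R) (x : V) : R :=
  let nu := fun y => (Num.sqrt (dotv (gradient F y) (gradient F y)))^-1
                       *: gradient F y in
  let J : 'M[R]_n := \matrix_(i, j) (derive nu x (evec i)) 0 j in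
  let N : 'M[R]_n := (nu x)^T *m nu x in
  \det ((1%:M - N) *m J + N).

Definition Zset (C : set V) : set V :=
  [set u | exists x, bdry C x /\ outer_unit_normal C x u /\
     exists W F, W x /\ local_defining (Fin 2) 0 (bdry C) W F /\
                 gauss_curv F x = 0].

Definition SOn : set 'M[R]_n :=
  [set Q | Q^T *m Q = 1%:M /\ \det Q = 1].

(* image of A under the linear map x |-> Q x (row-vector convention) *)
Definition rot_image (Q : 'M[R]_n) (A : set V) : set V :=
  [set x *m Q^T | x in A].

Definition mink_sum (A B : set V) : set V := [set x + y | x in A & y in B].

End Defs.

Definition comeager_in (T : topologicalType) (S G : set T) : Prop :=
  exists U : nat -> set T,
    (forall k, U k `<=` S /\ (exists O, open O /\ U k = O `&` S) /\
               S `<=` closure (U k)) /\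
    \bigcap_k U k `<=` G.

(* Main.v *)
(* Let p = a + b be a boundary point of A + B, where a and b have the common outer normal u,
   and suppose that B has nonzero curvature at b.  With defining functions FA and FB whose
   gradients are positive multiples of u, the map
     Psi (a', b', l) = (a' + b', grad FA a' - l grad FB b', FB b')
   has an invertible differential at (a, b, l0): a kernel vector reduces to a tangent vector v
   at which the sum of two nonnegative second fundamental forms vanishes, hence v = 0.  So near p
   each x is a(x) + b(x) with parallel normals, b(x) on the boundary of B and x -> a(x) one class
   less regular than A, and F = FA o a defines the boundary of A + B.  As moving b(x) along its
   tangent plane does not change FB to first order, grad F = (grad FA) o a, and F is as regular
   as A.  Hence R(A) + B can only be singular if some u in Z_B is the R-image of a point of Z_A.
   If Z_A, say, is countable, it remains to see that the complement of Z_B contains a dense open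
   subset of the sphere, so that each condition R u_k in that subset is open and dense in R.
   This holds because at a point of B farthest from -t u0 the curvature is positive, and the
   normal there tends to u0 as t grows. *)

(* Two difficulties shape the proof. First, the inverse function theorem only sees pairs near (a,
   b), while a boundary point of A + B near p might split into a pair far from (a, b), since A may
   have flat pieces. Nonzero curvature at b makes b the only point of B with normal u; by
   compactness every splitting of a boundary point near p then has its B-part near b, hence its
   A-part near a. Second, one argument has to serve C^{k,alpha}, C^oo and C^omega. It uses only
   closure under ring operations, reciprocals and composition, and the regularity of Lipschitz
   solutions of dG = H(G). In the analytic case these facts are derived from bounds on derivatives,
   with the majorants (1 - K t)^(-q), and no power series is ever substituted into another: power
   series appear only when the definition of analyticity is translated into such bounds and back. *)
Require Import Defs.
From HB Require Import structures.
From mathcomp Require Import all_boot all_order all_algebra.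
From mathcomp Require Import all_classical all_reals all_analysis.
From mathcomp Require Import ring lra.
Set Implicit Arguments. Unset Strict Implicit. Unset Printing Implicit Defensive.
Import Order.TTheory GRing.Theory Num.Theory.
Import numFieldNormedType.Exports.
Local Open Scope classical_set_scope.
Local Open Scope ring_scope.

(** * Partial derivatives *)

(* Locked: otherwise unification compares partial derivatives by unfolding limits. *)
HB.lock Definition pd (R : realType) (n : nat) (i : 'I_n) (f : 'rV[R]_n -> R)
  : 'rV[R]_n -> R := fun x => 'D_(evec R i) f x.

(** The increment form avoids dividing by [h], so that [h = 0] needs no separate case in later
    estimates. *)
Lemma is_deriveP (R : realType) (W : normedModType R) (f : W -> R) (x v : W) (l : R) :
  is_derive x v f l <->
  forall e : R, 0 < e -> exists2 d : R, 0 < d &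
    forall h : R, `|h| < d -> `|f (x + h *: v) - f x - h * l| <= e * `|h|.
Proof.
split=> [[+ +] e e0|H].
  rewrite /derivable /derive => /cvg_ex[/= l' Hl] Hl'.
  have El : l' = l by rewrite -Hl'; apply/esym/cvg_lim.
  rewrite {}El {Hl'} in Hl.
  have /cvgrPdist_le/(_ e e0) := Hl.
  move=> /nbhs_ballP[d d0 Hd].
  exists d => // h hd; have [->|h0] := eqVneq h 0.
    by rewrite scale0r addr0 mul0r subr0 subrr normr0 mulr0.
  have /Hd : ball 0 d h by rewrite -ball_normE /= sub0r normrN.
  move=> /(_ h0); rewrite addrC => H1.
  rewrite -[X in _ <= _ * `|X|](mulr1 h).
  have -> : f (x + h *: v) - f x - h * l =
     - (h * (l - h^-1 *: (f (h *: v + x) - f x))).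
    rewrite /= -[h^-1 *: _]/(h^-1 * _) (addrC (h *: v)).
    by rewrite mulrBr mulVKf // opprB.
  by rewrite normrN normrM mulrC mulr1 ler_wpM2r// addrC.
have Hl : (fun h : R => h^-1 *: ((f \o shift x) (h *: v) - f x)) @ 0^' --> l.
  apply/cvgrPdist_le => e e0.
  have [d d0 Hd] := H e e0; apply/nbhs_ballP; exists d => // h.
  rewrite -ball_normE /= sub0r normrN => hd h0.
  have -> : l - h^-1 *: (f (h *: v + x) - f x) =
     - (h^-1 * (f (x + h *: v) - f x - h * l)).
    rewrite -[h^-1 *: _]/(h^-1 * _) (addrC (h *: v)).
    by rewrite [in RHS]mulrBr mulKf // opprB.
  by rewrite normrN normrM normfV ler_pdivrMl ?normr_gt0// [leRHS]mulrC Hd.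
by apply: DeriveDef; [apply/cvg_ex; exists l | apply: cvg_lim].
Qed.

Section Partials.
Variables (R : realType) (n : nat).
Notation V := 'rV[R]_n.
Implicit Types (f g : V -> R) (x y z v : V) (i j : 'I_n).

Lemma pdE i f x : pd i f x = 'D_(evec R i) f x. Proof. by rewrite pd.unlock. Qed.

Lemma pd_partial i f : pd i f = iter_partial [:: i] f. Proof. by rewrite pd.unlock. Qed.

Lemma pdP f x i : derivable f x (evec R i) -> is_derive x (evec R i) f (pd i f x).
Proof. by rewrite pdE => /derivableP. Qed.

Lemma is_derive_pd f x i (l : R) : is_derive x (evec R i) f l -> pd i f x = l.
Proof. by rewrite pdE => -[]. Qed.

Lemma coord_norm_le x i : `|x 0 i| <= `|x|.
Proof.
rewrite [leRHS]/Num.Def.normr/= mx_normrE.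
exact: (le_bigmax _ (fun ij : 'I_1 * 'I_n => `|x ij.1 ij.2|) (0, i)).
Qed.

Lemma norm_le_coord x (e : R) : 0 <= e -> (forall i, `|x 0 i| <= e) -> `|x| <= e.
Proof.
move=> e0 H; rewrite [leLHS]/Num.Def.normr/= mx_normrE.
by apply/bigmax_le => // -[a b] _ /=; rewrite ord1.
Qed.

Lemma norm_lt_coord x (e : R) : 0 < e -> (forall i, `|x 0 i| < e) -> `|x| < e.
Proof.
move=> e0 H; rewrite [ltLHS]/Num.Def.normr/= mx_normrE.
by apply/bigmax_lt => // -[a b] _ /=; rewrite ord1.
Qed.

Lemma rV_ballE x (e : R) y : ball x e y = (`|y - x| < e) :> Prop.
Proof. by rewrite -ball_normE /= distrC. Qed.

Lemma nbhsE_norm x (P : set V) :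
  nbhs x P <-> exists2 e : R, 0 < e & forall y, `|y - x| < e -> P y.
Proof.
split=> [/nbhs_ballP[e e0 H]|[e e0 H]].
  by exists e => // y xy; apply: H; rewrite rV_ballE.
by apply/nbhs_ballP; exists e => // y; rewrite rV_ballE; apply: H.
Qed.

Lemma open_norm (U : set V) x : open U -> U x ->
  exists2 e : R, 0 < e & forall y, `|y - x| < e -> U y.
Proof. by move=> oU Ux; apply/nbhsE_norm/open_nbhs_nbhs. Qed.

Lemma continuousP_norm f x :
  {for x, continuous f} <->
  forall e : R, 0 < e -> exists2 d : R, 0 < d & forall y, `|y - x| < d -> `|f y - f x| < e.
Proof.
have E := (@cvgrPdist_lt _ _ _ (nbhs x) (nbhs_filter x) f (f x)).
split=> [/E H e e0|H].
  have /nbhsE_norm[d d0 Hd] := H e e0.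
  by exists d => // y /Hd; rewrite distrC.
apply/E => e e0; apply/nbhsE_norm.
have [d d0 Hd] := H e e0; exists d => // y /Hd; by rewrite distrC.
Qed.

Lemma is_derive_line (W : normedModType R) (f : V -> W) x v (t : R) :
  derivable f (x + t *: v) v ->
  is_derive t 1 (fun s : R => f (x + s *: v)) ('D_v f (x + t *: v)).
Proof.
move=> df.
have E : (fun h : R => h^-1 *: (((fun s : R => f (x + s *: v)) \o shift t) (h *: 1)
            - f (x + t *: v))) =
   (fun h : R => h^-1 *: ((f \o shift (x + t *: v)) (h *: v) - f (x + t *: v))).
  apply/funext => h /=; congr (_ *: (f _ - _)).
  by rewrite [h%:A]mulr1 scalerDl addrCA.
by apply: DeriveDef; [rewrite /derivable E | rewrite /derive E].
Qed.

(** The segment is parametrized by [0, 1] with [c] as a factor, so that the increment may have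
    either sign or vanish. *)
Lemma MVT_line f x v (c : R) :
  (forall t : R, 0 <= t <= 1 -> derivable f (x + (t * c) *: v) v) ->
  exists2 t : R, 0 <= t <= 1 &
    f (x + c *: v) - f x = c * 'D_v f (x + (t * c) *: v).
Proof.
move=> H; pose phi (s : R) := f (x + (s * c) *: v).
have D (t : R) : 0 <= t <= 1 -> is_derive t 1 phi (c * 'D_v f (x + (t * c) *: v)).
  move=> t01; have := is_derive_line (H t t01) => D1.
  have D2 : is_derive t 1 (fun s : R => s * c) c.
    apply/is_deriveP => e e0; exists 1 => // h _.
    have -> : (t + h *: (1 : R)) * c - t * c - h * c = 0.
      by rewrite [h *: _]mulr1; ring.
    by rewrite normr0 mulr_ge0 // ltW.
  have := @is_derive1_comp R _ _ t _ _ D1 D2.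
  by rewrite mulrC.
have [||t tc e] := @MVT_segment R phi (fun t => c * 'D_v f (x + (t * c) *: v)) 0 1 ler01.
- by move=> t /subset_itv_oo_cc; rewrite in_itv; apply: D.
- apply: continuous_in_subspaceT => t /set_mem; rewrite /= in_itv /= => tc.
  by apply/differentiable_continuous/derivable1_diffP; case: (D t tc).
exists t; first by move: tc; rewrite in_itv.
by move: e; rewrite /phi mul1r mul0r scale0r addr0 subr0 mulr1.
Qed.

(* The path from x to y that changes one coordinate at a time stays in the
   sup-norm ball. *)
Lemma ball_lipschitz f x0 (r : R) (B : 'I_n -> R) :
  (forall z, `|z - x0| < r -> forall i, derivable f z (evec R i) /\ `|pd i f z| <= B i) ->
  forall x y, `|x - x0| < r -> `|y - x0| < r ->
  `|f y - f x| <= \sum_i B i * `|y 0 i - x 0 i|.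
Proof.
move=> H x y xr yr.
have r0 : 0 < r by exact: le_lt_trans (normr_ge0 _) xr.
pose p (k : nat) : V := \row_i (if (i < k)%N then y 0 i else x 0 i).
have p0 : p 0%N = x by apply/rowP => i; rewrite mxE.
have pn : p n = y by apply/rowP => i; rewrite mxE ltn_ord.
have step (i : 'I_n) : p i.+1 = p i + (y 0 i - x 0 i) *: evec R i.
  apply/rowP => j; rewrite !mxE eqxx /= ltnS leq_eqVlt.
  have [->|ne] /= := @eqVneq 'I_n j i; last by rewrite val_eqE (negbTE ne) mulr0 addr0.
  by rewrite eqxx ltnn mulr1 addrC subrK.
have -> : f y - f x = \sum_(i < n) (f (p i.+1) - f (p i)).
  rewrite -(big_mkord xpredT (fun k : nat => f (p k.+1) - f (p k))) telescope_sumr//.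
  by rewrite p0 pn.
apply: (le_trans (ler_norm_sum _ _ _)); apply: ler_sum => i _.
pose c := y 0 i - x 0 i.
have inball (t : R) : 0 <= t <= 1 -> `|p i + (t * c) *: evec R i - x0| < r.
  move=> /andP[t0 t1].
  apply: norm_lt_coord => // j; rewrite !mxE eqxx /=.
  have [->|ne] := eqVneq j i; last first.
    rewrite mulr0 addr0; case: ifP => _.
      by apply: le_lt_trans yr; have := coord_norm_le (y - x0) j; rewrite !mxE.
    by apply: le_lt_trans xr; have := coord_norm_le (x - x0) j; rewrite !mxE.
  rewrite ltnn mulr1.
  have := coord_norm_le (y - x0) i; have := coord_norm_le (x - x0) i; rewrite !mxE.
  move=> /le_lt_trans/(_ xr) + /le_lt_trans/(_ yr).
  rewrite !ltr_norml /c; move: (x 0 i) (y 0 i) (x0 0 i) => a b m /andP[A1 A2] /andP[B1 B2].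
  (* One of the weights [t], [1 - t] is at least 1/2, which keeps the inequality for the convex
     combination strict. *)
  have [t2|t2] := leP t (1 / 2); apply/andP; split; nra.
have [t t01|t t01] := @MVT_line f (p i) (evec R i) c.
  by have [] := H _ (inball t t01) i; rewrite ?pdE.
rewrite -step => ->; rewrite normrM mulrC ler_wpM2r //.
by have [] := H _ (inball t t01) i; rewrite ?pdE.
Qed.
End Partials.

(** * The dot product and its comparison with the sup norm *)

Section Dot.
Variables (R : realType) (n : nat).
Notation V := 'rV[R]_n.
Implicit Types (u v w : V).

Lemma dotvE u v : dotv u v = \sum_i u 0 i * v 0 i.
Proof. by rewrite /dotv mxE; apply: eq_bigr => i _; rewrite mxE. Qed.

Lemma dotvC u v : dotv u v = dotv v u.
Proof. by rewrite !dotvE; apply: eq_bigr => i _; rewrite mulrC. Qed.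

Lemma dotvDl u v w : dotv (u + v) w = dotv u w + dotv v w.
Proof. by rewrite /dotv mulmxDl mxE. Qed.

Lemma dotvDr u v w : dotv w (u + v) = dotv w u + dotv w v.
Proof. by rewrite !(dotvC w) dotvDl. Qed.

Lemma dotvZl (a : R) u w : dotv (a *: u) w = a * dotv u w.
Proof. by rewrite /dotv -scalemxAl mxE. Qed.

Lemma dotvZr (a : R) u w : dotv w (a *: u) = a * dotv w u.
Proof. by rewrite !(dotvC w) dotvZl. Qed.

Lemma dotvNl u w : dotv (- u) w = - dotv u w.
Proof. by rewrite -scaleN1r dotvZl mulN1r. Qed.

Lemma dotvNr u w : dotv w (- u) = - dotv w u.
Proof. by rewrite !(dotvC w) dotvNl. Qed.

Lemma dotvBl u v w : dotv (u - v) w = dotv u w - dotv v w.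
Proof. by rewrite dotvDl dotvNl. Qed.

Lemma dotvBr u v w : dotv w (u - v) = dotv w u - dotv w v.
Proof. by rewrite dotvDr dotvNr. Qed.

Lemma dotv0l w : dotv 0 w = 0.
Proof. by rewrite /dotv mul0mx mxE. Qed.

Lemma dotv0r w : dotv w 0 = 0.
Proof. by rewrite dotvC dotv0l. Qed.

Lemma dotv_evec u i : dotv u (evec R i) = u 0 i.
Proof.
rewrite dotvE (bigD1 i) //= big1 => [|j ji]; rewrite !mxE eqxx /=.
  by rewrite eqxx mulr1 addr0.
by rewrite /= (negbTE ji) mulr0.
Qed.

Lemma dotv_ge0 u : 0 <= dotv u u.
Proof. by rewrite dotvE sumr_ge0 // => i _; rewrite -expr2 sqr_ge0. Qed.

Lemma dotv_eq0 u : (dotv u u == 0) = (u == 0).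
Proof.
apply/eqP/eqP => [|->]; last by rewrite dotv0l.
rewrite dotvE => /eqP; rewrite psumr_eq0; last by move=> i _; rewrite -expr2 sqr_ge0.
move=> /allP H; apply/rowP => i; rewrite mxE.
have := H i; rewrite mem_index_enum => /(_ isT) /=.
by rewrite -expr2 sqrf_eq0 => /eqP.
Qed.

Lemma dotv_gt0 u : u != 0 -> 0 < dotv u u.
Proof. by move=> u0; rewrite lt_neqAle eq_sym dotv_eq0 u0 dotv_ge0. Qed.

Lemma sum_norm_le u : \sum_i `|u 0 i| <= n%:R * `|u|.
Proof.
rewrite -[n in n%:R](card_ord n) mulr_natl -sumr_const; apply: ler_sum => i _.
exact: coord_norm_le.
Qed.

(** A crude form of Cauchy-Schwarz: [|u|] is the sup norm, which costs the factor [n]. *)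
Lemma dotv_norm_le u v : `|dotv u v| <= n%:R * `|u| * `|v|.
Proof.
rewrite dotvE (le_trans (ler_norm_sum _ _ _))//.
apply: le_trans (_ : \sum_i `|u 0 i| * `|v| <= _).
  by apply: ler_sum => i _; rewrite normrM ler_wpM2l// coord_norm_le.
by rewrite -mulr_suml ler_wpM2r// sum_norm_le.
Qed.

Lemma norm_sqr_le_dotv u : `|u| ^+ 2 <= dotv u u.
Proof.
have [->|u0] := eqVneq u 0; first by rewrite normr0 expr0n dotv0l.
rewrite -ler_sqrt ?dotv_ge0// sqrtr_sqr ger0_norm//.
apply: norm_le_coord => [|i]; first exact: sqrtr_ge0.
rewrite -sqrtr_sqr ler_sqrt ?dotv_ge0// dotvE (bigD1 i)//= -expr2 lerDl.
by apply: sumr_ge0 => j _; rewrite -expr2 sqr_ge0.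
Qed.

End Dot.

(** * Differentiability and the chain rule *)

Section Diff.
Variables (R : realType) (n : nat).
Notation V := 'rV[R]_n.
Implicit Types (f g : V -> R) (x y z v : V).

Lemma gradientE f x i : gradient f x 0 i = pd i f x.
Proof. by rewrite mxE pd_partial. Qed.

Lemma near_fin (I : finType) (P : I -> V -> Prop) x :
  (forall i, exists2 d : R, 0 < d & forall y, `|y - x| < d -> P i y) ->
  exists2 d : R, 0 < d & forall y, `|y - x| < d -> forall i, P i y.
Proof.
move=> H; apply/nbhsE_norm.
have F := nbhs_filter x.
apply: (@filter_forall _ _ (fun i y => P i y) (nbhs x) F) => i.
by apply/nbhsE_norm; apply: H.
Qed.

(** Frechet differentiability. The regularity classes only speak of partial derivatives, which do
    not suffice for the chain rule. *)
Definition fdiff f x : Prop := forall e : R, 0 < e -> exists2 d : R, 0 < d &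
  forall y, `|y - x| < d -> `|f y - f x - dotv (y - x) (gradient f x)| <= e * `|y - x|.

Lemma is_derive_dotv (a x v : V) : is_derive x v (fun z => dotv z a) (dotv v a).
Proof.
apply/is_deriveP => e e0; exists 1 => // h _.
rewrite dotvDl dotvZl; set A := (X in `|X|); have -> : A = 0 by rewrite /A; ring.
by rewrite normr0 mulr_ge0// ltW.
Qed.

Lemma is_derive_coord x v i : is_derive x v (fun z : V => z 0 i) (v 0 i).
Proof.
rewrite -(dotv_evec v i); under eq_fun do rewrite -(dotv_evec _ i).
exact: is_derive_dotv.
Qed.

Lemma C1_fdiff f x :
  (exists2 r : R, 0 < r & forall z, `|z - x| < r -> forall i, derivable f z (evec R i)) ->
  (forall i, {for x, continuous (pd i f)}) -> fdiff f x.
Proof.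
move=> [r r0 df] cf e e0.
(* Summing over the coordinates costs a factor [n]; [n.+1] keeps the denominator nonzero when
   [n = 0]. *)
pose e' := e / n.+1%:R.
have e'0 : 0 < e' by rewrite divr_gt0.
have [d d0 Hd] : exists2 d : R, 0 < d &
    forall y, `|y - x| < d -> forall i, `|pd i f y - pd i f x| <= e'.
  apply: near_fin => i; have /continuousP_norm/(_ e' e'0)[d d0 Hd] := cf i.
  by exists d => // y /Hd/ltW.
exists (Num.min d r); first by rewrite lt_min d0.
move=> y; rewrite lt_min => /andP[yd yr].
(* Without its linear part the function has partial derivatives at most [e'] near [x], and
   [ball_lipschitz] integrates this bound. *)
pose g z := f z - dotv z (gradient f x).
have dg z (zr : `|z - x| < r) i :
    is_derive z (evec R i) g (pd i f z - pd i f x).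
  have := is_derive_dotv (gradient f x) z (evec R i).
  rewrite dotvC dotv_evec gradientE => D1.
  by apply: is_deriveB; apply/pdP/df.
have s0 : 0 < Num.min d r by rewrite lt_min d0.
have Hs : forall z, `|z - x| < Num.min d r ->
    forall i, derivable g z (evec R i) /\ `|pd i g z| <= e'.
  move=> z; rewrite lt_min => /andP[zd zr] i; have [D1 D2] := dg z zr i.
  by split => //; rewrite pdE D2 Hd.
have xs : `|x - x| < Num.min d r by rewrite subrr normr0.
have ys : `|y - x| < Num.min d r by rewrite lt_min yd.
have := ball_lipschitz Hs xs ys.
have -> : g y - g x = f y - f x - dotv (y - x) (gradient f x).
  by rewrite /g dotvBl; ring.
move=> /le_trans; apply.
rewrite -mulr_sumr.
apply: le_trans (_ : e' * (n%:R * `|y - x|) <= _).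
  rewrite ler_wpM2l ?(ltW e'0)//; apply: le_trans (sum_norm_le _).
  by apply: ler_sum => i _; rewrite !mxE.
rewrite mulrA ler_wpM2r// /e' mulrAC ler_pdivrMr// ler_wpM2l ?(ltW e0)//.
by rewrite ler_nat.
Qed.

Lemma C1_lipschitz f x :
  (exists2 r : R, 0 < r & forall z, `|z - x| < r -> forall i, derivable f z (evec R i)) ->
  (forall i, {for x, continuous (pd i f)}) ->
  exists2 r : R, 0 < r & exists2 C : R, 0 <= C &
  forall y z, `|y - x| < r -> `|z - x| < r -> `|f y - f z| <= C * `|y - z|.
Proof.
move=> [r r0 df] cf.
have [d d0 Hd] : exists2 d : R, 0 < d &
    forall y, `|y - x| < d -> forall i, `|pd i f y - pd i f x| <= 1.
  apply: near_fin => i; have /continuousP_norm/(_ 1 ltr01)[d d0 Hd] := cf i.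
  by exists d => // y /Hd/ltW.
exists (Num.min d r); first by rewrite lt_min d0.
have Hs : forall z, `|z - x| < Num.min d r ->
    forall i, derivable f z (evec R i) /\ `|pd i f z| <= 1 + `|gradient f x|.
  move=> z; rewrite lt_min => /andP[zd zr] i; split; first exact: df.
  rewrite -[X in `|X|](subrK (pd i f x)); apply: (le_trans (ler_normD _ _)).
  apply: lerD; first exact: Hd.
  by rewrite -gradientE; exact: coord_norm_le.
exists ((1 + `|gradient f x|) * n%:R); first by rewrite mulr_ge0// addr_ge0.
move=> y z yr zr; have := ball_lipschitz Hs zr yr => /le_trans; apply.
rewrite -mulr_sumr -mulrA ler_wpM2l ?addr_ge0//; apply: le_trans (sum_norm_le _).
by apply: ler_sum => i _; rewrite !mxE.
Qed.

End Diff.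

Section Chain.
Variables (R : realType) (n : nat).

(** Only the outer function has to be Frechet differentiable; for the inner one, derivatives of its
    coordinates in the single direction [v] are enough. [W] is arbitrary, so that curves are covered
    too. *)
Lemma is_derive_comp (W : normedModType R) (f : 'rV[R]_n -> R) (G : W -> 'rV[R]_n)
    (x v : W) (l : 'rV[R]_n) :
  fdiff f (G x) -> (forall j, is_derive x v (fun z => G z 0 j) (l 0 j)) ->
  is_derive x v (fun z => f (G z)) (dotv l (gradient f (G x))).
Proof.
move=> df dG; apply/is_deriveP => e e0.
pose L := `|l| + 1; pose D := n%:R * `|gradient f (G x)| + 1.
have L0 : 0 < L by rewrite ltr_wpDl.
have D0 : 0 < D by rewrite ltr_wpDl// mulr_ge0.
have [d1 d10 H1] := df _ (divr_gt0 (divr_gt0 e0 (ltr0Sn _ 1)) L0).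
(* The bound 1 yields the growth estimate [yL]; the other bound makes the inner error, paired with
   the gradient, at most half of the allowance. *)
pose e2 := Num.min 1 (e / 2 / D).
have e20 : 0 < e2 by rewrite lt_min ltr01 !divr_gt0.
have [d2 d20 H2] : exists2 d : R, 0 < d & forall h : R, `|h| < d ->
    `|G (x + h *: v) - G x - h *: l| <= e2 * `|h|.
  suff [d d0 Hd] : exists2 d : R, 0 < d & forall h : R, `|h| < d -> forall j,
     `|(G (x + h *: v) - G x - h *: l) 0 j| <= e2 * `|h|.
    exists d => // h hd; apply: norm_le_coord; first by rewrite mulr_ge0// ltW.
    exact: Hd.
  have F := @nbhs_filter R 0.
  suff : nbhs (0 : R) [set h | forall j, `|(G (x + h *: v) - G x - h *: l) 0 j| <= e2 * `|h|].
    move=> /nbhs_ballP[d d0 Hd]; exists d => // h hd.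
    by apply: Hd; rewrite -ball_normE /= sub0r normrN.
  apply: (@filter_forall _ _ (fun j h => `|(G (x + h *: v) - G x - h *: l) 0 j| <= e2 * `|h|) _ F).
  move=> j; have /is_deriveP/(_ _ e20)[d d0 Hd] := dG j.
  apply/nbhs_ballP; exists d => // h; rewrite -ball_normE /= sub0r normrN => /Hd.
  by rewrite !mxE.
exists (Num.min d2 (d1 / (2 * L))).
  by rewrite lt_min d20 divr_gt0// mulr_gt0.
move=> h; rewrite lt_min => /andP[/H2 hd2 hd1].
set y := G (x + h *: v) in hd2 *.
have yL : `|y - G x| <= L * `|h|.
  rewrite -[X in `|X|](subrK (h *: l)); apply: (le_trans (ler_normD _ _)).
  rewrite /L mulrDl mul1r addrC normrZ [_ * `|l|]mulrC lerD2l.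
  apply: (le_trans hd2); rewrite -[leRHS]mul1r ler_wpM2r//.
  by rewrite /e2 ge_min lexx.
have yd1 : `|y - G x| < d1.
  apply: (le_lt_trans yL); move: hd1; rewrite ltr_pdivlMr ?mulr_gt0// => H.
  by have h0 := normr_ge0 h; nra.
have A1 := H1 _ yd1.
have -> : f y - f (G x) - h * dotv l (gradient f (G x)) =
   (f y - f (G x) - dotv (y - G x) (gradient f (G x)))
   + dotv (y - G x - h *: l) (gradient f (G x)).
  by rewrite (dotvBl (y - G x) (h *: l)) dotvZl; ring.
apply: (le_trans (ler_normD _ _)); rewrite (splitr e) mulrDl; apply: lerD.
  apply: (le_trans A1).
  have -> : e / 2 * `|h| = e / 2 / L * (L * `|h|) by rewrite mulrA divfK// gt_eqF.
  by rewrite ler_wpM2l// !divr_ge0// ltW.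
apply: (le_trans (dotv_norm_le _ _)).
apply: le_trans (_ : D * (e2 * `|h|) <= _).
  rewrite mulrAC; apply: ler_pM => //.
  by rewrite /D lerDl.
rewrite mulrA ler_wpM2r//.
apply: le_trans (_ : D * (e / 2 / D) <= _).
  by rewrite ler_wpM2l ?(ltW D0)// /e2 ge_min lexx orbT.
by rewrite mulrC divfK// gt_eqF.
Qed.

Lemma fdiff_is_derive (f : 'rV[R]_n -> R) x v :
  fdiff f x -> is_derive x v f (dotv v (gradient f x)).
Proof.
by move=> df; apply: (is_derive_comp (G := id)) => // j; exact: is_derive_coord.
Qed.

End Chain.

Lemma addrBK (T : zmodType) (x h : T) : x + h - x = h.
Proof. by rewrite addrAC subrr add0r. Qed.

(** * Second derivatives and the Taylor expansion of order two *)

Section SecondOrder.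
Variables (R : realType) (n : nat).
Notation V := 'rV[R]_n.
Implicit Types (f g : V -> R) (x y z v : V).

Definition C2on (W : set V) f : Prop := forall z, W z ->
  [/\ forall i, derivable f z (evec R i),
      forall i, {for z, continuous (pd i f)},
      forall i j, derivable (pd j f) z (evec R i) &
      forall i j, {for z, continuous (pd i (pd j f))}].

Definition hess f x : 'M[R]_n := \matrix_(i, j) pd i (pd j f) x.

Definition qf (H : 'M[R]_n) v : R := dotv (v *m H) v.

Lemma C2_fdiff W f x : open W -> C2on W f -> W x -> fdiff f x.
Proof.
move=> oW cf Wx; have [_ c1 _ _] := cf x Wx.
apply: C1_fdiff; last exact: c1.
have [d d0 Hd] := open_norm oW Wx; exists d; first exact: d0.
move=> z /Hd zW j.
by have [D _ _ _] := cf z zW; exact: D.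
Qed.

Lemma C2_fdiff_pd W f x i : open W -> C2on W f -> W x -> fdiff (pd i f) x.
Proof.
move=> oW cf Wx; have [_ _ _ c2] := cf x Wx.
apply: C1_fdiff; last by move=> j; exact: c2.
have [d d0 Hd] := open_norm oW Wx; exists d; first exact: d0.
move=> z /Hd zW j.
by have [_ _ D _] := cf z zW; exact: D.
Qed.

Lemma is_derive_shift_fun f x v a (l : R) :
  is_derive (x + a) v f l -> is_derive x v (fun z => f (z + a)) l.
Proof.
move=> /is_deriveP H; apply/is_deriveP => e e0; have [d d0 Hd] := H e e0.
by exists d => // h /Hd; rewrite [x + a + _]addrAC.
Qed.

Lemma is_derive_mull f x v (k l : R) :
  is_derive x v f l -> is_derive x v (fun z => k * f z) (k * l).
Proof. exact: (@is_deriveZ R V R f k x v l). Qed.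

Lemma norm_evec (i : 'I_n) : `|evec R i| <= 1 :> R.
Proof.
apply: norm_le_coord => // j; rewrite mxE eqxx /=.
by case: (j == i); rewrite ?normr1 ?normr0.
Qed.

(** The left side is symmetric in [i] and [j], while two uses of the mean value theorem give the
    mixed derivative in one order. Comparing both orders proves [hess_sym]. *)
Lemma second_difference f x (d : R) i j (h : R) :
  (forall z, `|z - x| < d -> derivable f z (evec R i) /\
     derivable (pd i f) z (evec R j)) -> 0 < h -> 2 * h < d ->
  exists2 p, `|p - x| <= 2 * h &
    f (x + h *: evec R i + h *: evec R j) - f (x + h *: evec R i)
    - f (x + h *: evec R j) + f x = h ^+ 2 * pd j (pd i f) p.
Proof.
move=> df h0 hd; pose phi z := f (z + h *: evec R j) - f z.
have small (k : 'I_n) (t : R) : 0 <= t -> t <= 1 -> `|t| * `|h| * `|evec R k| <= h.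
  move=> t0 t1; rewrite (ger0_norm t0) (gtr0_norm h0).
  apply: le_trans (_ : t * h * 1 <= _).
    by rewrite ler_wpM2l ?norm_evec// mulr_ge0// ltW.
  by rewrite mulr1 ler_piMl// ltW.
have near (t : R) (s : R) : 0 <= t <= 1 -> 0 <= s <= 1 ->
    `|x + (t * h) *: evec R i + (s * h) *: evec R j - x| <= 2 * h.
  move=> /andP[t0 t1] /andP[s0 s1]; rewrite [x + _ + _ - x]addrC !addrA addNr add0r.
  apply: (le_trans (ler_normD _ _)); rewrite !normrZ mulrDl mul1r; apply: lerD.
    exact: small.
  exact: small.
have near0 (t : R) : 0 <= t <= 1 -> `|x + (t * h) *: evec R i - x| < d.
  move=> t01; apply: le_lt_trans hd.
  by have := near t 0 t01; rewrite lexx ler01 mul0r scale0r addr0 => /(_ isT).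
have dphi (t : R) : 0 <= t <= 1 -> is_derive (x + (t * h) *: evec R i) (evec R i) phi
    (pd i f (x + (t * h) *: evec R i + h *: evec R j) - pd i f (x + (t * h) *: evec R i)).
  move=> t01; apply: is_deriveB; last by apply/pdP; case: (df _ (near0 t t01)).
  apply: is_derive_shift_fun; apply/pdP.
  have [] // := df (x + (t * h) *: evec R i + h *: evec R j) _.
  apply: le_lt_trans hd.
  by have := near t 1 t01; rewrite lexx ler01 mul1r => /(_ isT).
have [t t01|t t01 E1] := @MVT_line _ _ phi x (evec R i) h; first by case: (dphi t t01).
have [s s01|s s01 E2] := @MVT_line _ _ (pd i f) (x + (t * h) *: evec R i) (evec R j) h.
  have [] // := df (x + (t * h) *: evec R i + (s * h) *: evec R j) _.
  by apply: le_lt_trans hd; apply: near.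
exists (x + (t * h) *: evec R i + (s * h) *: evec R j); first exact: near.
have [_ D] := dphi t t01.
move: E1; rewrite D E2 /phi -pdE expr2 -mulrA => <-.
move: (f _) (f _) (f _) (f _) => a1 a2 a3 a4; ring.
Qed.

Lemma hess_sym W f x i j : open W -> C2on W f -> W x ->
  pd i (pd j f) x = pd j (pd i f) x.
Proof.
move=> oW cf Wx; have [d d0 Hd] := open_norm oW Wx.
apply/eqP; rewrite -subr_eq0 -normr_le0; apply/ler_addgt0Pl => e e0.
rewrite addr0.
have e20 : 0 < e / 2 by rewrite divr_gt0.
have [_ _ _ cf2] := cf x Wx.
have /continuousP_norm/(_ _ e20)[d1 d10 H1] := cf2 i j.
have /continuousP_norm/(_ _ e20)[d2 d20 H2] := cf2 j i.
pose m := Num.min d (Num.min d1 d2).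
have m0 : 0 < m by rewrite !lt_min d0 d10.
pose h := m / 4.
have h0 : 0 < h by rewrite divr_gt0.
have hm : 2 * h < m by rewrite /h; lra.
move: (hm); rewrite !lt_min => /and3P[hd h1 h2].
have [|p px Ep] := @second_difference f x d i j h _ h0 hd.
  by move=> z /Hd/cf[].
have [|q qx Eq] := @second_difference f x d j i h _ h0 hd.
  by move=> z /Hd/cf[].
have E : pd j (pd i f) p = pd i (pd j f) q.
  have hn : h ^+ 2 != 0 by rewrite expf_neq0// gt_eqF.
  apply: (mulfI hn); rewrite -Ep -Eq [x + _ + _ in RHS]addrAC.
  move: (f _) (f _) (f _) (f _) => a1 a2 a3 a4; ring.
have A1 := H1 q (le_lt_trans qx h1).
have A2 := H2 p (le_lt_trans px h2).
rewrite distrC in A1.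
rewrite -[X in X - _](subrK (pd i (pd j f) q)) -addrA -{2}E.
apply: (le_trans (ler_normD _ _)); rewrite (splitr e); apply: lerD; exact: ltW.
Qed.

(** After subtraction of the quadratic polynomial, differentiability of each [pd i f] bounds the
    partial derivatives by a small multiple of the distance to [x]; [ball_lipschitz] turns this into
    a quadratic bound. *)
Lemma taylor2 W f x : open W -> C2on W f -> W x -> forall e : R, 0 < e ->
  exists2 d : R, 0 < d & forall h : V, `|h| < d ->
  `|f (x + h) - f x - dotv h (gradient f x) - 2^-1 * qf (hess f x) h| <= e * `|h| ^+ 2.
Proof.
move=> oW cf Wx e e0; have [d0 d00 Hd0] := open_norm oW Wx.
pose e' := e / (2 * n.+1%:R).
have e'0 : 0 < e' by rewrite divr_gt0// mulr_gt0.
have [d1 d10 Hd1] : exists2 d : R, 0 < d & forall y, `|y - x| < d ->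
    forall i, `|pd i f y - pd i f x - dotv (y - x) (gradient (pd i f) x)| <= e' * `|y - x|.
  apply: near_fin => i; exact: (C2_fdiff_pd i oW cf Wx e'0).
pose H := hess f x.
pose G z := f z - (dotv (z - x) (gradient f x) + 2^-1 * qf H (z - x)).
have Hsym : H^T = H.
  by apply/matrixP => i j; rewrite !mxE; apply: hess_sym oW cf Wx.
have dq z i : is_derive z (evec R i) (fun z => qf H (z - x)) (2 * dotv (z - x) (row i H)).
  apply/is_deriveP => a a0; exists (a / (`|H i i| + 1)).
    by rewrite divr_gt0// ltr_wpDl.
  move=> h; rewrite ltr_pdivlMr ?ltr_wpDl// => hh.
  have -> : qf H (z + h *: evec R i - x) - qf H (z - x)
     - h * (2 * dotv (z - x) (row i H)) = h ^+ 2 * H i i.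
    rewrite /qf [z + _ - x]addrAC; move: (z - x) => w; rewrite mulmxDl -scalemxAl -rowE !(dotvDl, dotvDr, dotvZl, dotvZr).
    have -> : dotv (w *m H) (evec R i) = dotv w (row i H).
      rewrite dotv_evec /dotv [LHS]mxE [RHS]mxE; apply: eq_bigr => k _.
      by rewrite !mxE -(hess_sym k i oW cf Wx).
    have -> : dotv (row i H) (evec R i) = H i i by rewrite dotv_evec mxE.
    by rewrite (dotvC (row i H) w) expr2; move: (dotv _ _) (dotv _ _) => a1 a2; ring.
  rewrite normrM normrX expr2 [leRHS]mulrC -mulrA ler_wpM2l//.
  by apply: le_trans (ltW hh); rewrite ler_wpM2l// lerDl.
have dG z : `|z - x| < Num.min d0 d1 -> forall i, 
    derivable G z (evec R i) /\ `|pd i G z| <= e' * `|z - x|.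
  rewrite lt_min => /andP[z0 z1] i.
  have D1 : is_derive z (evec R i) G (pd i f z - (dotv (evec R i) (gradient f x) +
     2^-1 * (2 * dotv (z - x) (row i H)))).
    apply: is_deriveB; first by apply/pdP; have [] := cf z (Hd0 _ z0).
    apply: (@is_deriveD _ _ _ (fun z => dotv (z - x) (gradient f x)) (fun z => 2^-1 * qf H (z - x))).

    under eq_fun do rewrite dotvBl.
    rewrite -[dotv (evec _ _) _]subr0.
    by apply: is_deriveB; exact: is_derive_dotv.
  case: D1 => D1 D2; split=> //; rewrite pdE D2.
  rewrite dotvC dotv_evec gradientE.
  have -> : 2^-1 * (2 * dotv (z - x) (row i H)) = dotv (z - x) (gradient (pd i f) x).
    rewrite mulKf//; congr dotv; apply/rowP => j.
    by rewrite gradientE !mxE (hess_sym _ _ oW cf Wx).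
  by rewrite opprD addrA; apply: Hd1.
exists (Num.min d0 d1 / 2); first by rewrite divr_gt0// lt_min d00.
move=> h hd; have [->|h0] := eqVneq h 0.
  by rewrite addr0 /qf mul0mx !dotv0l !subrr mulr0 subr0 !normr0 expr0n mulr0.
have hp : 0 < `|h| by rewrite normr_gt0.
(* The radius [2 * |h|] makes the open ball contain [x + h]. *)
have B z : `|z - x| < 2 * `|h| -> forall i, derivable G z (evec R i) /\ `|pd i G z| <= e' * (2 * `|h|).
  move=> zh i; have [|D1 D2] := dG z _ i; first by apply: (lt_trans zh); lra.
  by split => //; apply: (le_trans D2); rewrite ler_wpM2l ?(ltW e'0)// ltW.
have x1 : `|x - x| < 2 * `|h| by rewrite subrr normr0 mulr_gt0.
have x2 : `|x + h - x| < 2 * `|h| by rewrite addrBK; lra.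
have := ball_lipschitz B x1 x2.
have -> : G (x + h) - G x = f (x + h) - f x - dotv h (gradient f x) - 2^-1 * qf (hess f x) h.
  by rewrite /G subrr {2}/qf mul0mx !dotv0l addrBK /H; move: (f _) (f _) (dotv _ _) (qf _ _) => a1 a2 a3 a4; ring.
move=> /le_trans; apply; rewrite -mulr_sumr.
apply: le_trans (_ : e' * (2 * `|h|) * (n%:R * `|h|) <= _).
  rewrite ler_wpM2l ?(mulr_ge0 (ltW e'0))//; apply: le_trans (sum_norm_le _).
  by apply: ler_sum => i _; rewrite !mxE addrBK.
have -> : e' * (2 * `|h|) * (n%:R * `|h|) = (e' * 2 * n%:R) * `|h| ^+ 2 by ring.
rewrite ler_wpM2r ?sqr_ge0// /e'.
have -> : e / (2 * n.+1%:R) * 2 * n%:R = e * n%:R / n.+1%:R.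
  by field; rewrite nat1r pnatr_eq0.
by rewrite ler_pdivrMr// ler_wpM2l ?(ltW e0)// ler_nat.
Qed.

End SecondOrder.

(** * Second-order contact of a convex body with its boundary *)

Section Curves.
Variables (R : realType) (n : nat).
Notation V := 'rV[R]_n.
Implicit Types (F : V -> R) (S W : set V) (x y z u v w : V).

(** What second-order arguments need from [local_defining], whatever the regularity class. *)
Definition C2def S W F : Prop :=
  [/\ open W, C2on W F, forall x, W x -> gradient F x != 0 &
      S `&` W = [set x | W x /\ F x = 0]].

Lemma qfD (H : 'M[R]_n) v w :
  qf H (v + w) = qf H v + (dotv (v *m H) w + dotv (w *m H) v) + qf H w.
Proof.
rewrite /qf mulmxDl !(dotvDl, dotvDr).
move: (dotv _ v) (dotv _ w) (dotv _ v) (dotv _ w) => a b c d; ring.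
Qed.

Lemma qfZ (H : 'M[R]_n) v (a : R) : qf H (a *: v) = a ^+ 2 * qf H v.
Proof. by rewrite /qf -scalemxAl dotvZl dotvZr mulrA expr2. Qed.

(** On the parabola x + t v + s t^2 w with [v] tangent, the first-order term of [F] also has order
    t^2 and competes with the Hessian. The estimate is uniform in [|s| <= K], so that [s] can be
    chosen afterwards. *)
Lemma curve_expand W F x v w : open W -> C2on W F -> W x -> F x = 0 ->
  dotv v (gradient F x) = 0 -> forall K e : R, 0 <= K -> 0 < e ->
  exists2 d : R, 0 < d & forall t s : R, `|t| < d -> `|s| <= K ->
    W (x + (t *: v + (s * t ^+ 2) *: w)) /\
    `|F (x + (t *: v + (s * t ^+ 2) *: w))
      - t ^+ 2 * (s * dotv w (gradient F x) + 2^-1 * qf (hess F x) v)| <= e * t ^+ 2.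
Proof.
move=> oW cF Wx Fx0 vg K e K0 e0; have [d0 d00 Hd0] := open_norm oW Wx.
set H := hess F x; set g := gradient F x in vg *.
(* For [|t| <= 1], [M] bounds [|h| / |t|], and [C] bounds what [qf H h] contains beyond t^2
   [qf H v], divided by |t|^3. *)
pose M := `|v| + K * `|w| + 1.
have M0 : 0 < M by rewrite ltr_wpDl// addr_ge0// mulr_ge0.
pose C := K * `|dotv (v *m H) w + dotv (w *m H) v| + K ^+ 2 * `|qf H w| + 1.
have C0 : 0 < C by rewrite ltr_wpDl// addr_ge0// mulr_ge0// sqr_ge0.
have e10 : 0 < e / 2 / M ^+ 2 by rewrite !divr_gt0// exprn_gt0.
have [d1 d10 Hd1] := taylor2 oW cF Wx e10.
exists (Num.min 1 (Num.min (e / C) (Num.min d0 d1 / M))).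
  by rewrite !lt_min ltr01 !divr_gt0// lt_min d00.
move=> t s; rewrite !lt_min => /and3P[t1 te td] sK.
have t1' : `|t| <= 1 by exact: ltW.
pose h := t *: v + (s * t ^+ 2) *: w.
have hM : `|h| <= M * `|t|.
  apply: (le_trans (ler_normD _ _)); rewrite /M.
  have -> : `|t *: v| = `|t| * `|v| by rewrite normrZ.
  have -> : `|(s * t ^+ 2) *: w| = `|s| * `|t| ^+ 2 * `|w|.
    by rewrite normrZ normrM normrX.
  have A : `|s| * `|t| ^+ 2 * `|w| <= K * `|w| * `|t|.
    have -> : K * `|w| * `|t| = K * `|t| * `|w| by rewrite mulrAC.
    rewrite ler_wpM2r// ler_pM// ?mulr_ge0// expr2 -[leRHS]mulr1.
    by rewrite ler_wpM2l.
  rewrite !mulrDl mul1r (mulrC `|v|) -addrA lerD2l.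
  by apply: (le_trans A); rewrite lerDl.
have hd : `|h| < Num.min d0 d1.
  by apply: (le_lt_trans hM); rewrite mulrC -ltr_pdivlMr.
move: hd; rewrite lt_min => /andP[hd0 hd1]; split.
  by apply: Hd0; rewrite addrBK.
have := Hd1 h hd1; rewrite Fx0 subr0.
have -> : dotv h g = t ^+ 2 * (s * dotv w g).
  by rewrite /h dotvDl !dotvZl vg; ring.
have Eh : qf H h = t ^+ 2 * qf H v +
   t ^+ 2 * ((s * t) * (dotv (v *m H) w + dotv (w *m H) v) + (s * t) ^+ 2 * qf H w).
  have -> : h = t *: (v + (s * t) *: w).
    by rewrite /h scalerDr scalerA; congr (_ + _ *: _); ring.
  rewrite qfZ qfD qfZ -!scalemxAl !(dotvZl, dotvZr).
  by move: (qf H v) (qf H w) (dotv _ _) (dotv _ _) => a1 a2 a3 a4; ring.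
set B := _ + _ * qf H w in Eh.
have Bb : `|B| <= C * `|t|.
  apply: (le_trans (ler_normD _ _)); rewrite (normrM (s * t)) (normrM ((s * t) ^+ 2)) normrX (normrM s t).
  move: (`|dotv (v *m H) w + _|) (`|qf H w|) (normr_ge0 (dotv (v *m H) w + dotv (w *m H) v)) (normr_ge0 (qf H w)) @C C0 te => a b a0 b0 C C0 te.
  have T0 := normr_ge0 t; have S0 := normr_ge0 s.
  have A1 : `|s| * `|t| * a <= K * a * `|t|.
    have -> : K * a * `|t| = K * `|t| * a by ring.
    by rewrite ler_wpM2r// ler_wpM2r.
  have A2 : (`|s| * `|t|) ^+ 2 * b <= K ^+ 2 * b * `|t|.
    have -> : (`|s| * `|t|) ^+ 2 * b = `|s| ^+ 2 * b * (`|t| * `|t|) by ring.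
    apply: ler_pM => //.
    - by rewrite mulr_ge0// sqr_ge0.
    - by rewrite ler_wpM2r// ler_sqr ?nnegrE.
    - by rewrite -[leRHS]mulr1 ler_wpM2l.
  rewrite /C !mulrDl mul1r; apply: le_trans (lerD A1 A2) _.
  by rewrite lerDl.
rewrite -/h Eh => H1.
have T2 : 0 <= t ^+ 2 by exact: sqr_ge0.
have -> : F (x + h) - t ^+ 2 * (s * dotv w g + 2^-1 * qf H v) =
  (F (x + h) - t ^+ 2 * (s * dotv w g) - 2^-1 * (t ^+ 2 * qf H v + t ^+ 2 * B))
  + 2^-1 * (t ^+ 2 * B).
  by move: (F _) (dotv _ _) (qf H v) B {Eh Bb H1} => a1 a2 a3 a4; ring.
apply: (le_trans (ler_normD _ _)); rewrite (splitr e) [leRHS]mulrDl; apply: lerD.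
  apply: (le_trans H1).
  apply: le_trans (_ : e / 2 / M ^+ 2 * (M * `|t|) ^+ 2 <= _).
    by rewrite ler_wpM2l ?(ltW e10)// ler_sqr ?nnegrE// mulr_ge0// ltW.
  rewrite exprMn mulrA divfK ?expf_neq0 ?gt_eqF//.
  by rewrite -normrX (ger0_norm T2).
rewrite (normrM 2^-1) (normrM (t ^+ 2)) (ger0_norm T2) gtr0_norm ?invr_gt0//.
have Be : `|B| <= e.
  by apply: (le_trans Bb); rewrite mulrC ltW// -ltr_pdivlMr.
have := ler_wpM2l T2 Be.
move: (t ^+ 2 * `|B|) => a; lra.
Qed.

(** With [w] transversal, [F] changes sign as [s] runs over a small interval, so the parabolas meet
    [S] by the intermediate value theorem. Hessians thereby become statements about points of [S],
    which convexity can act on. *)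
Lemma curve_point S W F x v w : C2def S W F -> W x -> S x ->
  dotv v (gradient F x) = 0 -> dotv w (gradient F x) != 0 ->
  exists2 K : R, 0 <= K & forall e : R, 0 < e ->
  exists2 d : R, 0 < d & forall t : R, `|t| < d -> exists s : R,
    [/\ `|s| <= K, `|s * dotv w (gradient F x) + 2^-1 * qf (hess F x) v| <= e &
      S (x + (t *: v + (s * t ^+ 2) *: w))].
Proof.
move=> [oW cF gn0 SW] Wx Sx vg wg.
have Fx0 : F x = 0 by have : (S `&` W) x by []; rewrite SW => -[].
(* [k] is the zero of the leading coefficient [s * W0 + Q]. As [r <= |W0|^-1], the bound [K] covers
   every interval [k - r, k + r] and does not depend on [e]. *)
pose k := - (2^-1 * qf (hess F x) v) / dotv w (gradient F x).
pose K := `|k| + `|dotv w (gradient F x)|^-1.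
exists K; first by rewrite addr_ge0.
move=> e e0; pose e1 := Num.min 1 e.
have e10 : 0 < e1 by rewrite lt_min ltr01.
have e20 : 0 < e1 / 2 by rewrite divr_gt0.
have K0 : 0 <= K by rewrite addr_ge0.
have [d d0 Hd] := curve_expand w oW cF Wx Fx0 vg K0 e20.
exists d => // t td.
set W0 := dotv w _ in wg k K K0 Hd *; set Q := 2^-1 * _ in k K K0 Hd *.
pose r := e1 / `|W0|.
have W00 : 0 < `|W0| by rewrite normr_gt0.
have r0 : 0 < r by rewrite divr_gt0.
have sK s : s \in `[k - r, k + r] -> `|s| <= K /\ `|s * W0 + Q| <= e1.
  rewrite in_itv /= => sr.
  have kr : `|s - k| <= r.
    by move: sr => /andP[? ?]; rewrite ler_norml; apply/andP; split; lra.
  split.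
    rewrite -[s](subrK k) addrC (le_trans (ler_normD _ _))// lerD2l.
    apply: (le_trans kr); rewrite /r ler_piMl ?invr_ge0//.
    by rewrite /e1 ge_min lexx.
  have -> : s * W0 + Q = (s - k) * W0 by rewrite /k; field.
  by rewrite normrM -ler_pdivlMr.
pose phi (s : R) := F (x + (t *: v + (s * t ^+ 2) *: w)).
have rr : k - r <= k + r by lra.
have cphi : {within `[k - r, k + r], continuous phi}.
  apply: continuous_in_subspaceT => s /set_mem /= sI.
  have [sK1 _] := sK s sI; have [Ws _] := Hd t s td sK1.
  have Ephi : phi = (fun s => F (x + t *: v + s *: (t ^+ 2 *: w))).
    by apply/funext => s'; rewrite /phi scalerA addrA.
  have Es : x + (t *: v + (s * t ^+ 2) *: w) = x + t *: v + s *: (t ^+ 2 *: w).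
    by rewrite scalerA addrA.
  rewrite Es in Ws.
  rewrite Ephi; apply/differentiable_continuous/derivable1_diffP.
  have [+ _] := fdiff_is_derive (t ^+ 2 *: w) (C2_fdiff oW cF Ws).
  by move=> /is_derive_line[].
have HT s : s \in `[k - r, k + r] -> `|phi s - t ^+ 2 * (s * W0 + Q)| <= e1 / 2 * t ^+ 2.
  by move=> /sK[s1 _]; have [_] := Hd t s td s1.
have T2 : 0 <= t ^+ 2 by exact: sqr_ge0.
have E1 : `|phi (k - r) - t ^+ 2 * (- (r * W0))| <= e1 / 2 * t ^+ 2.
  have -> : - (r * W0) = (k - r) * W0 + Q by rewrite /k; field.
  by apply: HT; rewrite in_itv /= lexx.
have E2 : `|phi (k + r) - t ^+ 2 * (r * W0)| <= e1 / 2 * t ^+ 2.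
  have -> : r * W0 = (k + r) * W0 + Q by rewrite /k; field.
  by apply: HT; rewrite in_itv /= lexx andbT.
have [s sI Es] : exists2 s, s \in `[k - r, k + r] & phi s = 0.
  apply: IVT => //; rewrite ge_min le_max.
  have rW : r * `|W0| = e1 by rewrite /r divfK// gt_eqF.
  move: E1 E2; rewrite !ler_norml => /andP[A1 A2] /andP[B1 B2].
  have e1t : 0 <= e1 * t ^+ 2 by rewrite mulr_ge0// ltW.
  have [Wp|Wn] := leP 0 W0.
    rewrite ger0_norm // in rW; rewrite rW in A1 A2 B1 B2.
    apply/andP; split; apply/orP; [left|right]; nra.
  rewrite ltr0_norm // mulrN in rW.
  have rW' : r * W0 = - e1 by rewrite -rW opprK.
  rewrite rW' in A1 A2 B1 B2.
  apply/andP; split; apply/orP; [right|left]; nra.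
have [s1 s2] := sK s sI; have [Ws _] := Hd t s td s1.
exists s; split => //.
  by apply: (le_trans s2); rewrite /e1 ge_min lexx orbT.
have : [set x | W x /\ F x = 0] (x + (t *: v + (s * t ^+ 2) *: w)) by split.
by rewrite -SW => -[].
Qed.

(** Converse of [curve_point]: whichever way a point of [S] on such a parabola was found, its [s] is
    nearly determined by [F]. *)
Lemma point_curve S W F x v w : C2def S W F -> W x -> S x ->
  dotv v (gradient F x) = 0 -> forall K e : R, 0 <= K -> 0 < e ->
  exists2 d : R, 0 < d & forall t s : R, 0 < `|t| < d -> `|s| <= K ->
    S (x + (t *: v + (s * t ^+ 2) *: w)) ->
    `|s * dotv w (gradient F x) + 2^-1 * qf (hess F x) v| <= e.
Proof.
move=> [oW cF gn0 SW] Wx Sx vg K e K0 e0.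
have Fx0 : F x = 0 by have : (S `&` W) x by []; rewrite SW => -[].
have [d d0 Hd] := curve_expand w oW cF Wx Fx0 vg K0 e0.
exists d => // t s /andP[t0 td] sK Ss; have [Ws] := Hd t s td sK.
have -> : F (x + (t *: v + (s * t ^+ 2) *: w)) = 0.
  by have : (S `&` W) (x + (t *: v + (s * t ^+ 2) *: w)) by []; rewrite SW => -[].
rewrite sub0r normrN normrM ger0_norm ?sqr_ge0// mulrC ler_pM2r//.
by rewrite -[t ^+ 2]ger0_norm ?sqr_ge0// normrX exprn_gt0.
Qed.

End Curves.

Section Normals.
Variables (R : realType) (n : nat).
Notation V := 'rV[R]_n.
Implicit Types (F : V -> R) (C S W : set V) (x y z u v w : V).

(** If [u] grew in a tangent direction [v], a boundary curve with velocity [v] would cross the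
    supporting hyperplane, its t^2 correction being negligible. So [u] is orthogonal to the tangent
    space. The sign of the factor stays open, since [F] may be positive on either side. *)
Lemma outer_normal_gradient C W F x u : bdry C `<=` C -> C2def (bdry C) W F ->
  W x -> bdry C x -> outer_unit_normal C x u ->
  gradient F x = dotv u (gradient F x) *: u /\ dotv u (gradient F x) != 0.
Proof.
move=> bC dF Wx bx [u1 un]; set g := gradient F x.
have gn0 : g != 0 by case: dF => _ _ + _; apply.
have gg : dotv g g != 0 by rewrite dotv_eq0.
have tang v : dotv v g = 0 -> dotv u v <= 0.
  move=> vg; rewrite leNgt; apply/negP => a0.
  have [K K0 HK] := curve_point dF Wx bx vg gg.
  have [d d0 Hd] := HK 1 ltr01.
  pose G := `|dotv u g|.
  have KG : 0 < K * G + 1 by rewrite ltr_wpDl// mulr_ge0// normr_ge0.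
  pose t := Num.min (d / 2) (dotv u v / (K * G + 1)).
  have t0 : 0 < t by rewrite lt_min !divr_gt0.
  have td : `|t| < d.
    by rewrite gtr0_norm// gt_min ltr_pdivrMr// ltr_pMr// ltr1n.
  have [s [sK _ /bC/un]] := Hd t td.
  rewrite addrBK dotvDr !dotvZr leNgt => /negP; apply.
  have -> : t * dotv u v + s * t ^+ 2 * dotv u g = t * (dotv u v + t * (s * dotv u g)).
    by move: (dotv u v) (dotv u g) => a b; ring.
  rewrite mulr_gt0//.
  have sG : `|s * dotv u g| <= K * G by rewrite normrM ler_wpM2r.
  have tG : t * (K * G + 1) <= dotv u v by rewrite -ler_pdivlMr// ge_min lexx orbT.
  move: sG; rewrite ler_norml => /andP[sG _].
  by have := ler_wpM2l (ltW t0) sG; nra.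
have tang0 v : dotv v g = 0 -> dotv u v = 0.
  move=> vg; apply/eqP; rewrite eq_le tang//= -oppr_le0 -dotvNr tang//.
  by rewrite dotvNl vg oppr0.
have ug : u = (dotv u g / dotv g g) *: g.
  apply/eqP; rewrite -subr_eq0 -dotv_eq0; set v := u - _.
  have vg : dotv v g = 0 by rewrite dotvBl dotvZl divfK// subrr.
  by rewrite {1}/v dotvBl dotvZl tang0// (dotvC g) vg mulr0 subrr.
have c0 : dotv u g != 0.
  apply/eqP => E; move: u1; rewrite ug E mul0r scale0r dotv0l => /eqP.
  by rewrite eq_sym oner_eq0.
split=> //; rewrite {2}ug scalerA -{1}[g]scale1r; congr (_ *: _).
by have := u1; rewrite {2}ug dotvZr mulrC => <-.
Qed.

(** The boundary points x + t v + s t^2 u lie below the supporting hyperplane, so [s <= 0], whereas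
    [s] times the factor [c] is nearly minus half the Hessian value. That factor corrects for the
    sign of [F]. *)
Lemma hess_tangent_ge0 C W F x u v : bdry C `<=` C -> C2def (bdry C) W F ->
  W x -> bdry C x -> outer_unit_normal C x u -> dotv u v = 0 ->
  0 <= dotv u (gradient F x) * qf (hess F x) v.
Proof.
move=> bC dF Wx bx un uv.
have [Eg c0] := outer_normal_gradient bC dF Wx bx un.
set c := dotv u _ in Eg c0 *.
have vg : dotv v (gradient F x) = 0 by rewrite Eg dotvZr dotvC uv mulr0.
have [K K0 HK] := curve_point dF Wx bx vg c0.
case: un => u1 un.
rewrite leNgt; apply/negP => q0.
have e0 : 0 < - (c * qf (hess F x) v) / (4 * `|c|).
  by rewrite divr_gt0 ?oppr_gt0// mulr_gt0// normr_gt0.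
have [d d0 Hd] := HK _ e0.
pose t := d / 2; have t0 : 0 < t by rewrite divr_gt0.
have [|s [sK E /bC/un]] := Hd t; first by rewrite gtr0_norm// /t; lra.
rewrite addrBK dotvDr !dotvZr uv mulr0 add0r u1 mulr1 => st.
have s0 : s <= 0 by rewrite -(@pmulr_lle0 _ (t ^+ 2)) ?exprn_gt0.
move: E; rewrite -/c ler_pdivlMr ?mulr_gt0 ?normr_gt0//.
have -> : `|s * c + 2^-1 * qf (hess F x) v| * (4 * `|c|) =
   `|4 * (c ^+ 2 * s) + 2 * (c * qf (hess F x) v)|.
  have -> : 4 * (c ^+ 2 * s) + 2 * (c * qf (hess F x) v) =
    (s * c + 2^-1 * qf (hess F x) v) * (4 * c).
    by move: (qf _ _) => a; field.
  by rewrite !normrM (@ger0_norm _ 4).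
rewrite ler_norml => /andP[+ _].
have : c ^+ 2 * s <= 0 by rewrite mulr_ge0_le0// sqr_ge0.
move: (c ^+ 2 * s) (c * qf _ _) q0 => a b; lra.
Qed.

(** Degenerate directions belong to the body, not to the defining function: points supplied by
    [curve_point] for [F'] are tested with [point_curve] for [F]. This matters because [Zset] brings
    its own defining function. *)
Lemma hess_tangent_eq0 C W F W' F' x u v : bdry C `<=` C ->
  C2def (bdry C) W F -> C2def (bdry C) W' F' ->
  W x -> W' x -> bdry C x -> outer_unit_normal C x u -> dotv u v = 0 ->
  qf (hess F' x) v = 0 -> qf (hess F x) v = 0.
Proof.
move=> bC dF dF' Wx Wx' bx un uv q0.
have [Eg c0] := outer_normal_gradient bC dF Wx bx un.
have [Eg' c0'] := outer_normal_gradient bC dF' Wx' bx un.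
set c := dotv u (gradient F x) in Eg c0 *.
set c' := dotv u (gradient F' x) in Eg' c0' *.
have vg : dotv v (gradient F x) = 0 by rewrite Eg dotvZr dotvC uv mulr0.
have vg' : dotv v (gradient F' x) = 0 by rewrite Eg' dotvZr dotvC uv mulr0.
have [K K0 HK] := curve_point dF' Wx' bx vg' c0'.
apply/eqP; rewrite -normr_le0; apply/ler_addgt0Pl => e e0; rewrite addr0.
have e4 : 0 < e / 4 by rewrite divr_gt0.
have cc : 0 < e / 4 * (`|c'| / `|c|) by rewrite mulr_gt0// divr_gt0// normr_gt0.
have [d d0 Hd] := HK _ cc.
have [d' d0' Hd'] := point_curve u dF Wx bx vg K0 e4.
pose t := Num.min d d' / 2.
have t0 : 0 < t by rewrite divr_gt0// lt_min d0.
have /andP[td td'] : (`|t| < d) && (`|t| < d').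
  by rewrite -lt_min gtr0_norm// ltr_pdivrMr// ltr_pMr ?ltr1n// lt_min d0.
have [s [sK E1 Sy]] := Hd t td.
have tt : 0 < `|t| < d' by rewrite td' gtr0_norm// t0.
have := Hd' t s tt sK Sy.
move: E1; rewrite q0 mulr0 addr0 -/c -/c' normrM mulrA ler_pdivlMr ?normr_gt0// => E1 E2.
have E3 : `|s * c| <= e / 4.
  rewrite normrM; rewrite -(@ler_pM2l _ `|c'|) ?normr_gt0//.
  by move: E1; rewrite [_ * `|c'| * _]mulrAC mulrC [leRHS]mulrC.
move: E2 E3; rewrite !ler_norml => /andP[A1 A2] /andP[B1 B2].
move: (qf _ _) (s * c) A1 A2 B1 B2 => a b A1 A2 B1 B2; clear -A1 A2 B1 B2 e0.
by apply/andP; split; lra.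
Qed.

(** A segment in the surface is a parabola with [s = 0]. *)
Lemma hess_segment_eq0 S W F x v : C2def S W F -> W x ->
  (forall t : R, 0 <= t <= 1 -> S (x + t *: v)) ->
  dotv v (gradient F x) = 0 -> qf (hess F x) v = 0.
Proof.
move=> dF Wx Sv vg.
have Sx : S x by have := Sv 0; rewrite lexx ler01 scale0r addr0; apply.
apply/eqP; rewrite -normr_le0; apply/ler_addgt0Pl => e e0; rewrite addr0.
have e2 : 0 < e / 2 by rewrite divr_gt0.
have [d d0 Hd] := point_curve 0 dF Wx Sx vg (lexx 0) e2.
pose t := Num.min 1 d / 2.
have t0 : 0 < t by rewrite divr_gt0// lt_min ltr01.
have /andP[t1 td] : (t < 1) && (t < d).
  by rewrite -lt_min ltr_pdivrMr// ltr_pMr ?ltr1n// lt_min ltr01.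
have tt : 0 < `|t| < d by rewrite gtr0_norm// t0.
have t01 : 0 <= t <= 1 by rewrite !ltW.
have := Hd t 0 tt; rewrite normr0 !mul0r scale0r addr0 add0r => /(_ (lexx 0) (Sv t t01)).
rewrite normrM ger0_norm ?invr_ge0//; move: (`|_|) => a; lra.
Qed.

(** If the Hessian vanished at [v], boundary points x + t v + s t^2 u would exist with [s] at least
    -|v|^2 / (4 r). Their squared distance to [z] contains r^2 + t^2 (|v|^2 + 2 s r), which exceeds
    r^2. *)
Lemma hess_far_neq0 C W F x z (r : R) u v : bdry C `<=` C -> C2def (bdry C) W F ->
  W x -> bdry C x -> outer_unit_normal C x u -> dotv u v = 0 -> v != 0 ->
  0 < r -> x - z = r *: u ->
  (forall y, C y -> dotv (y - z) (y - z) <= r ^+ 2) -> qf (hess F x) v != 0.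
Proof.
move=> bC dF Wx bx un uv v0 r0 xz far; apply/eqP => q0.
have [Eg c0] := outer_normal_gradient bC dF Wx bx un.
set c := dotv u _ in Eg c0 *.
have vg : dotv v (gradient F x) = 0 by rewrite Eg dotvZr dotvC uv mulr0.
have [K K0 HK] := curve_point dF Wx bx vg c0.
have vv := dotv_gt0 v0.
have e0 : 0 < dotv v v / (4 * r) * `|c|.
  by rewrite mulr_gt0 ?normr_gt0// divr_gt0// mulr_gt0.
have [d d0 Hd] := HK _ e0.
pose t := d / 2; have t0 : 0 < t by rewrite divr_gt0.
have [|s [sK E /bC/far]] := Hd t; first by rewrite gtr0_norm// /t; lra.
case: un => u1 un.
rewrite addrAC xz !(dotvDl, dotvDr, dotvZl, dotvZr) (dotvC v u) uv u1.
move: E; rewrite q0 mulr0 addr0 -/c normrM ler_pM2r ?normr_gt0//.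
rewrite ler_pdivlMr ?mulr_gt0// => E.
have [sE _] : - (dotv v v) <= s * (4 * r) /\ True.
  split=> //; move: E; rewrite -[4 * r]gtr0_norm ?mulr_gt0// -normrM ler_norml.
  by rewrite gtr0_norm ?mulr_gt0// => /andP[].
have T2 : 0 < t ^+ 2 by rewrite exprn_gt0.
move: (dotv v v) vv sE {E Hd sK e0} => a vv sE.
rewrite leNgt => /negP; apply.
rewrite [ltRHS](_ : _ = r ^+ 2 + t ^+ 2 * (a + 2 * (s * r)) + (s * t ^+ 2) ^+ 2); last by ring.
rewrite -addrA ltrDl; apply: ltr_pwDl; last exact: sqr_ge0.
by rewrite mulr_gt0//; lra.
Qed.

End Normals.

(** * Gaussian curvature and the Hessian *)

Lemma is_derive_sum_seq (R : realType) (W : normedModType R) (I : Type) (s : seq I)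
    (f : I -> W -> R) (x v : W) (l : I -> R) :
  (forall i, is_derive x v (f i) (l i)) ->
  is_derive x v (fun z => \sum_(i <- s) f i z) (\sum_(i <- s) l i).
Proof.
move=> H; elim: s => [|i s IH].
  under eq_fun do rewrite big_nil; rewrite big_nil; exact: is_derive_cst.
by under eq_fun do rewrite big_cons; rewrite big_cons; exact: is_deriveD.
Qed.

Section Gauss.
Variables (R : realType) (n : nat).
Notation V := 'rV[R]_n.
Implicit Types (F : V -> R) (C S W : set V) (x y z u v w : V).

Lemma is_derive_comp1 (f : R -> R) (g : V -> R) x v (a b : R) :
  is_derive (g x) 1 f a -> is_derive x v g b -> is_derive x v (fun z => f (g z)) (a * b).
Proof.
move=> Df Dg.
have Dg' : is_derive (0 : R) 1 (fun t : R => g (x + t *: v)) b.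
  move/is_deriveP : Dg => Dg; apply/is_deriveP => e /Dg[d d0 Hd]; exists d => // h hd.
  by rewrite add0r [h *: _]mulr1 scale0r addr0; apply: Hd.
have Df' : is_derive (g (x + 0 *: v)) 1 f a by rewrite scale0r addr0.
have /is_deriveP D := is_derive1_comp Df' Dg'.
apply/is_deriveP => e /D[d d0 Hd]; exists d => // h /Hd.
by rewrite /= add0r [h *: _]mulr1 scale0r addr0.
Qed.

Lemma is_derive_mul (f g : V -> R) x v (a b : R) :
  is_derive x v f a -> is_derive x v g b ->
  is_derive x v (fun z => f z * g z) (f x * b + g x * a).
Proof. exact: (@is_deriveM R V f g x v a b). Qed.

Lemma is_derive_inv (f : V -> R) x v (l : R) : f x != 0 ->
  is_derive x v f l -> is_derive x v (fun z => (f z)^-1) (- (f x) ^- 2 * l).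
Proof.
move=> f0 [df <-]; apply: DeriveDef; first exact: derivableV.
by rewrite deriveV.
Qed.

(** Differentiating the normalizing factor only adds a term with values along the gradient, so on
    tangent vectors the differential of [nu] is [rho] times the Hessian modulo the normal. The
    second equation holds because [nu] has constant length. *)
Lemma gauss_jacobian W F x : open W -> C2on W F -> W x -> gradient F x != 0 ->
  let g := gradient F x in
  let nu := fun y => (Num.sqrt (dotv (gradient F y) (gradient F y)))^-1 *: gradient F y in
  let rho := (Num.sqrt (dotv g g))^-1 in
  exists a : V, \matrix_(i, j) (derive nu x (evec R i)) 0 j = a^T *m g + rho *: hess F x
    /\ (a^T *m g + rho *: hess F x) *m g^T = 0.
Proof.
move=> oW cF Wx g0 g nu rho.
have gg : 0 < dotv g g by exact: dotv_gt0.
have sg : 0 < Num.sqrt (dotv g g) by rewrite sqrtr_gt0.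
have D1 i k : is_derive x (evec R i) (pd k F) (pd i (pd k F) x).
  by have [_ _ + _] := cF x Wx => /(_ i k)/pdP.
pose b i := \sum_k g 0 k * pd i (pd k F) x.
have Dq i : is_derive x (evec R i) (fun y => dotv (gradient F y) (gradient F y)) (2 * b i).
  have -> : (fun y => dotv (gradient F y) (gradient F y)) = (fun y => \sum_k pd k F y * pd k F y).
    by apply/funext => y; rewrite dotvE; apply: eq_bigr => k _; rewrite gradientE.
  have -> : 2 * b i = \sum_k (pd k F x * pd i (pd k F) x + pd k F x * pd i (pd k F) x).
    by rewrite /b mulr_sumr; apply: eq_bigr => k _; rewrite gradientE; ring.
  by apply: is_derive_sum_seq => k; apply: is_derive_mul.
have Drho i : is_derive x (evec R i) (fun y => (Num.sqrt (dotv (gradient F y) (gradient F y)))^-1)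
    (- (rho ^+ 3 * b i)).
  have Ds : is_derive (dotv g g) 1 Num.sqrt (2 * Num.sqrt (dotv g g))^-1.
    exact: is_derive1_sqrt.
  have Dc := is_derive_comp1 (g := fun y => dotv (gradient F y) (gradient F y)) Ds (Dq i).
  have s0 : Num.sqrt (dotv g g) != 0 by rewrite gt_eqF.
  have := @is_derive_inv (fun y => Num.sqrt (dotv (gradient F y) (gradient F y))) x _ _ s0 Dc.
  congr (is_derive _ _ _ _); rewrite /rho; move: (Num.sqrt _) sg {Ds Dc s0 Dq} => s s0.
  by move: (b i) => c; field; rewrite gt_eqF.
exists (\row_i (- (rho ^+ 3 * b i))); split.
  apply/matrixP => i j; rewrite !mxE big_ord_recl big_ord0 addr0 !mxE.
  have Dij k : is_derive x (evec R i) (fun y => nu y 0 k)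
      (rho * pd i (pd k F) x + pd k F x * - (rho ^+ 3 * b i)).
    have -> : (fun y => nu y 0 k) =
      (fun y => (Num.sqrt (dotv (gradient F y) (gradient F y)))^-1 * pd k F y).
      by apply/funext => y; rewrite mxE gradientE.
    by apply: is_derive_mul.
  rewrite derive_mx ?mxE; last first.
    by apply/derivable_mxP => p k; rewrite ord1; have [] := Dij k.
  by have [_ ->] := Dij j; rewrite -pd_partial; ring.
apply/matrixP => i k; rewrite ord1 !mxE.
rewrite (eq_bigr (fun j => - (rho ^+ 3 * b i) * (g 0 j * g 0 j) + rho * (g 0 j * pd i (pd j F) x))).
  rewrite big_split /= -!mulr_sumr -/(b i) -dotvE.
  have -> : dotv g g = rho ^- 2 by rewrite /rho exprVn invrK sqr_sqrtr// ltW.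
  have : rho != 0 by rewrite invr_neq0// gt_eqF.
  by move: (b i) => c r0; field.
move=> j _; rewrite /g !mxE big_ord_recl big_ord0 addr0 !mxE -!pd_partial.
by move: (b i) (pd j F x) (pd i _ _) (rho) => c1 c2 c3 c4; ring.
Qed.

(** A null vector of the matrix in [gauss_curv] is tangent: multiplied by the gradient, the [J] part
    vanishes and [N] acts as the identity. *)
Lemma gauss_curv_eq0 W F x : open W -> C2on W F -> W x -> gradient F x != 0 ->
  gauss_curv F x = 0 -> exists v, [/\ v != 0, dotv v (gradient F x) = 0 & qf (hess F x) v = 0].
Proof.
move=> oW cF Wx g0; have [a [EJ Jg]] := gauss_jacobian oW cF Wx g0.
rewrite /gauss_curv /= EJ.
set g := gradient F x in g0 EJ Jg *; set rho := (Num.sqrt _)^-1 in EJ Jg *.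
set J := _ + _ in Jg *; move=> /eqP/det0P[v v0 vM].
have gg : 0 < dotv g g by exact: dotv_gt0.
have r0 : rho != 0 by rewrite invr_neq0// gt_eqF// sqrtr_gt0.
have rg : rho ^+ 2 * dotv g g = 1.
  by rewrite /rho exprVn sqr_sqrtr ?(ltW gg)// mulVf// gt_eqF.
set N := _^T *m _ in vM.
have ET : (rho *: g)^T = rho *: g^T by apply/matrixP => i j; rewrite !mxE.
have Ng : N *m g^T = g^T.
  rewrite /N ET -scalemxAl -scalemxAr scalerA -scalemxAl -mulmxA.
  rewrite (_ : g *m g^T = (dotv g g)%:M); last first.
    by apply/matrixP => i j; rewrite !ord1 [RHS]mxE eqxx mulr1n.
  by rewrite mul_mx_scalar scalerA -expr2 rg scale1r.
have vg : v *m g^T = 0.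
  have : (v *m ((1%:M - N) *m J + N)) *m g^T = 0 by rewrite vM mul0mx.
  by rewrite -mulmxA (mulmxDl (_ *m J)) -(mulmxA _ J) Jg mulmx0 add0r Ng.
have vg' : dotv v g = 0 by rewrite /dotv vg mxE.
have vN : v *m N = 0.
  by rewrite /N ET mulmxA -!scalemxAr vg scaler0 mul0mx scaler0.
have vJ : v *m J = 0.
  by move: vM; rewrite mulmxDr mulmxA mulmxBr mulmx1 vN subr0 addr0.
exists v; split => //.
have : rho * qf (hess F x) v = 0.
  have -> : rho * qf (hess F x) v = dotv (v *m J) v - dotv (v *m (a^T *m g)) v.
    by rewrite /J mulmxDr dotvDl -scalemxAr dotvZl /qf addrAC subrr add0r.
  rewrite vJ dotv0l mulmxA (_ : v *m a^T = (dotv v a)%:M); last first.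
    by apply/matrixP => i j; rewrite !ord1 [RHS]mxE eqxx mulr1n.
  by rewrite mul_scalar_mx dotvZl (dotvC g) vg' mulr0 subrr.
by move=> /eqP; rewrite mulf_eq0 (negbTE r0) => /eqP.
Qed.

(** A zero of a quadratic form need not be a null vector, but it is one when the form is
    semidefinite. Hence [v *m hess F x] is normal, and then [v *m J] vanishes because it is both
    normal and tangent. *)
Lemma eq0_gauss_curv W F x (c : R) v : open W -> C2on W F -> W x -> gradient F x != 0 ->
  c != 0 -> (forall w, dotv w (gradient F x) = 0 -> 0 <= c * qf (hess F x) w) ->
  v != 0 -> dotv v (gradient F x) = 0 -> qf (hess F x) v = 0 -> gauss_curv F x = 0.
Proof.
move=> oW cF Wx g0 c0 psd v0 vg qv; have [a [EJ Jg]] := gauss_jacobian oW cF Wx g0.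
rewrite /gauss_curv /= EJ.
set g := gradient F x in g0 EJ Jg vg psd *; set rho := (Num.sqrt _)^-1 in EJ Jg *.
set J := _ + _ in Jg *.
have gg : dotv g g != 0 by rewrite dotv_eq0.
have Hsym w : dotv (w *m hess F x) v = dotv (v *m hess F x) w.
  have Ht : (hess F x)^T = hess F x.
    by apply/matrixP => i j; rewrite !mxE; apply: hess_sym oW cF Wx.
  by rewrite dotvC /dotv trmx_mul Ht mulmxA.
have orth w : dotv w g = 0 -> dotv (v *m hess F x) w = 0.
  move=> wg; set B := dotv _ _.
  have H t : 0 <= c * (2 * (t * B) + t ^+ 2 * qf (hess F x) w).
    have := psd (v + t *: w); rewrite dotvDl dotvZl vg wg mulr0 addr0 => /(_ erefl).
    rewrite qfD qfZ qv add0r -scalemxAl dotvZl dotvZr Hsym -/B.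
    by rewrite (_ : t * B + t * B = 2 * (t * B)); last by ring.
  set q := qf _ w in H.
  apply/eqP/negPn/negP => B0.
  pose k := c * q; pose b := c * B.
  have b0 : b != 0 by rewrite mulf_neq0.
  have H' t : 0 <= 2 * (t * b) + t ^+ 2 * k.
    by have := H t; rewrite (_ : c * _ = 2 * (t * b) + t ^+ 2 * k) // /b /k; ring.
  have k1 : 0 < `|k| + 1 by rewrite ltr_wpDl.
  (* For this [t] the linear term outweighs the quadratic one and the value is negative. *)
  have := H' (- b / (`|k| + 1)).
  have -> : 2 * (- b / (`|k| + 1) * b) + (- b / (`|k| + 1)) ^+ 2 * k =
     (b / (`|k| + 1)) ^+ 2 * (k - 2 * (`|k| + 1)).
    by field; rewrite gt_eqF.
  have bb : 0 < (b / (`|k| + 1)) ^+ 2.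
    by rewrite lt_neqAle sqr_ge0 andbT eq_sym expf_neq0// mulf_neq0// invr_neq0// gt_eqF.
  by rewrite pmulr_rge0// => H2; have := ler_norm k; lra.
have vH : v *m hess F x = (dotv (v *m hess F x) g / dotv g g) *: g.
  apply/eqP; rewrite -subr_eq0 -dotv_eq0; set w := _ - _.
  have wg : dotv w g = 0 by rewrite dotvBl dotvZl divfK// subrr.
  by rewrite {1}/w dotvBl dotvZl orth// (dotvC g) wg mulr0 subrr.
have [mu Emu] : exists mu : R, v *m J = mu *: g.
  exists (dotv v a + rho * (dotv (v *m hess F x) g / dotv g g)).
  rewrite /J mulmxDr -scalemxAr {1}vH mulmxA (_ : v *m a^T = (dotv v a)%:M); last first.
    by apply/matrixP => i j; rewrite !ord1 [RHS]mxE eqxx mulr1n.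
  by rewrite mul_scalar_mx scalerA scalerDl.
have vJ : v *m J = 0.
  have : dotv (v *m J) g = 0 by rewrite /dotv -mulmxA Jg mulmx0 mxE.
  by rewrite Emu dotvZl => /eqP; rewrite mulf_eq0 (negbTE gg) orbF => /eqP ->; rewrite scale0r.
apply/eqP/det0P; exists v => //.
have vN : v *m (((rho *: g)^T) *m (rho *: g)) = 0.
  have -> : (rho *: g)^T = rho *: g^T by apply/matrixP => i j; rewrite !mxE.
  have vg0 : v *m g^T = 0.
    by apply/matrixP => i j; rewrite !ord1 [RHS]mxE; exact: vg.
  by rewrite mulmxA -!scalemxAr vg0 scaler0 mul0mx scaler0.
by rewrite mulmxDr mulmxA mulmxBr mulmx1 vN subr0 vJ addr0.
Qed.

End Gauss.

(** * Convex bodies *)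

Section ConvexGeometry.
Variables (R : realType) (n : nat).
Notation V := 'rV[R]_n.
Implicit Types (A B C S W : set V) (p q x y z u v w : V).

Lemma compact_closed_rV m (C : set 'rV[R]_m) : compact C -> closed C.
Proof. by apply: compact_closed; exact: norm_hausdorff. Qed.

Lemma closed_norm m (C : set 'rV[R]_m) (x : 'rV[R]_m) : closed C -> ~ C x ->
  exists2 d : R, 0 < d & forall y : 'rV[R]_m, `|y - x| < d -> ~ C y.
Proof.
move=> cC nCx; have oC : open (~` C) by exact: closed_openC.
exact: (open_norm oC nCx).
Qed.

Lemma bdry_sub C : compact C -> bdry C `<=` C.
Proof. by move=> /compact_closed_rV cC x [+ _]; exact: cC. Qed.

Lemma unit_neq0 u : dotv u u = 1 -> u != 0.
Proof. by move=> u1; rewrite -dotv_eq0 u1 oner_eq0. Qed.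

Lemma outer_normal_interior C q x u :
  interior C q -> outer_unit_normal C x u -> dotv u (q - x) < 0.
Proof.
move=> /nbhsE_norm[e e0 He] [u1 un].
have u0 : 0 < `|u| by rewrite normr_gt0 unit_neq0.
pose t := e / (2 * `|u|); have t0 : 0 < t by rewrite divr_gt0// mulr_gt0.
have /un : C (q + t *: u).
  apply: He; rewrite addrBK normrZ gtr0_norm// /t -mulrA invfM -mulrA mulVf ?gt_eqF// mulr1.
  by rewrite ltr_pdivrMr// ltr_pMr// ltr1n.
rewrite addrAC (dotvDr (q - x)) dotvZr u1 mulr1; lra.
Qed.

Lemma outer_normal_bdry C x u : C x -> outer_unit_normal C x u -> bdry C x.
Proof.
move=> Cx un; split; first exact: subset_closure.
by move=> /outer_normal_interior/(_ un); rewrite subrr dotv0r ltxx.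
Qed.

Lemma dotv_close u v (a : R) : dotv u v > a ->
  exists2 d : R, 0 < d & forall u' v', `|u' - u| < d -> `|v' - v| < d -> dotv u' v' > a.
Proof.
move=> uv; pose e := dotv u v - a; have e0 : 0 < e by rewrite subr_gt0.
pose M := n%:R * (`|u| + `|v| + 1) + 1.
have M0 : 0 < M by rewrite ltr_wpDl// mulr_ge0// !addr_ge0.
exists (Num.min 1 (e / (2 * M))); first by rewrite lt_min ltr01 divr_gt0// mulr_gt0.
move=> u' v'; rewrite !lt_min !ltr_pdivlMr ?mulr_gt0// => /andP[u1 ue] /andP[v1 ve].
have -> : dotv u' v' = dotv u v + dotv (u' - u) v' + dotv u (v' - v).
  by rewrite dotvBl dotvBr; move: (dotv _ _) (dotv u v') (dotv u v) => a1 a2 a3; ring.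
have B1 := dotv_norm_le (u' - u) v'; have B2 := dotv_norm_le u (v' - v).
have v'b : `|v'| <= `|v| + 1.
  rewrite -[v'](subrK v) addrC; apply: (le_trans (ler_normD _ _)).
  by rewrite lerD2l ltW.
have n0 : 0 <= n%:R :> R by [].
have nv : n%:R * `|v'| <= M.
  have := ler_wpM2l n0 v'b; have : 0 <= n%:R * `|u| by rewrite mulr_ge0.
  by rewrite /M !mulrDr; move: (n%:R * `|u|) (n%:R * `|v|) (n%:R * `|v'|) => a1 a2 a3; lra.
have nu : n%:R * `|u| <= M.
  have : 0 <= n%:R * `|v| by rewrite mulr_ge0.
  by rewrite /M !mulrDr; move: (n%:R * `|u|) (n%:R * `|v|) => a1 a2; lra.
have C1 : `|dotv (u' - u) v'| <= `|u' - u| * M.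
  by apply: (le_trans B1); rewrite mulrAC mulrC ler_wpM2l.
have C2 : `|dotv u (v' - v)| <= `|v' - v| * M.
  by apply: (le_trans B2); rewrite mulrC ler_wpM2l.
move: C1 C2; rewrite !ler_norml => /andP[C1 _] /andP[C2 _].
rewrite /e in ue ve; move: (dotv _ v') (dotv u (v' - v)) C1 C2 => a1 a2; lra.
Qed.

Lemma continuous_dotv_sqr q : continuous (fun y : V => dotv (y - q) (y - q)).
Proof.
move=> y; apply/continuousP_norm => e e0.
have [|d1 d10 H1] := @dotv_close (y - q) (y - q) (dotv (y - q) (y - q) - e); first lra.
have [|d2 d20 H2] := @dotv_close (- (y - q)) (y - q) (- dotv (y - q) (y - q) - e).
  by rewrite dotvNl; lra.
exists (Num.min d1 d2); first by rewrite lt_min d10.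
move=> z; rewrite lt_min => /andP[z1 z2].
have E : z - q - (y - q) = z - y by rewrite opprB addrA subrK.
have := H1 (z - q) (z - q); rewrite E => /(_ z1 z1) A1.
have := H2 (- (z - q)) (z - q); rewrite -opprD normrN E dotvNl => /(_ z2 z2) A2.
by rewrite ltr_norml; apply/andP; split; lra.
Qed.

(** The normal is [q - c], where [c] is the point of [C] nearest to [q]. *)
Lemma separation C q : compact C -> Defs.convex_set C -> C !=set0 -> ~ C q ->
  exists2 u, dotv u u = 1 & forall y, C y -> dotv u (y - q) <= 0.
Proof.
move=> cC vC C0 nCq.
have [] := @EVT_min_rV R n (fun y => dotv (y - q) (y - q)) C C0 cC.
  by apply: continuous_subspaceT; exact: continuous_dotv_sqr.
move=> c /set_mem Cc cmin.
pose w := q - c.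
have w0 : w != 0 by rewrite subr_eq0; apply: contra_notN nCq => /eqP ->.
have ww := dotv_gt0 w0.
have key y : C y -> dotv w (y - c) <= 0.
  move=> Cy; rewrite leNgt; apply/negP => a0.
  set a := dotv w _ in a0; pose b := dotv (y - c) (y - c).
  have b0 : 0 <= b by exact: dotv_ge0.
  (* So small that the linear gain [2 * t * a] beats the quadratic loss [t ^+ 2 * b]. *)
  pose t := Num.min 1 (a / (b + 1)).
  have t0 : 0 < t by rewrite lt_min ltr01 divr_gt0// ltr_wpDl.
  have t1 : t <= 1 by rewrite ge_min lexx.
  have tb : t * (b + 1) <= a by rewrite -ler_pdivlMr ?ltr_wpDl// ge_min lexx orbT.
  have Ct : C (t *: y + (1 - t) *: c) by apply: vC => //; rewrite t1 ltW.
  have := cmin _ (mem_set Ct).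
  have -> : t *: y + (1 - t) *: c - q = t *: (y - c) - w.
    by apply/rowP => i; rewrite !mxE; ring.
  have -> : c - q = - w by rewrite opprB.
  have E2 (v' w' : V) : dotv (t *: v' - w') (t *: v' - w') =
      t ^+ 2 * dotv v' v' - 2 * t * dotv w' v' + dotv w' w'.
    rewrite !(dotvDl, dotvDr, dotvNl, dotvNr, dotvZl, dotvZr) (dotvC v' w').
    by move: (dotv _ _) (dotv _ _) (dotv _ _) => a1 a2 a3; ring.
  rewrite E2 dotvNl dotvNr opprK -/a -/b; move: (dotv w w) => ww'; nra.
pose u := (Num.sqrt (dotv w w))^-1 *: w.
have s0 : 0 < Num.sqrt (dotv w w) by rewrite sqrtr_gt0.
exists u; first by rewrite /u dotvZl dotvZr mulrA -expr2 exprVn sqr_sqrtr ?ltW// mulVf// gt_eqF.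
move=> y Cy; rewrite /u dotvZl pmulr_rle0 ?invr_gt0//.
have -> : y - q = (y - c) - w by rewrite /w opprB addrA subrK.
by rewrite dotvBr subr_le0; apply: (le_trans (key y Cy)); exact: ltW.
Qed.

(** A tube lemma with two parameters, for statements that vary a point and a direction together;
    where one parameter is enough, the other is kept near 0. *)
Lemma compact_uniform (m1 m2 m3 : nat) (K : set 'rV[R]_m3)
    (P : 'rV[R]_m1 -> 'rV[R]_m2 -> 'rV[R]_m3 -> Prop) (p1 : 'rV[R]_m1) (p2 : 'rV[R]_m2) : compact K ->
  (forall c, K c -> exists2 d : R, 0 < d & forall a b c',
     `|a - p1| < d -> `|b - p2| < d -> `|c' - c| < d -> P a b c') ->
  exists2 d : R, 0 < d & forall a b, `|a - p1| < d -> `|b - p2| < d ->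
     forall c, K c -> P a b c.
Proof.
move=> /compact_near_coveringP cK H.
have F := @nbhs_filter _ (p1, p2).
have := cK _ (nbhs (p1, p2)) (fun ab c => P ab.1 ab.2 c) F.
move=> [|[Q1 Q2] /= [/nbhsE_norm[d1 d10 H1] /nbhsE_norm[d2 d20 H2]] Q].
  move=> c /H[d d0 Hd].
  exists ([set c' | `|c' - c| < d], [set ab | `|ab.1 - p1| < d /\ `|ab.2 - p2| < d]) => /=.
    split; first by apply/nbhsE_norm; exists d.
    exists ([set a | `|a - p1| < d], [set b | `|b - p2| < d]) => //=.
    by split; apply/nbhsE_norm; exists d.
  by move=> [c' [a b]] /= [? [? ?]]; apply: Hd.
exists (Num.min d1 d2); first by rewrite lt_min d10.
move=> a b; rewrite !lt_min => /andP[a1 _] /andP[_ b2] c Kc.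
by apply: (Q (a, b)) => //; split; [exact: H1|exact: H2].
Qed.

Lemma sphere_compact : compact [set u : V | dotv u u = 1].
Proof.
apply: bounded_closed_compact.
  exists 1; split; first exact: num_real.
  move=> M M1 u /= u1; apply: le_trans (ltW M1).
  by rewrite -(@ler_pXn2r _ 2)// ?nnegrE// expr1n -u1 norm_sqr_le_dotv.
have -> : [set u : V | dotv u u = 1] = (fun u => dotv u u) @^-1` [set 1] by [].
apply: preimage_closed; last exact: closed_eq.
move=> u _; have := @continuous_dotv_sqr 0 u.
by under [X in continuous_at _ X -> _]eq_fun do rewrite subr0.
Qed.

(** Without a normal at [p], every unit [u] sees a point of [C] strictly beyond [p]. Compactness of
    the sphere extends this to all [q] near [p]; such [q] cannot be separated from [C], so [p] would
    be interior. *)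
Lemma supporting_hyperplane C p : compact C -> Defs.convex_set C -> C !=set0 ->
  ~ interior C p -> exists u, outer_unit_normal C p u.
Proof.
move=> cC vC C0 ip; apply: contrapT => H; apply: ip; apply/nbhsE_norm.
have [|d d0 Hd] := @compact_uniform n n n [set u : V | dotv u u = 1]
   (fun q _ u => exists2 y, C y & dotv u (y - q) > 0) p 0 sphere_compact.
  move=> u u1; have [y Cy yp] : exists2 y, C y & dotv u (y - p) > 0.
    apply: contrapT => Hn; apply: H; exists u; split => // y Cy.
    by rewrite leNgt; apply/negP => uy; apply: Hn; exists y.
  have [d d0 Hd] := dotv_close yp; exists d => // q _ u' qp _ uu.
  by exists y => //; apply: Hd => //; rewrite opprB addrC addrA subrK distrC.
exists d => // q qp; apply: contrapT => nCq.
have [u u1 uC] := separation cC vC C0 nCq.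
have [|y /uC] := Hd q 0 qp _ u u1; first by rewrite subrr normr0.
by move=> + /lt_geF; move=> ->.
Qed.

End ConvexGeometry.

(** * Finite regularity classes *)

Section Holder.
Variables (R : realType).

Definition loc_lip n (W : normedModType R) (U : set 'rV[R]_n) (G : 'rV[R]_n -> W) : Prop :=
  forall x, U x -> exists2 r : R, 0 < r & exists2 C : R, 0 <= C &
    forall y z, `|y - x| < r -> `|z - x| < r -> `|G y - G z| <= C * `|y - z|.

(** The constant in [holder_on] has no prescribed sign; estimates multiply by it, so it is made
    nonnegative here. *)
Lemma holderP n (alpha : R) (U : set 'rV[R]_n) (g : 'rV[R]_n -> R) :
  holder_on alpha U g <->
  forall x, U x -> exists2 r : R, 0 < r & exists2 C : R, 0 <= C &
    forall y z, `|y - x| < r -> `|z - x| < r -> `|g y - g z| <= C * `|y - z| `^ alpha.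
Proof.
split=> H x /H.
  move=> [r [r0 [C HC]]]; exists r => //; exists (Num.max 0 C); first by rewrite le_max lexx.
  move=> y z yr zr; have by1 : ball x r y by rewrite (rV_ballE x r y).
  have bz1 : ball x r z by rewrite (rV_ballE x r z).
  apply: (le_trans (HC y z by1 bz1)).
  by rewrite ler_wpM2r ?powR_ge0// le_max lexx orbT.
move=> [r r0 [C C0 HC]]; exists r; split=> //; exists C => y z.
by rewrite (rV_ballE x r y) (rV_ballE x r z); apply: HC.
Qed.

Section Level0.
Variables (n : nat) (alpha : R).
Hypothesis alpha01 : 0 <= alpha <= 1.
Implicit Types (U : set 'rV[R]_n) (f g : 'rV[R]_n -> R).

(** Continuity is a separate clause because for [alpha = 0] the Hoelder condition only expresses
    local boundedness. *)
Definition cls0 U f : Prop := (forall x, U x -> {for x, continuous f}) /\ holder_on alpha U f.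

Lemma lip_holder U f : loc_lip U f -> holder_on alpha U f.
Proof.
move=> H; apply/holderP => x /H[r r0 [C C0 HC]].
(* Points of this ball are at distance at most 1, where a number is at most its power of exponent
   [alpha]. *)
exists (Num.min r 2^-1); first by rewrite lt_min r0 invr_gt0 ltr0n.
exists C => // y z; rewrite !lt_min => /andP[yr y2] /andP[zr z2].
apply: (le_trans (HC y z yr zr)); rewrite ler_wpM2l//.
have d1 : `|y - z| <= 1.
  have -> : y - z = (y - x) - (z - x) by rewrite opprB addrA subrK.
  by apply: (le_trans (ler_normB _ _)); lra.
have [->|yz0] := eqVneq (`|y - z|) 0; first exact: powR_ge0.
have d0 : 0 < `|y - z| by rewrite lt_neqAle eq_sym yz0 normr_ge0.
rewrite -{1}(@powRr1 _ `|y - z|)//; apply: ger_powR; first by rewrite d0.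
by case/andP: alpha01.
Qed.

Lemma lip_continuous (W : normedModType R) (G : 'rV[R]_n -> W) U x : loc_lip U G -> U x ->
  forall e : R, 0 < e -> exists2 d : R, 0 < d & forall y, `|y - x| < d -> `|G y - G x| < e.
Proof.
move=> H /H[r r0 [C C0 HC]] e e0; have C1 : 0 < C + 1 by rewrite ltr_wpDl.
exists (Num.min r (e / (C + 1))); first by rewrite lt_min r0 divr_gt0.
move=> y; rewrite lt_min ltr_pdivlMr// => /andP[yr ye].
apply: le_lt_trans ye; apply: (le_trans (HC y x yr _)); first by rewrite subrr normr0.
by rewrite mulrC ler_wpM2l// lerDl.
Qed.

Lemma lip_cls0 U f : loc_lip U f -> cls0 U f.
Proof.
move=> H; split; last exact: lip_holder.
by move=> x Ux; apply/continuousP_norm; exact: (lip_continuous H Ux).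
Qed.

Lemma cont_bounded f x : {for x, continuous f} ->
  exists2 r : R, 0 < r & forall y, `|y - x| < r -> `|f y| <= `|f x| + 1.
Proof.
move=> /continuousP_norm/(_ 1 ltr01)[d d0 Hd]; exists d => // y /Hd H.
by rewrite -[f y](subrK (f x)) addrC (le_trans (ler_normD _ _))// lerD2l ltW.
Qed.

Lemma cls0_ext U f g : open U -> (forall x, U x -> f x = g x) -> cls0 U f -> cls0 U g.
Proof.
move=> oU fg [cf /holderP hf]; split.
  move=> x Ux; apply/continuousP_norm => e e0.
  have /continuousP_norm/(_ e e0)[d d0 Hd] := cf x Ux.
  have [r r0 Hr] := open_norm oU Ux.
  exists (Num.min d r); first by rewrite lt_min d0.
  move=> y; rewrite lt_min => /andP[yd yr].
  by rewrite -!fg//; [exact: Hd|exact: Hr].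
apply/holderP => x Ux; have [r r0 Hr] := open_norm oU Ux.
have [s s0 [C C0 HC]] := hf x Ux; exists (Num.min r s); first by rewrite lt_min r0.
exists C => // y z; rewrite !lt_min => /andP[yr ys] /andP[zr zs].
by rewrite -!fg//; [exact: HC|exact: Hr|exact: Hr].
Qed.

Lemma cls0_cst U (c : R) : cls0 U (fun=> c).
Proof.
apply: lip_cls0 => x _; exists 1 => //; exists 0 => // y z _ _.
by rewrite subrr normr0 mul0r.
Qed.

Lemma cls0_add U f g : cls0 U f -> cls0 U g -> cls0 U (fun x => f x + g x).
Proof.
move=> [cf /holderP hf] [cg /holderP hg]; split.
  by move=> x Ux; exact: (continuousD (cf x Ux) (cg x Ux)).
apply/holderP => x Ux; have [r r0 [C C0 HC]] := hf x Ux; have [s s0 [D D0 HD]] := hg x Ux.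
exists (Num.min r s); first by rewrite lt_min r0.
exists (C + D); first exact: addr_ge0.
move=> y z; rewrite !lt_min => /andP[yr ys] /andP[zr zs].
have -> : f y + g y - (f z + g z) = (f y - f z) + (g y - g z) by ring.
by apply: (le_trans (ler_normD _ _)); rewrite mulrDl lerD//; [exact: HC|exact: HD].
Qed.

Lemma cls0_mul U f g : cls0 U f -> cls0 U g -> cls0 U (fun x => f x * g x).
Proof.
move=> [cf /holderP hf] [cg /holderP hg]; split.
  by move=> x Ux; exact: (continuousM (cf x Ux) (cg x Ux)).
apply/holderP => x Ux; have [r r0 [C C0 HC]] := hf x Ux; have [s s0 [D D0 HD]] := hg x Ux.
have [r1 r10 H1] := cont_bounded (cf x Ux); have [r2 r20 H2] := cont_bounded (cg x Ux).
exists (Num.min (Num.min r s) (Num.min r1 r2)); first by rewrite !lt_min r0 s0 r10.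
exists ((`|f x| + 1) * D + (`|g x| + 1) * C); first by rewrite addr_ge0// mulr_ge0// addr_ge0.
move=> y z; rewrite !lt_min => /andP[/andP[yr ys] /andP[y1 y2]] /andP[/andP[zr zs] /andP[z1 z2]].
have -> : f y * g y - f z * g z = f y * (g y - g z) + g z * (f y - f z) by ring.
apply: (le_trans (ler_normD _ _)); rewrite mulrDl !normrM -!mulrA; apply: lerD.
  by apply: ler_pM => //; [exact: H1|exact: HD].
by apply: ler_pM => //; [exact: H2|exact: HC].
Qed.

Lemma cls0_inv U f : cls0 U f -> (forall x, U x -> f x != 0) -> cls0 U (fun x => (f x)^-1).
Proof.
move=> [cf /holderP hf] f0; split.
  by move=> x Ux; exact: (continuousV (f0 x Ux) (cf x Ux)).
apply/holderP => x Ux; have [r r0 [C C0 HC]] := hf x Ux.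
have fx0 : 0 < `|f x| by rewrite normr_gt0 f0.
have fx2 : 0 < `|f x| / 2 by rewrite divr_gt0.
have /continuousP_norm/(_ _ fx2)[d d0 Hd] := cf x Ux.
have low y : `|y - x| < d -> `|f x| / 2 <= `|f y|.
  move=> /Hd; rewrite distrC => H; have := lerB_dist (f x) (f y); lra.
exists (Num.min r d); first by rewrite lt_min r0.
exists ((`|f x| / 2) ^- 2 * C); first by rewrite mulr_ge0// invr_ge0 sqr_ge0.
move=> y z; rewrite !lt_min => /andP[yr yd] /andP[zr zd].
have ly := low y yd; have lz := low z zd.
have fy0 : 0 < `|f y| by exact: lt_le_trans ly.
have fz0 : 0 < `|f z| by exact: lt_le_trans lz.
have -> : (f y)^-1 - (f z)^-1 = (f y * f z)^-1 * (f z - f y).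
  by field; rewrite -!normr_gt0 fz0 fy0.
rewrite normrM normfV -mulrA; apply: ler_pM => //.
  rewrite lef_pV2 ?posrE ?exprn_gt0// ?normrM ?mulr_gt0// expr2.
  by apply: ler_pM => //; exact: ltW.
by rewrite distrC; exact: HC.
Qed.

End Level0.

Lemma cls0_comp m n (alpha : R) (U : set 'rV[R]_m) (U' : set 'rV[R]_n) f G :
  0 <= alpha -> cls0 alpha U' f -> loc_lip U G -> (forall x, U x -> U' (G x)) ->
  cls0 alpha U (fun x => f (G x)).
Proof.
move=> a0 [cf /holderP hf] lG UU'; split.
  move=> x Ux; apply/continuousP_norm => e e0.
  have /continuousP_norm/(_ e e0)[d d0 Hd] := cf _ (UU' x Ux).
  by have [d' d'0 Hd'] := lip_continuous lG Ux d0; exists d' => // y /Hd'/Hd.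
apply/holderP => x Ux; have [r r0 [C C0 HC]] := hf _ (UU' x Ux).
have [s s0 [L L0 HL]] := lG x Ux.
have [d d0 Hd] := lip_continuous lG Ux r0.
exists (Num.min s d); first by rewrite lt_min s0.
exists (C * L `^ alpha); first by rewrite mulr_ge0// powR_ge0.
move=> y z; rewrite !lt_min => /andP[ys yd] /andP[zs zd].
apply: (le_trans (HC _ _ (Hd _ yd) (Hd _ zd))).
rewrite -mulrA ler_wpM2l// -powRM//.
by apply: ge0_ler_powR; rewrite ?nnegrE ?mulr_ge0//; exact: HL.
Qed.

End Holder.

Section Classes.
Variables (R : realType) (alpha : R).
Hypothesis alpha01 : 0 <= alpha <= 1.

(** The class C^{k,alpha} by recursion through one partial derivative at a time: products,
    reciprocals and composites are then handled by induction on [k], without formulas for higher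
    derivatives. *)
Fixpoint cls n (k : nat) (U : set 'rV[R]_n) (f : 'rV[R]_n -> R) : Prop :=
  match k with
  | 0 => cls0 alpha U f
  | k'.+1 => (forall x, U x -> {for x, continuous f}) /\
      forall i, (forall x, U x -> derivable f x (evec R i)) /\ cls k' U (pd i f)
  end.

Section OneDim.
Variable n : nat.
Implicit Types (U : set 'rV[R]_n) (f g : 'rV[R]_n -> R).

Lemma pd_ext U f g i x : open U -> (forall x, U x -> f x = g x) -> U x -> pd i f x = pd i g x.
Proof.
move=> oU fg Ux; rewrite !pdE; apply: near_eq_derive.
by apply/nbhsE_norm; have [d d0 Hd] := open_norm oU Ux; exists d => // y /Hd/fg.
Qed.

Lemma derivable_ext U f g (v : 'rV[R]_n) x : open U -> (forall x, U x -> f x = g x) -> U x ->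
  derivable f x v -> derivable g x v.
Proof.
move=> oU fg Ux; apply: near_eq_derivable.
by apply/nbhsE_norm; have [d d0 Hd] := open_norm oU Ux; exists d => // y /Hd/fg.
Qed.

Lemma cls_continuous k U f x : cls k U f -> U x -> {for x, continuous f}.
Proof. by case: k => [|k] [cf _]; exact: cf. Qed.

Lemma cls_pd k U f i : cls k.+1 U f -> cls k U (pd i f).
Proof. by case=> _ /(_ i)[]. Qed.

Lemma cls_derivable k U f i x : cls k.+1 U f -> U x -> derivable f x (evec R i).
Proof. by case=> _ /(_ i)[+ _]; exact. Qed.

Lemma cls_ext k U f g : open U -> (forall x, U x -> f x = g x) -> cls k U f -> cls k U g.
Proof.
move=> oU; elim: k f g => [|k IH] f g fg; first exact: cls0_ext.
move=> [cf H]; split.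
  (* Continuity is transferred through the exponent 0, for which the Hoelder clause follows from
     continuity. *)
  suff h0 : cls0 0 U f by have [] := cls0_ext oU fg h0.
  split=> //; apply/holderP => x Ux; have [r r0 Hr] := cont_bounded (cf x Ux).
  exists r => //; exists (2 * (`|f x| + 1)); first by rewrite mulr_ge0// addr_ge0.
  move=> y z /Hr hy /Hr hz; rewrite powRr0 mulr1 (le_trans (ler_normB _ _))//.
  by rewrite mulrDl mul1r lerD.
move=> i; have [df cdf] := H i; split.
  by move=> x Ux; apply: (derivable_ext oU fg Ux); exact: df.
by apply: IH cdf => x; exact: (pd_ext i oU fg).
Qed.

Lemma cls_sub k U V f : V `<=` U -> cls k U f -> cls k V f.
Proof.
move=> VU; elim: k f => [|k IH] f [cf H].
  by split=> x /VU; [exact: cf|exact: H].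
split; first by move=> x /VU; exact: cf.
by move=> i; have [df cdf] := H i; split; [move=> x /VU; exact: df|exact: IH].
Qed.

Lemma cls_lip k U f : open U -> cls k.+1 U f -> loc_lip U f.
Proof.
move=> oU [cf H] x Ux; apply: C1_lipschitz.
  have [d d0 Hd] := open_norm oU Ux; exists d => // z /Hd Uz i.
  by have [df _] := H i; exact: df.
by move=> i; have [_ /cls_continuous] := H i; apply.
Qed.

Lemma cls_fdiff k U f x : open U -> cls k.+1 U f -> U x -> fdiff f x.
Proof.
move=> oU [cf H] Ux; apply: C1_fdiff.
  have [d d0 Hd] := open_norm oU Ux; exists d => // z /Hd Uz i.
  by have [df _] := H i; exact: df.
by move=> i; have [_ /cls_continuous] := H i; apply.
Qed.

(** At the bottom of the induction a C^1 function is locally Lipschitz, hence Hoelder for every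
    exponent at most 1. *)
Lemma cls_S k U f : open U -> cls k.+1 U f -> cls k U f.
Proof.
move=> oU; elim: k f => [|k IH] f Hf; first by apply: lip_cls0 => //; exact: cls_lip Hf.
case: Hf => cf H; split=> // i; have [df cdf] := H i; split=> //; exact: IH.
Qed.

Lemma cls_le j k U f : open U -> (j <= k)%N -> cls k U f -> cls j U f.
Proof.
move=> oU; elim: k => [|k IH]; first by rewrite leqn0 => /eqP ->.
by rewrite leq_eqVlt ltnS => /orP[/eqP -> //|jk] /(cls_S oU); exact: IH.
Qed.

Lemma cls_cst k U (c : R) : open U -> cls k U (fun=> c).
Proof.
move=> oU; elim: k c => [|k IH] c; first exact: cls0_cst.
split; first by have [] := cls0_cst alpha01 U c.
move=> i; split=> [x _|]; first exact: derivable_cst.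
apply: cls_ext (IH 0) => // x _.
by apply/esym/is_derive_pd; exact: is_derive_cst.
Qed.

Lemma cls_add k U f g : open U -> cls k U f -> cls k U g -> cls k U (fun x => f x + g x).
Proof.
move=> oU; elim: k f g => [|k IH] f g; first exact: cls0_add.
move=> [cf Hf] [cg Hg]; split.
  by move=> x Ux; exact: (continuousD (cf x Ux) (cg x Ux)).
move=> i; have [df cdf] := Hf i; have [dg cdg] := Hg i.
have D x : U x -> is_derive x (evec R i) (fun x => f x + g x) (pd i f x + pd i g x).
  by move=> Ux; apply: is_deriveD; apply: pdP; [exact: df|exact: dg].
split; first by move=> x /D[].
by apply: cls_ext (IH _ _ cdf cdg) => // x /D D1; apply/esym/is_derive_pd.
Qed.

Lemma cls_mul k U f g : open U -> cls k U f -> cls k U g -> cls k U (fun x => f x * g x).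
Proof.
move=> oU; elim: k f g => [|k IH] f g; first exact: cls0_mul.
move=> hf hg; have hf' := cls_S oU hf; have hg' := cls_S oU hg.
case: hf => cf Hf; case: hg => cg Hg; split.
  by move=> x Ux; exact: (continuousM (cf x Ux) (cg x Ux)).
move=> i; have [df cdf] := Hf i; have [dg cdg] := Hg i.
have D x : U x -> is_derive x (evec R i) (fun x => f x * g x) (f x * pd i g x + g x * pd i f x).
  by move=> Ux; apply: is_derive_mul; apply: pdP; [exact: df|exact: dg].
split; first by move=> x /D[].
apply: cls_ext (cls_add oU (IH _ _ hf' cdg) (IH _ _ hg' cdf)) => // x /D D1.
exact/esym/is_derive_pd.
Qed.

Lemma cls_opp k U f : open U -> cls k U f -> cls k U (fun x => - f x).
Proof.
move=> oU hf; apply: cls_ext (cls_mul oU (cls_cst k (-1) oU) hf) => // x _.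
by rewrite mulN1r.
Qed.

Lemma cls_inv k U f : open U -> cls k U f -> (forall x, U x -> f x != 0) ->
  cls k U (fun x => (f x)^-1).
Proof.
move=> oU; elim: k f => [|k IH] f; first exact: cls0_inv.
move=> hf f0; have hf' := cls_S oU hf; case: hf => cf Hf; split.
  by move=> x Ux; exact: (continuousV (f0 x Ux) (cf x Ux)).
move=> i; have [df cdf] := Hf i.
have D x : U x -> is_derive x (evec R i) (fun x => (f x)^-1) (- (f x) ^- 2 * pd i f x).
  by move=> Ux; apply: is_derive_inv; [exact: f0|apply: pdP; exact: df].
split; first by move=> x /D[].
have h2 := IH _ hf' f0.
apply: cls_ext (cls_mul oU (cls_opp oU (cls_mul oU h2 h2)) cdf) => // x /D D1.
by rewrite -invfM -expr2; exact/esym/is_derive_pd.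
Qed.

Lemma cls_sum k U (I : Type) (s : seq I) (f : I -> 'rV[R]_n -> R) : open U ->
  (forall i, cls k U (f i)) -> cls k U (fun x => \sum_(i <- s) f i x).
Proof.
move=> oU H; elim: s => [|i s IH].
  by under eq_fun do rewrite big_nil; exact: cls_cst.
by under eq_fun do rewrite big_cons; exact: cls_add.
Qed.

End OneDim.

Lemma cls_comp m n k (U : set 'rV[R]_m) (U' : set 'rV[R]_n) f (G : 'rV[R]_m -> 'rV[R]_n) : open U -> open U' ->
  cls k U' f -> (forall j, cls k U (fun x => G x 0 j)) -> loc_lip U G ->
  (forall x, U x -> U' (G x)) -> cls k U (fun x => f (G x)).
Proof.
move=> oU oU' + + lG UU'; have [a0 _] := andP alpha01.
elim: k f => [|k IH] f; first by move=> hf _; exact: cls0_comp hf lG UU'.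
move=> hf hG; split.
  by move=> x Ux; have [+ _] := cls0_comp a0 (cls_le oU' (leq0n _) hf) lG UU'; exact.
have hG' j := cls_S oU (hG j).
move=> i.
have D x : U x -> is_derive x (evec R i) (fun x => f (G x))
    (\sum_j pd i (fun x => G x 0 j) x * pd j f (G x)).
  move=> Ux.
  have -> : \sum_j pd i (fun x => G x 0 j) x * pd j f (G x) =
     dotv (\row_j pd i (fun x => G x 0 j) x) (gradient f (G x)).
    by rewrite dotvE; apply: eq_bigr => j _; rewrite gradientE mxE.
  apply: is_derive_comp; first by apply: cls_fdiff hf _ => //; exact: UU'.
  move=> j; rewrite mxE; apply: pdP; have [_ /(_ i)[+ _]] := hG j; exact.
split; first by move=> x /D[].
apply: (@cls_ext _ _ _ (fun x => \sum_(j <- index_enum 'I_n) pd i (fun x => G x 0 j) x * pd j f (G x))) => //.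
  by move=> x /D D1; exact/esym/is_derive_pd.
apply: cls_sum => // j; apply: cls_mul => //.
  by have [_ /(_ i)[_]] := hG j.
by apply: IH => //; case: hf => _ /(_ j)[].
Qed.

(** Bootstrap: if [G] has level l, so have the composites [H i j] o [G], which are the partial
    derivatives of [G]; hence [G] has level l + 1. The Lipschitz hypothesis starts the induction. *)
Lemma cls_ode m n k (U : set 'rV[R]_m) (U' : set 'rV[R]_n) (G : 'rV[R]_m -> 'rV[R]_n)
    (H : 'I_m -> 'I_n -> 'rV[R]_n -> R) : open U -> open U' ->
  (forall x, U x -> U' (G x)) -> loc_lip U G ->
  (forall x, U x -> forall i j, is_derive x (evec R i) (fun x => G x 0 j) (H i j (G x))) ->
  (forall i j, cls k U' (H i j)) -> forall j, cls k.+1 U (fun x => G x 0 j).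
Proof.
move=> oU oU' UU' lG dG.
have lGj j : loc_lip U (fun x => G x 0 j).
  move=> x /lG[r r0 [C C0 HC]]; exists r => //; exists C => // y z yr zr.
  apply: le_trans (HC y z yr zr); rewrite -[X in `|X|](_ : (G y - G z) 0 j = _); last by rewrite !mxE.
  exact: coord_norm_le.
have cG j x : U x -> {for x, continuous (fun x => G x 0 j)}.
  by move=> Ux; apply/continuousP_norm; exact: (lip_continuous (lGj j) Ux).
have step l : (forall i j, cls l U' (H i j)) -> (forall j, cls l U (fun x => G x 0 j)) ->
    forall j, cls l.+1 U (fun x => G x 0 j).
  move=> hH hG j; split; first exact: cG.
  move=> i; split; first by move=> x /dG/(_ i j)[].
  apply: cls_ext (cls_comp oU oU' (hH i j) hG lG UU') => // x /dG/(_ i j) D.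
  exact/esym/is_derive_pd.
elim: k => [|k IH] hH j.
  by apply: step => // j'; exact: lip_cls0.
by apply: step => //; apply: IH => i' j'; exact: cls_S.
Qed.

End Classes.

Section ClassesDefs.
Variables (R : realType) (n : nat).
Implicit Types (U : set 'rV[R]_n) (f : 'rV[R]_n -> R).

Lemma iter_cls (alpha : R) k U f (s : seq 'I_n) : cls alpha k U f -> (size s <= k)%N ->
  cls alpha (k - size s) U (iter_partial s f).
Proof.
move=> hf; elim: s => [|i s IH]; first by rewrite subn0.
move=> sk; have := IH (ltnW sk); rewrite -(subnSK sk) => -[_ /(_ i)[_ h]].
by rewrite (_ : iter_partial (i :: s) f = pd i (iter_partial s f)); [exact: h|rewrite pd_partial].
Qed.

Lemma cls_of_class (alpha : R) k U f : cls alpha k U f <-> of_class (Fin k) alpha U f.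
Proof.
split=> [hf|[hf hs]]; first split.
- move=> s sk x Ux; have hs := iter_cls hf sk.
  split; first exact: cls_continuous hs Ux.
  by move=> sk' i; move: hs; rewrite -(subnSK sk') => -[_ /(_ i)[+ _]]; exact.
- move=> s sk; have := iter_cls hf (eq_leq sk); rewrite sk subnn => -[_]; exact.
suff H j s : (size s + j = k)%N -> cls alpha j U (iter_partial s f) by exact: (H k [::]).
elim: j s => [|j IH] s; first rewrite addn0 => sk.
  by split; [move=> x Ux; have [] := hf s (eq_leq sk) x Ux|exact: hs].
move=> sk; have sk' : (size s < k)%N by rewrite -sk addnS ltnS leq_addr.
split; first by move=> x Ux; have [] := hf s (ltnW sk') x Ux.
move=> i; split; first by move=> x Ux; have [_ /(_ sk')] := hf s (ltnW sk') x Ux; exact.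
rewrite pd_partial; apply: (IH (i :: s)); by rewrite /= addSnnS.
Qed.

(** For exponent 0 the Hoelder clause follows from continuity, so plain C^k is the case
    [alpha = 0]. *)
Lemma Ck_on_cls k U f : Ck_on k U f <-> cls 0 k U f.
Proof.
split=> [hf|/cls_of_class[]//]; apply/cls_of_class; split=> // s sk.
apply/holderP => x Ux; have [cf _] := hf s (eq_leq sk) x Ux.
have [r r0 Hr] := cont_bounded cf.
exists r => //; exists (2 * (`|iter_partial s f x| + 1)); first by rewrite mulr_ge0// addr_ge0.
move=> y z /Hr hy /Hr hz; rewrite powRr0 mulr1 (le_trans (ler_normB _ _))//.
by rewrite mulrDl mul1r lerD.
Qed.

Lemma cls_C2on (alpha : R) k U f : cls alpha k.+2 U f -> C2on U f.
Proof.
move=> H x Ux; split=> [i|i|i j|i j].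
- exact: cls_derivable H Ux.
- exact: cls_continuous (cls_pd i H) Ux.
- exact: cls_derivable (cls_pd j H) Ux.
- exact: cls_continuous (cls_pd i (cls_pd j H)) Ux.
Qed.

End ClassesDefs.

(** * Analytic functions through Cauchy estimates *)

Section Majorants.
Variables (R : realType).

(* [pgeom k q l] is the l-th derivative at 0 of (1 - k t)^(-q). *)
Definition pgeom (k q : R) (l : nat) : R := k ^+ l * \prod_(i < l) (q + i%:R).

Lemma pgeom0 k q : pgeom k q 0 = 1.
Proof. by rewrite /pgeom expr0 big_ord0 mulr1. Qed.

Lemma pgeomS k q l : pgeom k q l.+1 = k * q * pgeom k (q + 1) l.
Proof.
rewrite /pgeom exprS big_ord_recl addr0.
have -> : \prod_(i < l) (q + (bump 0 i)%:R) = \prod_(i < l) (q + 1 + i%:R).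
  by apply: eq_bigr => i _; rewrite /bump add1n -natr1 -addrA [1 + _]addrC.
by rewrite !mulrA; congr (_ * _); ring.
Qed.

Lemma pgeom_ge0 k q l : 0 <= k -> 0 <= q -> 0 <= pgeom k q l.
Proof.
by move=> k0 q0; rewrite mulr_ge0 ?exprn_ge0// prodr_ge0// => i _; rewrite addr_ge0.
Qed.

(** One factor [a] per linear term of the product is moved into the base, so that a larger rate pays
    for a smaller exponent. *)
Lemma pgeom_le (a k q k' q' : R) l : 0 < a -> 0 <= k -> 0 <= q -> a * k <= k' ->
  (forall i : nat, q + i%:R <= a * (q' + i%:R)) -> pgeom k q l <= pgeom k' q' l.
Proof.
move=> a0 k0 q0 kk qq; have k'0 : 0 <= k' by apply: le_trans kk; rewrite mulr_ge0// ltW.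
have q'0 i : 0 <= q' + i%:R.
  by rewrite -(pmulr_rge0 _ a0); apply: le_trans (qq i); rewrite addr_ge0.
apply: le_trans (_ : pgeom (a * k) q' l <= _).
  rewrite /pgeom exprMn mulrAC -[a ^+ l](_ : \prod_(i < l) a = _); last first.
    by rewrite prodr_const card_ord.
  rewrite -big_split /= mulrC ler_wpM2r ?exprn_ge0//.
  by apply: ler_prod => i _; rewrite addr_ge0//= qq.
have P0 : 0 <= \prod_(i < l) (q' + i%:R) by apply: prodr_ge0 => i _; exact: q'0.
rewrite /pgeom ler_wpM2r//.
by rewrite lerXn2r ?nnegrE// mulr_ge0// ltW.
Qed.

Lemma pgeom_fact k l : pgeom k 1 l = k ^+ l * l`!%:R.
Proof.
rewrite /pgeom; congr (_ * _); elim: l => [|l IH]; first by rewrite big_ord0 fact0.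
by rewrite big_ord_recr /= IH factS natrM mulrC nat1r.
Qed.

Section Maj.
Variable n : nat.
Implicit Types (U V : set 'rV[R]_n) (f g : 'rV[R]_n -> R) (c d : nat -> R).

(** [c l] bounds all partial derivatives of order [l], for [l <= L]. The cut-off at [L] lets a bound
    be extended one order at a time. *)
Fixpoint maj (L : nat) U f c : Prop :=
  match L with
  | 0 => forall x, U x -> `|f x| <= c 0
  | L'.+1 => (forall x, U x -> `|f x| <= c 0) /\
     forall i, (forall x, U x -> derivable f x (evec R i)) /\
               maj L' U (pd i f) (fun l => c l.+1)
  end.

Lemma maj_bound L U f c x : maj L U f c -> U x -> `|f x| <= c 0%N.
Proof. by case: L => [|L] => [H|[H _]]; exact: H. Qed.

Lemma maj_ext L U f g c : open U -> (forall x, U x -> f x = g x) -> maj L U f c -> maj L U g c.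
Proof.
move=> oU; elim: L f g c => [|L IH] f g c fg /=; first by move=> H x Ux; rewrite -fg//; exact: H.
move=> [H D]; split; first by move=> x Ux; rewrite -fg//; exact: H.
move=> i; have [df mf] := D i; split.
  by move=> x Ux; apply: (derivable_ext oU fg Ux); exact: df.
by apply: IH mf => x; exact: (pd_ext i oU fg).
Qed.

Lemma maj_sub L U V f c : V `<=` U -> maj L U f c -> maj L V f c.
Proof.
move=> VU; elim: L f c => [|L IH] f c /=; first by move=> H x /VU/H.
move=> [H D]; split; first by move=> x /VU/H.
by move=> i; have [df mf] := D i; split; [move=> x /VU/df|exact: IH].
Qed.

Lemma maj_le L U f c d : (forall l, c l <= d l) -> maj L U f c -> maj L U f d.
Proof.
elim: L f c d => [|L IH] f c d cd /=.
  by move=> H x /H /le_trans; apply; exact: cd.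
move=> [H D]; split; first by move=> x /H /le_trans; apply; exact: cd.
move=> i; have [df mf] := D i; split=> //.
by apply: IH mf => l; exact: cd.
Qed.

Lemma maj_S L U f c : maj L.+1 U f c -> maj L U f c.
Proof.
elim: L f c => [|L IH] f c; first by case.
move=> [H D]; split=> // i; have [df mf] := D i; split=> //; exact: IH.
Qed.

Lemma maj_add L U f g c d : open U -> maj L U f c -> maj L U g d ->
  maj L U (fun x => f x + g x) (fun l => c l + d l).
Proof.
move=> oU; elim: L f g c d => [|L IH] f g c d.
  by move=> H K x Ux; apply: (le_trans (ler_normD _ _)); apply: lerD; [exact: H|exact: K].
move=> [H D] [K E]; split.
  by move=> x Ux; apply: (le_trans (ler_normD _ _)); apply: lerD; [exact: H|exact: K].
move=> i; have [df mf] := D i; have [dg mg] := E i.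
have Dx x : U x -> is_derive x (evec R i) (fun x => f x + g x) (pd i f x + pd i g x).
  by move=> Ux; apply: is_deriveD; apply: pdP; [exact: df|exact: dg].
split; first by move=> x /Dx[].
by apply: maj_ext (IH _ _ _ _ mf mg) => // x /Dx D1; apply/esym/is_derive_pd.
Qed.

Lemma maj_cst0 L U c : open U -> (forall l, 0 <= c l) -> maj L U (fun=> 0) c.
Proof.
move=> oU; elim: L c => [|L IH] c c0; first by move=> x _; rewrite normr0.
split; first by move=> x _; rewrite normr0.
move=> i; split=> [x _|]; first exact: derivable_cst.
apply: maj_ext (IH _ (fun l => c0 l.+1)) => // x _.
by apply/esym/is_derive_pd; exact: is_derive_cst.
Qed.

Lemma maj_cst L U c (a : R) : open U -> `|a| <= c 0%N -> (forall l, 0 <= c l) -> maj L U (fun=> a) c.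
Proof.
move=> oU ac c0; case: L => [|L]; first by move=> x _.
split=> // i; split=> [x _|]; first exact: derivable_cst.
apply: maj_ext (maj_cst0 L oU (fun l => c0 l.+1)) => // x _.
by apply/esym/is_derive_pd; exact: is_derive_cst.
Qed.

Lemma maj_sum L U (I : Type) (s : seq I) (f : I -> 'rV[R]_n -> R) (c : I -> nat -> R) : open U ->
  (forall i, maj L U (f i) (c i)) ->
  maj L U (fun x => \sum_(i <- s) f i x) (fun l => \sum_(i <- s) c i l).
Proof.
move=> oU H; elim: s => [|i s IH].
  under eq_fun do rewrite big_nil.
  by apply: maj_cst0 => // l; rewrite big_nil.
under eq_fun do rewrite big_cons; under [X in maj _ _ _ X]eq_fun do rewrite big_cons.
exact: maj_add.
Qed.

(** The majorants multiply like (1 - k t)^(-p) (1 - k t)^(-q); the induction is the product rule for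
    these functions, with k p + k q = k (p + q). *)
Lemma maj_mul L U f g (k p q C D : R) : open U -> 0 <= k -> 0 <= p -> 0 <= q ->
  0 <= C -> 0 <= D ->
  maj L U f (fun l => C * pgeom k p l) -> maj L U g (fun l => D * pgeom k q l) ->
  maj L U (fun x => f x * g x) (fun l => C * D * pgeom k (p + q) l).
Proof.
move=> oU k0; elim: L f g p q C D => [|L IH] f g p q C D p0 q0 C0 D0.
  move=> H K x Ux; rewrite normrM pgeom0 mulr1; apply: ler_pM => //.
    by have := H x Ux; rewrite pgeom0 mulr1.
  by have := K x Ux; rewrite pgeom0 mulr1.
move=> hf hg; have hf' := maj_S hf; have hg' := maj_S hg.
case: hf => H Hf; case: hg => K Hg; split.
  move=> x Ux; rewrite normrM pgeom0 mulr1; apply: ler_pM => //.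
    by have := H x Ux; rewrite pgeom0 mulr1.
  by have := K x Ux; rewrite pgeom0 mulr1.
move=> i; have [df mf] := Hf i; have [dg mg] := Hg i.
have Dx x : U x -> is_derive x (evec R i) (fun x => f x * g x) (f x * pd i g x + g x * pd i f x).
  by move=> Ux; apply: is_derive_mul; apply: pdP; [exact: df|exact: dg].
split; first by move=> x /Dx[].
have mf' : maj L U (pd i f) (fun l => C * (k * p) * pgeom k (p + 1) l).
  by apply: maj_le mf => l; rewrite pgeomS !mulrA.
have mg' : maj L U (pd i g) (fun l => D * (k * q) * pgeom k (q + 1) l).
  by apply: maj_le mg => l; rewrite pgeomS !mulrA.
have m1 := IH _ _ _ _ _ _ p0 (addr_ge0 q0 ler01) C0 (mulr_ge0 D0 (mulr_ge0 k0 q0)) hf' mg'.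
have m2 := IH _ _ _ _ _ _ q0 (addr_ge0 p0 ler01) D0 (mulr_ge0 C0 (mulr_ge0 k0 p0)) hg' mf'.
apply: maj_ext (_ : maj _ _ (fun x => f x * pd i g x + g x * pd i f x) _) => //.
  by move=> x /Dx D1; apply/esym/is_derive_pd.
apply: maj_le (maj_add oU m1 m2) => l.
have -> : q + (p + 1) = p + q + 1 by ring.
rewrite addrA pgeomS; move: (pgeom _ _ _) => e; rewrite le_eqVlt; apply/orP; left; apply/eqP; ring.
Qed.

Lemma maj_iter L U f c (s : seq 'I_n) : maj L U f c -> (size s <= L)%N ->
  maj (L - size s) U (iter_partial s f) (fun l => c (l + size s)%N).
Proof.
move=> hf; elim: s => [|i s IH].
  by move=> _; rewrite subn0; apply: maj_le hf => l; rewrite addn0.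
move=> sL; have := IH (ltnW sL); rewrite -(subnSK sL) => -[_ /(_ i)[_ h]].
rewrite (_ : iter_partial (i :: s) f = pd i (iter_partial s f)); last by rewrite pd_partial.
by apply: (maj_le _ h) => l; rewrite addnS addSn.
Qed.

(* If the derivatives of level-k functions are combinations, with coefficients
   dominated by b (1 - K t)^(-1/2), of level-(k+1) functions, then the bounds
   C k! s^k propagate to all derivatives: C k! s^k (1 - K t)^(-(k+1)/2) solves
   the corresponding scalar system. *)
Lemma maj_jets_step N (Phi : nat -> ('rV[R]_n -> R) -> Prop) U
    (g : 'I_n -> 'I_N -> 'rV[R]_n -> R) (C s b K : R) L :
  open U -> 0 <= C -> 0 <= s -> 0 <= b -> 0 <= K -> N%:R * b * s <= K / 2 ->
  (forall k phi, Phi k phi -> forall x, U x -> `|phi x| <= C * k`!%:R * s ^+ k) ->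
  (forall k phi, Phi k phi -> forall i, exists2 psi : 'I_N -> 'rV[R]_n -> R,
     forall j, Phi k.+1 (psi j) &
     forall x, U x -> is_derive x (evec R i) phi (\sum_j psi j x * g i j x)) ->
  (forall i j, maj L U (g i j) (fun l => b * pgeom K 2^-1 l)) ->
  (forall k phi, Phi k phi -> maj L U phi (fun l => C * k`!%:R * s ^+ k * pgeom K (k.+1%:R / 2) l)) ->
  forall k phi, Phi k phi -> maj L.+1 U phi (fun l => C * k`!%:R * s ^+ k * pgeom K (k.+1%:R / 2) l).
Proof.
move=> oU C0 s0 b0 K0 NbK PA PB mg IH k phi Pphi; split.
  by move=> x Ux; rewrite pgeom0 mulr1; exact: PA.
move=> i; have [psi Ppsi Dphi] := PB k phi Pphi i.
split; first by move=> x /Dphi[].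
apply: (@maj_ext _ _ (fun x => \sum_(j <- index_enum 'I_N) psi j x * g i j x)) => //.
  by move=> x /Dphi D1; apply/esym/is_derive_pd.
pose A : R := C * k.+1`!%:R * s ^+ k.+1.
have A0 : 0 <= A by rewrite !mulr_ge0// exprn_ge0.
have m j : maj L U (fun x => psi j x * g i j x)
    (fun l => A * b * pgeom K (k.+2%:R / 2 + 2^-1) l).
  by apply: (maj_mul oU K0 _ _ A0 b0 (IH _ _ (Ppsi j)) (mg i j)); rewrite ?divr_ge0 ?invr_ge0.
apply: maj_le (maj_sum (index_enum 'I_N) oU m) => l.
rewrite sumr_const card_ord -[_ *+ N]mulr_natl pgeomS.
have -> : k.+2%:R / 2 + 2^-1 = k.+1%:R / 2 + 1 :> R.
  by rewrite -[k.+2%:R]natr1; field.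
have : 0 <= pgeom K (k.+1%:R / 2 + 1) l by rewrite pgeom_ge0// addr_ge0// divr_ge0.
move: (pgeom _ _ _) => e e0; rewrite /A factS natrM exprS.
have -> : N%:R * (C * (k.+1%:R * k`!%:R) * (s * s ^+ k) * b * e) =
   C * k`!%:R * s ^+ k * k.+1%:R * e * (N%:R * b * s) by ring.
have -> : C * k`!%:R * s ^+ k * (K * (k.+1%:R / 2) * e) =
   C * k`!%:R * s ^+ k * k.+1%:R * e * (K / 2) by ring.
by rewrite ler_wpM2l// !mulr_ge0// exprn_ge0.
Qed.

End Maj.
End Majorants.

(** * The analytic class and its closure properties *)

Section AnalyticClass.
Variables (R : realType).

Definition nb n (x : 'rV[R]_n) (r : R) : set 'rV[R]_n := [set y | `|y - x| < r].

Lemma nb_open n (x : 'rV[R]_n) r : open (nb x r).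
Proof.
rewrite openE => y /= yr; apply/nbhsE_norm; exists (r - `|y - x|); first by rewrite subr_gt0.
move=> z zy; rewrite /nb /= -(subrK y z) -addrA.
by apply: (le_lt_trans (ler_normD _ _)); rewrite -ltrBrDr.
Qed.

Lemma nb_sub n (x : 'rV[R]_n) (r s : R) : r <= s -> nb x r `<=` nb x s.
Proof. by move=> rs y /= yr; exact: lt_le_trans rs. Qed.

Lemma nbxx n (x : 'rV[R]_n) (r : R) : 0 < r -> nb x r x.
Proof. by rewrite /nb /= subrr normr0. Qed.

Lemma pgeom_mono (k k' q : R) l : 0 <= k -> 0 <= q -> k <= k' -> pgeom k q l <= pgeom k' q l.
Proof. by move=> k0 q0 kk; apply: (@pgeom_le _ 1) => //= [|i]; rewrite mul1r. Qed.

Section OneDim.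
Variable n : nat.
Implicit Types (U : set 'rV[R]_n) (f g : 'rV[R]_n -> R).

(* The Cauchy estimates |D^l f| <= C k^l l! near x; they characterize analyticity at x. *)
Definition anb f (x : 'rV[R]_n) : Prop := exists2 r : R, 0 < r & exists2 k : R, 0 <= k &
  exists2 C : R, 0 <= C & forall L, maj L (nb x r) f (fun l => C * pgeom k 1 l).

Lemma anb_family (I : finType) (f : I -> 'rV[R]_n -> R) x : (forall i, anb (f i) x) ->
  exists2 r : R, 0 < r & exists2 k : R, 0 <= k & exists2 C : R, 0 <= C &
  forall i r' k' L, r' <= r -> k <= k' -> maj L (nb x r') (f i) (fun l => C * pgeom k' 1 l).
Proof.
move=> H.
suff [r r0 [k k0 [C C0 HC]]] : exists2 r : R, 0 < r & exists2 k : R, 0 <= k & exists2 C : R, 0 <= C &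
  forall i r' k' L, i \in enum I -> r' <= r -> k <= k' -> maj L (nb x r') (f i) (fun l => C * pgeom k' 1 l).
  exists r => //; exists k => //; exists C => // i r' k' L; apply: HC; exact: mem_enum.
elim: (enum I) => [|i s [r r0 [k k0 [C C0 HC]]]].
  by exists 1 => //; exists 0 => //; exists 0.
have [r1 r10 [k1 k10 [C1 C10 H1]]] := H i.
exists (Num.min r r1); first by rewrite lt_min r0.
exists (Num.max k k1); first by rewrite le_max k0.
exists (C + C1); first exact: addr_ge0.
move=> j r' k' L; rewrite inE le_min ge_max => /orP[/eqP ->|js] /andP[rr rr1] /andP[kk kk1].
  apply: maj_le (maj_sub (nb_sub rr1) (H1 L)) => l.
  apply: ler_pM => //; [exact: pgeom_ge0|by rewrite lerDr|exact: pgeom_mono].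
apply: maj_le (HC j r' k' L js rr kk) => l.
rewrite ler_wpM2r ?lerDl// pgeom_ge0//; exact: le_trans kk.
Qed.

Lemma anb1 f x : anb f x ->
  exists2 r : R, 0 < r & exists2 k : R, 0 <= k & exists2 C : R, 0 <= C &
  forall r' k' L, r' <= r -> k <= k' -> maj L (nb x r') f (fun l => C * pgeom k' 1 l).
Proof.
move=> H; have [r r0 [k k0 [C C0 HC]]] := @anb_family unit (fun=> f) x (fun=> H).
exists r => //; exists k => //; exists C => // r' k' L; exact: HC tt _ _ _.
Qed.

Lemma anb_pair f g x : anb f x -> anb g x ->
  exists2 r : R, 0 < r & exists2 k : R, 0 <= k & exists2 C : R, 0 <= C &
  forall L, maj L (nb x r) f (fun l => C * pgeom k 1 l) /\ maj L (nb x r) g (fun l => C * pgeom k 1 l).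
Proof.
move=> Hf Hg.
have [|r r0 [k k0 [C C0 HC]]] := @anb_family bool (fun b => if b then f else g) x; first by case.
exists r => //; exists k => //; exists C => // L; split; [exact: (HC true)|exact: (HC false)].
Qed.

(** Smoothness is carried along with the estimates because the chain rule asks for Frechet
    differentiability of every partial derivative. *)
Definition an U f : Prop := (forall k, cls 0 k U f) /\ forall x, U x -> anb f x.

Let a01 : (0 : R) <= (0 : R) <= (1 : R). Proof. by rewrite lexx ler01. Qed.

Lemma an_ext U f g : open U -> (forall x, U x -> f x = g x) -> an U f -> an U g.
Proof.
move=> oU fg [cf Hf]; split; first by move=> k; apply: cls_ext (cf k).
move=> x Ux; have [r r0 [k k0 [C C0 HC]]] := anb1 (Hf x Ux).
have [d d0 Hd] := open_norm oU Ux.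
exists (Num.min r d); first by rewrite lt_min r0.
exists k => //; exists C => // L.
apply: maj_ext (HC (Num.min r d) k L _ (lexx k)); first exact: nb_open.
  by move=> y; rewrite /nb /= lt_min => /andP[_ /Hd /fg].
by rewrite ge_min lexx.
Qed.

Lemma an_sub U V f : V `<=` U -> an U f -> an V f.
Proof.
move=> VU [cf Hf]; split; first by move=> k; exact: cls_sub VU (cf k).
by move=> x /VU; exact: Hf.
Qed.

Lemma an_cst U (c : R) : open U -> an U (fun=> c).
Proof.
move=> oU; split; first by move=> k; exact: cls_cst.
move=> x _; exists 1 => //; exists 0 => //; exists `|c| => // L.
apply: maj_cst; first exact: nb_open.
  by rewrite pgeom0 mulr1.
by move=> l; rewrite mulr_ge0// pgeom_ge0.
Qed.

Lemma an_add U f g : open U -> an U f -> an U g -> an U (fun x => f x + g x).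
Proof.
move=> oU [cf Hf] [cg Hg]; split; first by move=> k; exact: cls_add.
move=> x Ux; have [r r0 [k k0 [C C0 HC]]] := anb_pair (Hf x Ux) (Hg x Ux).
exists r => //; exists k => //; exists (C + C); first exact: addr_ge0.
move=> L; have [m1 m2] := HC L.
by apply: maj_le (maj_add (@nb_open _ x r) m1 m2) => l; rewrite mulrDl.
Qed.

(** Together with the next two lemmas: the exponents 2, 1 and 1/2 can be exchanged at the price of a
    doubled rate, so Cauchy estimates are always stated with exponent 1. *)
Lemma pgeom2_le (k : R) l : 0 <= k -> pgeom k 2 l <= pgeom (2 * k) 1 l.
Proof. by move=> k0; apply: (@pgeom_le _ 2) => // i; have : 0 <= i%:R :> R by []; lra. Qed.

Lemma pgeom1_le (k : R) l : 0 <= k -> pgeom k 1 l <= pgeom (2 * k) 2^-1 l.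
Proof. by move=> k0; apply: (@pgeom_le _ 2) => // i; have : 0 <= i%:R :> R by []; lra. Qed.

Lemma pgeom_half_le (k : R) l : 0 <= k -> pgeom k 2^-1 l <= pgeom k 1 l.
Proof.
move=> k0; apply: (@pgeom_le _ 1) => //; rewrite ?mul1r// ?invr_ge0// => i.
by rewrite mul1r; have : 0 <= i%:R :> R by []; lra.
Qed.

Lemma an_mul U f g : open U -> an U f -> an U g -> an U (fun x => f x * g x).
Proof.
move=> oU [cf Hf] [cg Hg]; split; first by move=> k; exact: cls_mul.
move=> x Ux; have [r r0 [k k0 [C C0 HC]]] := anb_pair (Hf x Ux) (Hg x Ux).
exists r => //; exists (2 * k); first exact: mulr_ge0.
exists (C * C); first exact: mulr_ge0.
move=> L; have [m1 m2] := HC L.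
apply: maj_le (maj_mul (@nb_open _ x r) k0 ler01 ler01 C0 C0 m1 m2) => l.
by rewrite ler_wpM2l ?mulr_ge0//; exact: pgeom2_le.
Qed.

Lemma anb_pd f x i : anb f x -> anb (pd i f) x.
Proof.
move=> [r r0 [k k0 [C C0 HC]]]; exists r => //; exists (2 * k); first exact: mulr_ge0.
exists (C * k); first exact: mulr_ge0.
move=> L; have [_ /(_ i)[_]] := HC L.+1.
apply: maj_le => l; rewrite pgeomS mulr1 mulrA.
by rewrite ler_wpM2l ?mulr_ge0//; exact: pgeom2_le.
Qed.

Lemma an_pd U f i : an U f -> an U (pd i f).
Proof.
by move=> [cf Hf]; split; [move=> k; exact: cls_pd (cf k.+1)|move=> x /Hf /anb_pd].
Qed.

Lemma maj_pow_bound (r C k : R) (x y : 'rV[R]_n) f (w : seq 'I_n) :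
  maj (size w) (nb x r) f (fun l => C * pgeom k 1 l) -> `|y - x| < r ->
  `|iter_partial w f y| <= C * (size w)`!%:R * k ^+ (size w).
Proof.
move=> m yr; have := maj_bound (maj_iter m (leqnn _)) yr.
by rewrite add0n pgeom_fact [k ^+ _ * _]mulrC mulrA.
Qed.

(** Typically [Phi k] consists of the derivatives of order [k] of an outer function evaluated at an
    inner one. The bound on [g] may use the estimates already known at order [L]; this covers
    differential equations, where the coefficients are themselves among the functions being
    estimated. *)
Lemma maj_jets N (Phi : nat -> ('rV[R]_n -> R) -> Prop) U
    (g : 'I_n -> 'I_N -> 'rV[R]_n -> R) (C s b K : R) :
  open U -> 0 <= C -> 0 <= s -> 0 <= b -> 0 <= K -> N%:R * b * s <= K / 2 ->
  (forall k phi, Phi k phi -> forall x, U x -> `|phi x| <= C * k`!%:R * s ^+ k) ->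
  (forall k phi, Phi k phi -> forall i, exists2 psi : 'I_N -> 'rV[R]_n -> R,
     forall j, Phi k.+1 (psi j) &
     forall x, U x -> is_derive x (evec R i) phi (\sum_j psi j x * g i j x)) ->
  (forall L, (forall k phi, Phi k phi -> maj L U phi (fun l => C * k`!%:R * s ^+ k * pgeom K (k.+1%:R / 2) l)) ->
     forall i j, maj L U (g i j) (fun l => b * pgeom K 2^-1 l)) ->
  forall L phi, Phi 0%N phi -> maj L U phi (fun l => C * pgeom K 2^-1 l).
Proof.
move=> oU C0 s0 b0 K0 NbK PA PB mg L phi Pphi.
suff H : forall k phi, Phi k phi -> maj L U phi (fun l => C * k`!%:R * s ^+ k * pgeom K (k.+1%:R / 2) l).
  by apply: maj_le (H _ _ Pphi) => l; rewrite expr0 fact0 !mulr1 mul1r.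
elim: L {phi Pphi} => [|L IH]; last by apply: (maj_jets_step oU C0 s0 b0 K0 NbK PA PB) => //; exact: mg.
by move=> k phi Pphi x Ux; rewrite pgeom0 mulr1; exact: PA.
Qed.

Lemma is_derive_pow (f : 'rV[R]_n -> R) x v (l : R) k : is_derive x v f l ->
  is_derive x v (fun z => f z ^+ k.+1) (k.+1%:R * f x ^+ k * l).
Proof.
move=> Df; elim: k => [|k IH].
  by under eq_fun do rewrite expr1; rewrite expr0 !mul1r.
under eq_fun do rewrite exprS.
have := is_derive_mul Df IH; congr (is_derive _ _ _ _).
by rewrite -[k.+2%:R]natr1 exprS; ring.
Qed.

Lemma an_inv U f : open U -> an U f -> (forall x, U x -> f x != 0) -> an U (fun x => (f x)^-1).
Proof.
move=> oU [cf Hf] f0; split; first by move=> k; exact: cls_inv.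
move=> x Ux; have [d d0 Hd] := open_norm oU Ux.
pose m := `|f x| / 2; have m0 : 0 < m by rewrite divr_gt0// normr_gt0 f0.
have [d1 d10 Hd1] : exists2 d : R, 0 < d & forall y, `|y - x| < d -> m <= `|f y|.
  have /continuousP_norm/(_ _ m0)[d1 d10 H1] := cls_continuous (cf 0%N) Ux.
  exists d1 => // y /H1; rewrite distrC => H; have := lerB_dist (f x) (f y).
  by move: H; rewrite /m; lra.
have [r r0 [k k0 [b b0 Hb]]] := anb_family (fun i => anb_pd i (Hf x Ux)).
pose r' := Num.min r (Num.min d d1).
have r'0 : 0 < r' by rewrite !lt_min r0 d0.
(* The second entry is the condition [N%:R * b * s <= K / 2] of [maj_jets], for [N = 1], [s = m^-1]
   and [K = 2 * k']. *)
pose k' := Num.max k (b * m^-1).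
have k'0 : 0 <= k' by rewrite le_max k0.
have mi : 0 <= m^-1 by rewrite invr_ge0 ltW.
exists r' => //; exists (2 * k'); first exact: mulr_ge0.
exists m^-1 => // L.
(* Up to sign, the [j]-th derivative of 1/y is j! / y^(j+1). *)
pose Phi (j : nat) (phi : 'rV[R]_n -> R) := exists2 c : R, `|c| <= j`!%:R &
   phi = (fun z => c * ((f z)^-1) ^+ j.+1).
have key : forall L phi, Phi 0%N phi -> maj L (nb x r') phi (fun l => m^-1 * pgeom (2 * k') 2^-1 l).
  apply: (@maj_jets 1 Phi (nb x r') (fun i _ => pd i f) m^-1 m^-1 b (2 * k')) => //.
  - exact: nb_open.
  - exact: mulr_ge0.
  - by rewrite mul1r mulrAC divff// mul1r le_max lexx orbT.
  - move=> j phi [c cj ->] y; rewrite /nb /= !lt_min => /and3P[_ _ /Hd1 my].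
    rewrite normrM normrX normfV [m^-1 * _]mulrC -mulrA -exprS.
    apply: ler_pM => //.
    rewrite lerXn2r ?nnegrE// ?invr_ge0// lef_pV2 ?posrE//.
    exact: lt_le_trans my.
  - move=> j phi [c cj ->] i.
    exists (fun _ z => - (c * j.+1%:R) * ((f z)^-1) ^+ j.+2).
      move=> _; exists (- (c * j.+1%:R)) => //.
      by rewrite normrN normrM factS natrM mulrC normr_nat ler_wpM2l.
    move=> y; rewrite /nb /= !lt_min => /and3P[_ /Hd Uy _].
    have D1 : is_derive y (evec R i) f (pd i f y) by apply: pdP; exact: cls_derivable (cf 1%N) Uy.
    have D2 := is_derive_mull c (is_derive_pow j (is_derive_inv (f0 y Uy) D1)).
    move: D2; congr (is_derive _ _ _ _).
    by rewrite big_ord1 -exprVn; move: ((f y)^-1) (pd i f y) => a p; rewrite [a ^+ j.+2]exprS [a ^+ j.+1]exprS; ring.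
  - move=> L' _ i _; have := Hb i r' k' L'.
    rewrite /r' /k' ge_min lexx le_max lexx => /(_ isT isT).
    by apply: maj_le => l; rewrite ler_wpM2l//; exact: pgeom1_le.
apply: maj_le (key L (fun z => (f z)^-1) _) => [l|].
  by rewrite ler_wpM2l//; apply: pgeom_half_le; exact: mulr_ge0.
by exists 1; [rewrite normr1|apply/funext => z; rewrite mul1r expr1].
Qed.

End OneDim.

Let a01 : (0 : R) <= (0 : R) <= (1 : R). Proof. by rewrite lexx ler01. Qed.

Lemma is_derive_iter_comp m n (U' : set 'rV[R]_n) f (G : 'rV[R]_m -> 'rV[R]_n) y i
    (l : 'I_n -> R) (w : seq 'I_n) : open U' -> (forall k, cls 0 k U' f) -> U' (G y) ->
  (forall j, is_derive y (evec R i) (fun z => G z 0 j) (l j)) ->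
  is_derive y (evec R i) (fun z => iter_partial w f (G z))
    (\sum_j iter_partial (j :: w) f (G y) * l j).
Proof.
move=> oU' cf UGy dG.
have -> : \sum_j iter_partial (j :: w) f (G y) * l j =
    dotv (\row_j l j) (gradient (iter_partial w f) (G y)).
  by rewrite dotvE; apply: eq_bigr => j _; rewrite gradientE mxE mulrC pd_partial.
apply: is_derive_comp; last by move=> j; rewrite mxE.
have h := iter_cls (cf (size w).+1) (leqnSn _); rewrite subSnn in h.
exact: cls_fdiff oU' h UGy.
Qed.

Lemma an_comp m n (U : set 'rV[R]_m) (U' : set 'rV[R]_n) f (G : 'rV[R]_m -> 'rV[R]_n) :
  open U -> open U' -> an U' f -> (forall j, an U (fun x => G x 0 j)) -> loc_lip U G ->
  (forall x, U x -> U' (G x)) -> an U (fun x => f (G x)).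
Proof.
move=> oU oU' [cf Hf] hG lG UU'; split.
  by move=> k; apply: cls_comp (cf k) _ lG UU' => // j; have [+ _] := hG j; exact.
move=> x Ux; have [d d0 Hd] := open_norm oU Ux.
have [r1 r10 [s s0 [C C0 HC]]] := Hf _ (UU' x Ux).
have [d1 d10 Hd1] := lip_continuous lG Ux r10.
have [|r r0 [k k0 [b b0 Hb]]] :=
    @anb_family m ('I_m * 'I_n)%type (fun ij => pd ij.1 (fun x => G x 0 ij.2)) x.
  by move=> [i j]; apply: anb_pd; have [_] := hG j; exact.
pose r' := Num.min r (Num.min d d1).
have r'0 : 0 < r' by rewrite !lt_min r0 d0.
(* Again the condition of [maj_jets]: the chain rule has [n] terms, whose coefficients are the
   partial derivatives of [G], and [s] is the rate of [f]. *)
pose k' := Num.max k (n%:R * b * s).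
have k'0 : 0 <= k' by rewrite le_max k0.
exists r' => //; exists (2 * k'); first exact: mulr_ge0.
exists C => // L.
pose Phi (j : nat) (phi : 'rV[R]_m -> R) := exists2 w : seq 'I_n, size w = j &
   phi = (fun z => iter_partial w f (G z)).
have key : forall L phi, Phi 0%N phi -> maj L (nb x r') phi (fun l => C * pgeom (2 * k') 2^-1 l).
  apply: (@maj_jets m n Phi (nb x r') (fun i j => pd i (fun x => G x 0 j)) C s b (2 * k')) => //.
  - exact: nb_open.
  - exact: mulr_ge0.
  - by rewrite [2 * k']mulrC mulfK// le_max lexx orbT.
  - move=> j phi [w <- ->] y; rewrite /nb /= !lt_min => /and3P[_ _ /Hd1 my].
    exact: maj_pow_bound (HC _) my.
  - move=> j phi [w wj ->] i.
    exists (fun j' z => iter_partial (j' :: w) f (G z)).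
      by move=> j'; exists (j' :: w) => //=; rewrite wj.
    move=> y; rewrite /nb /= !lt_min => /and3P[_ /Hd Uy _].
    apply: is_derive_iter_comp oU' cf (UU' y Uy) _ => j'.
    by apply: pdP; have [+ _] := hG j' => /(_ 1%N) h; exact: cls_derivable h Uy.
  - move=> L' _ i j; have := Hb (i, j) r' k' L'.
    rewrite /r' /k' ge_min lexx le_max lexx => /(_ isT isT).
    by apply: maj_le => l; rewrite ler_wpM2l//; exact: pgeom1_le.
apply: maj_le (key L (fun z => f (G z)) _) => [l|]; last by exists [::].
by rewrite ler_wpM2l//; apply: pgeom_half_le; exact: mulr_ge0.
Qed.

(** Here the chain rule coefficients are the composites [H i j] o [G], that is, the level 0
    functions themselves, so the induction in [maj_jets] feeds on its own bound. The exponent 1/2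
    comes from the majorant equation G' = C / (1 - n s G), whose solution with G(0) = 0 satisfies G'
    = C (1 - 2 n C s t)^(-1/2). *)
Lemma an_ode m n (U : set 'rV[R]_m) (U' : set 'rV[R]_n) (G : 'rV[R]_m -> 'rV[R]_n)
    (H : 'I_m -> 'I_n -> 'rV[R]_n -> R) : open U -> open U' ->
  (forall x, U x -> U' (G x)) -> loc_lip U G ->
  (forall x, U x -> forall i j, is_derive x (evec R i) (fun x => G x 0 j) (H i j (G x))) ->
  (forall i j, an U' (H i j)) -> forall j, an U (fun x => G x 0 j).
Proof.
move=> oU oU' UU' lG dG hH j0.
have cG k j : cls 0 k U (fun x => G x 0 j).
  apply: (@cls_le _ _ a01 _ _ k.+1) => //.
  by apply: (cls_ode a01 oU oU' UU' lG dG) => i' j'; have [+ _] := hH i' j'; exact.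
split; first by move=> k; exact: cG.
move=> x Ux; have [d d0 Hd] := open_norm oU Ux.
have [|r1 r10 [s s0 [C C0 HC]]] :=
    @anb_family n ('I_m * 'I_n)%type (fun ij => H ij.1 ij.2) (G x).
  by move=> [i j]; have [_] := hH i j; apply; exact: UU'.
have [d1 d10 Hd1] := lip_continuous lG Ux r10.
have [d2 d20 Hd2] := cont_bounded (cls_continuous (cG 0%N j0) Ux).
pose r := Num.min d2 (Num.min d d1).
have r0 : 0 < r by rewrite !lt_min d20 d0.
pose K := 2 * (n%:R * C * s).
have K0 : 0 <= K by rewrite !mulr_ge0.
pose Phi (k : nat) (phi : 'rV[R]_m -> R) := exists2 w : seq 'I_n, size w = k &
   exists ij, phi = (fun z => iter_partial w (H ij.1 ij.2) (G z)).
have key : forall L phi, Phi 0%N phi -> maj L (nb x r) phi (fun l => C * pgeom K 2^-1 l).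
  apply: (@maj_jets m n Phi (nb x r) (fun i j z => H i j (G z)) C s C K) => //.
  - exact: nb_open.
  - by rewrite /K [2 * _]mulrC mulfK.
  - move=> k phi [w <- [ij ->]] y; rewrite /nb /= !lt_min => /and3P[_ _ /Hd1 my].
    exact: maj_pow_bound (HC ij r1 s _ (lexx _) (lexx _)) my.
  - move=> k phi [w wk [ij ->]] i.
    exists (fun j' z => iter_partial (j' :: w) (H ij.1 ij.2) (G z)).
      by move=> j'; exists (j' :: w) => /=; [rewrite wk|exists ij].
    move=> y; rewrite /nb /= !lt_min => /and3P[_ /Hd Uy _].
    apply: is_derive_iter_comp oU' _ (UU' y Uy) _; last by move=> j'; exact: dG.
    by have [] := hH ij.1 ij.2.
  - move=> L IH i j; apply: maj_le (IH 0%N _ _) => [l|].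
      by rewrite expr0 fact0 !mulr1 mul1r.
    by exists [::] => //; exists (i, j).
(* [M] bounds the function and [C] enters through its derivatives; [K' >= 1] absorbs the factor that
   [pgeomS] produces when the order is shifted by one. *)
pose M := `|G x 0 j0| + 1; pose K' := Num.max K 1.
have K'0 : 0 <= K' by rewrite le_max K0.
have M0 : 0 <= M by rewrite addr_ge0.
exists r => //; exists K' => //; exists (M + C); first exact: addr_ge0.
move=> L; apply: maj_S; split.
  move=> y; rewrite /nb /= !lt_min => /and3P[/Hd2 my _ _].
  by rewrite pgeom0 mulr1; apply: (le_trans my); rewrite lerDl.
move=> i; split.
  by move=> y; rewrite /nb /= !lt_min => /and3P[_ /Hd Uy _]; have [] := dG y Uy i j0.
apply: (@maj_ext _ _ _ _ (fun z => H i j0 (G z))); first exact: nb_open.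
  move=> y; rewrite /nb /= !lt_min => /and3P[_ /Hd Uy _].
  by apply/esym/is_derive_pd; exact: dG.
apply: maj_le (key L (fun z => H i j0 (G z)) _) => [l|]; last by exists [::] => //; exists (i, j0).
rewrite pgeomS mulr1; apply: ler_pM => //.
- by rewrite pgeom_ge0// invr_ge0.
- by rewrite lerDr.
rewrite -[leLHS]mul1r; apply: ler_pM => //.
- by rewrite pgeom_ge0// invr_ge0.
- by rewrite le_max lexx orbT.
apply: (@pgeom_le _ 1); rewrite ?mul1r ?invr_ge0 ?le_max ?lexx// => i'.
by rewrite mul1r; lra.
Qed.

End AnalyticClass.

(** * Series dominated by a geometric series of ratio 1/2 *)

Section SeriesFacts.
Variable R : realType.
Implicit Types (u : nat -> R).

Lemma cvg_norm_le u (l K : R) : u @ \oo --> l -> (forall k, `|u k| <= K) -> `|l| <= K.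
Proof.
move=> ul uK; rewrite leNgt; apply/negP => Kl.
have e0 : 0 < `|l| - K by rewrite subr_gt0.
have /cvgrPdist_lt/(_ _ e0)[N _ /(_ N (leqnn N))] := ul.
by have := uK N; have := lerB_dist l (u N); lra.
Qed.

Lemma half_lt1 : `|2^-1 : R| < 1.
Proof. by rewrite ger0_norm ?invr_ge0// invf_lt1// ltr1n. Qed.

Lemma series_half_le (a : R) k : 0 <= a -> series (geometric a 2^-1) k <= 2 * a.
Proof.
move=> a0; rewrite geometric_seriesE; last by rewrite lt_eqF// invf_lt1// ltr1n.
rewrite [leLHS](_ : _ = 2 * a * (1 - 2^-1 ^+ k)); last by rewrite /=; move: (2^-1 ^+ k) => p; field.
by rewrite ler_piMr ?mulr_ge0// gerBl exprn_ge0// invr_ge0.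
Qed.

Lemma half_series_cvg u (a : R) : (forall k, `|u k| <= a * 2^-1 ^+ k) -> cvgn (series u).
Proof.
move=> H; apply: normed_cvg.
apply: (@series_le_cvg _ _ (geometric a 2^-1)) => //=.
- move=> k; exact: le_trans (H k).
- apply: is_cvg_geometric_series; exact: half_lt1.
Qed.

Lemma half_series_bound u (a l : R) : 0 <= a -> (forall k, `|u k| <= a * 2^-1 ^+ k) ->
  series u @ \oo --> l -> `|l| <= 2 * a.
Proof.
move=> a0 H ul; apply: (cvg_norm_le ul) => k.
apply: le_trans (series_half_le k a0); apply: (le_trans (ler_norm_sum _ _ _)).
by apply: ler_sum => i _; exact: H.
Qed.

End SeriesFacts.

(** * Homogeneous polynomials and term by term differentiation *)

Section HomogeneousPoly.
Variables (R : realType) (n : nat).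
Notation V := 'rV[R]_n.
Implicit Types (h k : V -> R) (A B : R).

(* [HP d A h]: h behaves like a homogeneous polynomial of degree d whose
   coefficients have total absolute value at most A. *)
Fixpoint HP (d : nat) (A : R) h : Prop :=
  match d with
  | 0 => exists2 c : R, h = (fun=> c) & `|c| <= A
  | d'.+1 => (forall y, `|h y| <= A * `|y| ^+ d) /\
       forall i, (forall y, derivable h y (evec R i)) /\ HP d' (d%:R * A) (pd i h)
  end.

Lemma HP_bound d A h y : HP d A h -> `|h y| <= A * `|y| ^+ d.
Proof.
case: d => [[c -> cA]|d [H _]]; last exact: H.
by rewrite expr0 mulr1.
Qed.

Lemma HP_derivable d A h y i : HP d A h -> derivable h y (evec R i).
Proof.
case: d => [[c -> cA]|d [_ H]]; first exact: derivable_cst.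
by have [+ _] := H i; exact.
Qed.

Lemma pd_cst i (c : R) : pd i (fun _ : V => c) = (fun=> 0).
Proof. by apply/funext => y; apply: is_derive_pd; exact: is_derive_cst. Qed.

Lemma HP_le d A B h : A <= B -> HP d A h -> HP d B h.
Proof.
elim: d A B h => [|d IH] A B h AB.
  by move=> [c -> cA]; exists c => //; exact: le_trans AB.
move=> [H D]; split.
  by move=> y; apply: (le_trans (H y)); rewrite ler_wpM2r// exprn_ge0.
move=> i; have [dh hh] := D i; split=> //.
by apply: IH hh; rewrite ler_wpM2l.
Qed.

Lemma HP_0 d A : 0 <= A -> HP d A (fun=> 0).
Proof.
elim: d A => [|d IH] A A0; first by exists 0 => //; rewrite normr0.
split; first by move=> y; rewrite normr0 mulr_ge0// exprn_ge0.
move=> i; split; first by move=> y; exact: derivable_cst.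
by rewrite pd_cst; apply: IH; rewrite mulr_ge0.
Qed.

Lemma HP_add d A B h k : HP d A h -> HP d B k -> HP d (A + B) (fun y => h y + k y).
Proof.
elim: d A B h k => [|d IH] A B h k.
  move=> [a -> aA] [b -> bB]; exists (a + b) => //.
  by apply: (le_trans (ler_normD _ _)); exact: lerD.
move=> [H D] [K E]; split.
  by move=> y; apply: (le_trans (ler_normD _ _)); rewrite mulrDl; apply: lerD.
move=> i; have [dh hh] := D i; have [dk hk] := E i.
have DD y : is_derive y (evec R i) (fun y => h y + k y) (pd i h y + pd i k y).
  by apply: is_deriveD; apply: pdP; [exact: dh|exact: dk].
split; first by move=> y; case: (DD y).
have -> : pd i (fun y => h y + k y) = (fun y => pd i h y + pd i k y).
  by apply/funext => y; exact: is_derive_pd.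
by rewrite mulrDr; exact: IH.
Qed.

Lemma HP_scale d A h (c : R) : HP d A h -> HP d (`|c| * A) (fun y => c * h y).
Proof.
elim: d A h => [|d IH] A h.
  by move=> [a -> aA]; exists (c * a) => //; rewrite normrM ler_wpM2l.
move=> [H D]; split.
  by move=> y; rewrite normrM -mulrA ler_wpM2l.
move=> i; have [dh hh] := D i.
have DD y : is_derive y (evec R i) (fun y => c * h y) (c * pd i h y).
  by apply: is_derive_mull; apply: pdP; exact: dh.
split; first by move=> y; case: (DD y).
have -> : pd i (fun y => c * h y) = (fun y => c * pd i h y).
  by apply/funext => y; exact: is_derive_pd.
by rewrite mulrCA; exact: IH.
Qed.

(** The product rule lowers one of the two degrees at a time, so the induction runs on a bound [N]
    of their sum. *)
Lemma HP_mul N d e A B h k : (d + e <= N)%N -> 0 <= A -> 0 <= B ->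
  HP d A h -> HP e B k -> HP (d + e) (A * B) (fun y => h y * k y).
Proof.
elim: N d e A B h k => [|N IH] [|d] [|e] A B h k //.
- by move=> _ A0 B0 [a -> aA] [b -> bB]; exists (a * b) => //; rewrite normrM ler_pM.
- by move=> _ A0 B0 [a -> aA] [b -> bB]; exists (a * b) => //; rewrite normrM ler_pM.
- move=> _ A0 B0 [a -> aA] hk; apply: HP_le (HP_scale a hk).
  by rewrite ler_wpM2r.
- move=> _ A0 B0 hh [b -> bB]; rewrite addn0.
  have -> : (fun y => h y * b) = (fun y => b * h y) by apply/funext => y; rewrite mulrC.
  by apply: HP_le (HP_scale b hh); rewrite mulrC ler_wpM2l.
rewrite addSn ltnS => deN A0 B0 hh hk.
split.
  move=> y; rewrite normrM -addSn exprD mulrACA.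
  by apply: ler_pM => //; exact: HP_bound.
have [_ D] := hh; have [_ E] := hk.
move=> i; have [dh hh'] := D i; have [dk hk'] := E i.
have DD y : is_derive y (evec R i) (fun y => h y * k y) (h y * pd i k y + k y * pd i h y).
  by apply: is_derive_mul; apply: pdP; [exact: dh|exact: dk].
split; first by move=> y; case: (DD y).
have -> : pd i (fun y => h y * k y) = (fun y => h y * pd i k y + k y * pd i h y).
  by apply/funext => y; exact: is_derive_pd.
have m1 := IH d.+1 e _ _ _ _ _ A0 (mulr_ge0 (ler0n R e.+1) B0) hh hk'.
have m2 := IH e.+1 d _ _ _ _ _ B0 (mulr_ge0 (ler0n R d.+1) A0) hk hh'.
rewrite addSnnS in m1; have {}m1 := m1 deN.
have deN' : (e.+1 + d <= N)%N by rewrite addnC.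
have {}m2 := m2 deN'; rewrite addnC in m2.
apply: HP_le (HP_add m1 m2).
rewrite le_eqVlt; apply/orP; left; apply/eqP.
by rewrite -addSn natrD; ring.
Qed.

Lemma HP_coord i : HP 1 1 (fun y : V => y 0 i).
Proof.
split; first by move=> y; rewrite mul1r expr1 coord_norm_le.
move=> j; have DD (y : V) : is_derive y (evec R j) (fun y : V => y 0 i) (evec R j 0 i).
  exact: is_derive_coord.
split; first by move=> y; case: (DD y).
exists (evec R j 0 i); first by apply/funext => y; exact: is_derive_pd.
by rewrite mul1r mxE eqxx /=; case: (i == j); rewrite ?normr1 ?normr0.
Qed.

Lemma HP_pow i (k : nat) : HP k 1 (fun y : V => y 0 i ^+ k).
Proof.
elim: k => [|k IH]; first by exists 1; rewrite ?normr1//; apply/funext => y; rewrite expr0.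
under eq_fun do rewrite exprS.
by have := HP_mul (leqnn _) ler01 ler01 (HP_coord i) IH; rewrite mulr1.
Qed.

Lemma HP_monom (beta : 'I_n -> nat) : HP (\sum_i beta i) 1 (monom beta).
Proof.
rewrite /monom; elim: (index_enum 'I_n) => [|i s IH].
  rewrite big_nil; exists 1; rewrite ?normr1//.
  by apply/funext => y; rewrite big_nil.
rewrite big_cons (_ : (fun y : V => _) =
  (fun y : V => y 0 i ^+ beta i * \prod_(j <- s) y 0 j ^+ beta j)); last first.
  by apply/funext => y; rewrite big_cons.
by have := HP_mul (leqnn _) ler01 ler01 (HP_pow i (beta i)) IH; rewrite mulr1.
Qed.

Lemma HP_sum d (I : Type) (s : seq I) (P : pred I) (f : I -> V -> R) (c : I -> R) :
  (forall i, P i -> HP d (c i) (f i)) ->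
  HP d (\sum_(i <- s | P i) c i) (fun y => \sum_(i <- s | P i) f i y).
Proof.
move=> H; elim: s => [|i s IH].
  rewrite big_nil (_ : (fun y : V => _) = (fun=> 0)); first exact: HP_0.
  by apply/funext => y; rewrite big_nil.
rewrite big_cons; case: ifP => [Pi|nPi].
  rewrite (_ : (fun y : V => _) = (fun y => f i y + \sum_(j <- s | P j) f j y)).
    by apply: HP_add => //; exact: H.
  by apply/funext => y; rewrite big_cons Pi.
rewrite (_ : (fun y : V => _) = (fun y => \sum_(j <- s | P j) f j y)) //.
by apply/funext => y; rewrite big_cons nPi.
Qed.

Lemma second_order_bound h y i (t E s : R) : `|y| < s -> `|y + t *: evec R i| < s ->
  (forall z, derivable h z (evec R i)) -> (forall z, derivable (pd i h) z (evec R i)) ->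
  (forall z, `|z| < s -> `|pd i (pd i h) z| <= E) ->
  `|h (y + t *: evec R i) - h y - t * pd i h y| <= t ^+ 2 * E.
Proof.
move=> ys yts dh ddh HE.
have [|t1 t1I E1] := @MVT_line _ _ h y (evec R i) t; first by move=> *; exact: dh.
have [|t2 t2I E2] := @MVT_line _ _ (pd i h) y (evec R i) (t1 * t); first by move=> *; exact: ddh.
rewrite E1 -pdE -mulrBr E2 -pdE.
have zs : `|y + (t2 * (t1 * t)) *: evec R i| < s.
  have -> : y + (t2 * (t1 * t)) *: evec R i =
     (1 - t2 * t1) *: y + (t2 * t1) *: (y + t *: evec R i).
    by apply/rowP => j; rewrite !mxE; ring.
  case/andP: t1I => a0 a1; case/andP: t2I => b0 b1.
  have c0 : 0 <= t2 * t1 by rewrite mulr_ge0.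
  have c1 : t2 * t1 <= 1 by rewrite mulr_ile1.
  apply: (le_lt_trans (ler_normD _ _)); rewrite (normrZ (1 - t2 * t1)) (normrZ (t2 * t1)) (ger0_norm c0) ger0_norm ?subr_ge0//.
  move: (t2 * t1) (`|y|) (`|y + _|) c0 c1 ys yts => c a b c0 c1 ys yts.
  by have [c2|c2] := leP c (1 / 2); nra.
have Ez := HE _ zs; move: (pd i (pd i h) _) Ez => q Ez.
have -> : t * (t1 * t * q) = t ^+ 2 * (t1 * q) by ring.
rewrite normrM ger0_norm ?sqr_ge0// ler_wpM2l ?sqr_ge0// normrM.
case/andP: t1I => a0 a1; rewrite ger0_norm//.
by apply: le_trans Ez; rewrite ler_piMl.
Qed.

(** The first-order remainder of each term is at most t^2 times a bound on its second derivative.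
    These bounds are summable, so the remainder of the whole sum is O(t^2). *)
Lemma termwise_derivative (h : nat -> V -> R) f g (s a : R) i : 0 <= a ->
  (forall d z, derivable (h d) z (evec R i)) ->
  (forall d z, derivable (pd i (h d)) z (evec R i)) ->
  (forall d z, `|z| < s -> `|pd i (pd i (h d)) z| <= a * 2^-1 ^+ d) ->
  (forall z, `|z| < s -> series (fun d => h d z) @ \oo --> (f z : R)) ->
  (forall z, `|z| < s -> series (fun d => pd i (h d) z) @ \oo --> (g z : R)) ->
  forall y, `|y| < s -> is_derive y (evec R i) f (g y).
Proof.
move=> a0 dh ddh HE Hf Hg y ys; apply/is_deriveP => e e0.
have sy : 0 < s - `|y| by rewrite subr_gt0.
have a1 : 0 < 2 * a + 1 by rewrite ltr_wpDl// mulr_ge0.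
exists (Num.min (s - `|y|) (e / (2 * a + 1))); first by rewrite lt_min sy divr_gt0.
move=> t; rewrite lt_min => /andP[ts te].
have yts : `|y + t *: evec R i| < s.
  apply: (le_lt_trans (ler_normD _ _)); rewrite -ltrBrDl normrZ.
  apply: le_lt_trans ts; rewrite -[leRHS]mulr1 ler_wpM2l//; exact: norm_evec.
have limt : (fun N => t * series (fun d => pd i (h d) y) N) @ \oo --> t * g y.
  by apply: cvgM; [exact: cvg_cst|exact: Hg].
have lim := cvgB (cvgB (Hf _ yts) (Hf _ ys) : _ @ \oo --> _) limt.
have bound N : `|(series (fun d => h d (y + t *: evec R i)) N - series (fun d => h d y) N)
    - t * series (fun d => pd i (h d) y) N| <= t ^+ 2 * (2 * a).
  rewrite /series /= mulr_sumr -!sumrB.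
  apply: (le_trans (ler_norm_sum _ _ _)).
  apply: le_trans (_ : \sum_(0 <= d < N) t ^+ 2 * (a * 2^-1 ^+ d) <= _).
    apply: ler_sum => d _; apply: (second_order_bound ys yts) => //; exact: HE.
  rewrite -mulr_sumr ler_wpM2l ?sqr_ge0//.
  exact: (series_half_le N a0).
have key : `|f (y + t *: evec R i) - f y - t * g y| <= t ^+ 2 * (2 * a).
  exact: (cvg_norm_le (lim _ _) bound).
apply: (le_trans key).
rewrite -[t ^+ 2]ger0_norm ?sqr_ge0// normrX expr2 -mulrA [leRHS]mulrC ler_wpM2l//.
have := ltW te; rewrite ler_pdivlMr// => te'.
by apply: le_trans te'; rewrite ler_wpM2l// lerDl.
Qed.

End HomogeneousPoly.

(** * From power series to Cauchy estimates *)

Section AnalyticOn.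
Variables (R : realType) (n : nat).
Notation V := 'rV[R]_n.
Implicit Types (f g : V -> R) (x y : V).

(** The quotient is l! times a binomial coefficient, which is at most 2^(d+l). *)
Lemma fact_add_le (d l : nat) : (d + l)`!%:R / d`!%:R <= l`!%:R * 2 ^+ (d + l) :> R.
Proof.
rewrite ler_pdivrMr ?ltr0n ?fact_gt0//.
rewrite -natrX -!natrM ler_nat.
have bin_le N k : ('C(N, k) <= 2 ^ N)%N.
  elim: N k => [|N IH] [|k] //=; rewrite ?bin0 ?expn_gt0//.
  by rewrite binS expnS mul2n -addnn leq_add.
have := @bin_fact (d + l) d (leq_addr _ _); rewrite addKn => <-.
by rewrite mulnAC [leqRHS]mulnC [(l`! * _)%N]mulnC leq_mul2r bin_le orbT.
Qed.

(** The sizes are those of the [l]-th derivative of a series whose term of degree d has size M T^d.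
    Keeping [l] as a parameter, instead of weakening the bound after each differentiation, leaves
    the radius [(4 * T)^-1] unchanged. *)
Definition PS (M T : R) (l : nat) x f : Prop := exists2 h : nat -> V -> R,
  forall d, HP d (M * ((d + l)`!%:R / d`!%:R) * T ^+ (d + l)) (h d) &
  forall y, `|y| < (4 * T)^-1 -> series (fun d => h d y) @ \oo --> f (x + y).

(** The factor 2^d of [fact_add_le] is paid for by the radius: the remaining ratio is 2 T / (4 T) =
    1/2. *)
Lemma HP_half_bound (M T : R) l d (h : V -> R) y : 0 <= M -> 0 < T ->
  HP d (M * ((d + l)`!%:R / d`!%:R) * T ^+ (d + l)) h -> `|y| < (4 * T)^-1 ->
  `|h y| <= M * l`!%:R * (2 * T) ^+ l * 2^-1 ^+ d.
Proof.
move=> M0 T0 Hh yT; apply: (le_trans (HP_bound y Hh)).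
have T0' := ltW T0.
apply: le_trans (_ : M * (l`!%:R * 2 ^+ (d + l)) * T ^+ (d + l) * (4 * T)^-1 ^+ d <= _).
  apply: ler_pM => //.
  - by rewrite !mulr_ge0 ?invr_ge0 ?exprn_ge0.
  - by rewrite ler_wpM2r ?exprn_ge0// ler_wpM2l// fact_add_le.
  - by rewrite lerXn2r ?nnegrE// ?invr_ge0 ?mulr_ge0// ltW.
rewrite le_eqVlt; apply/orP; left; apply/eqP.
rewrite invfM exprMn !exprD [(2 * T) ^+ l]exprMn.
have -> : (4^-1 : R) ^+ d = 2^-1 ^+ d * 2^-1 ^+ d by rewrite -exprMn; congr (_ ^+ _); field.
have E1 : (2 : R) ^+ d * 2^-1 ^+ d = 1 by rewrite -exprMn divff ?expr1n.
have E2 : T ^+ d * T^-1 ^+ d = 1 by rewrite -exprMn divff ?expr1n// gt_eqF.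
have -> : M * (l`!%:R * (2 ^+ d * 2 ^+ l)) * (T ^+ d * T ^+ l) * (2^-1 ^+ d * 2^-1 ^+ d * T^-1 ^+ d) =
  M * l`!%:R * (2 ^+ l * T ^+ l) * 2^-1 ^+ d * (2 ^+ d * 2^-1 ^+ d) * (T ^+ d * T^-1 ^+ d) by ring.
by rewrite E1 E2 !mulr1.
Qed.

Lemma PS_bound M T l x f y : 0 <= M -> 0 < T -> PS M T l x f -> `|y| < (4 * T)^-1 ->
  `|f (x + y)| <= 2 * M * l`!%:R * (2 * T) ^+ l.
Proof.
move=> M0 T0 [h Hh Hf] yT.
have B d := HP_half_bound M0 T0 (Hh d) yT.
have := half_series_bound _ B (Hf y yT); rewrite !mulrA; apply.
by rewrite !mulr_ge0// exprn_ge0// mulr_ge0// ltW.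
Qed.

Lemma PS_derivative M T l x f i : 0 <= M -> 0 < T -> PS M T l x f ->
  (forall y, nb x (4 * T)^-1 y -> derivable f y (evec R i)) /\ PS M T l.+1 x (pd i f).
Proof.
move=> M0 T0 [h Hh Hf]; have T0' := ltW T0.
have Hd d : HP d (M * ((d + l.+1)`!%:R / d`!%:R) * T ^+ (d + l.+1)) (pd i (h d.+1)).
  have [_ /(_ i)[_ hh]] := Hh d.+1; apply: HP_le hh.
  rewrite addSnnS le_eqVlt; apply/orP; left; apply/eqP.
  rewrite [d.+1`!]factS natrM; field.
  by rewrite pnatr_eq0 -lt0n fact_gt0 nat1r pnatr_eq0.
have p0 : pd i (h 0%N) = (fun=> 0) by have [c -> _] := Hh 0%N; exact: pd_cst.
have p1 : pd i (pd i (h 1%N)) = (fun=> 0) by have [c -> _] := Hd 0%N; exact: pd_cst.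
have cv y : `|y| < (4 * T)^-1 -> cvgn (series (fun d => pd i (h d) y)).
  move=> yT; apply: (@half_series_cvg _ _ (2 * (M * l.+1`!%:R * (2 * T) ^+ l.+1))) => -[|d].
    by rewrite p0 normr0 !mulr_ge0// ?exprn_ge0 ?invr_ge0// mulr_ge0.
  apply: (le_trans (HP_half_bound M0 T0 (Hd d) yT)).
  rewrite [2^-1 ^+ d.+1]exprS le_eqVlt; apply/orP; left; apply/eqP.
  by move: (_ ^+ l.+1) (2^-1 ^+ d) => a b; field.
pose g y := limn (series (fun d => pd i (h d) y)).
have Hg y : `|y| < (4 * T)^-1 -> series (fun d => pd i (h d) y) @ \oo --> g y.
  by move=> /cv.
have a0 : 0 <= 4 * (M * l.+2`!%:R * (2 * T) ^+ l.+2).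
  apply: mulr_ge0 => //; apply: mulr_ge0; first exact: mulr_ge0.
  by apply: exprn_ge0; exact: mulr_ge0.
have D y : `|y| < (4 * T)^-1 -> is_derive y (evec R i) (fun z => f (x + z)) (g y).
  apply: (@termwise_derivative _ _ h (fun z => f (x + z)) g _ _ i a0) => //.
  - by move=> d z; exact: HP_derivable (Hh d).
  - move=> [|d] z; last exact: HP_derivable (Hd d).
    by rewrite p0; exact: derivable_cst.
  - move=> [|[|d]] z zT.
    + by rewrite p0 pd_cst normr0 mulr_ge0// exprn_ge0// invr_ge0.
    + by rewrite p1 normr0 mulr_ge0// exprn_ge0// invr_ge0.
    have Hdd : HP d (M * ((d + l.+2)`!%:R / d`!%:R) * T ^+ (d + l.+2)) (pd i (pd i (h d.+2))).
      have [_ /(_ i)[_ hh]] := Hd d.+1; apply: HP_le hh.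
      rewrite addSnnS le_eqVlt; apply/orP; left; apply/eqP.
      rewrite [d.+1`!]factS natrM; field.
      by rewrite pnatr_eq0 -lt0n fact_gt0 nat1r pnatr_eq0.
    apply: (le_trans (HP_half_bound M0 T0 Hdd zT)).
    rewrite [2^-1 ^+ d.+2]exprS [2^-1 ^+ d.+1]exprS le_eqVlt; apply/orP; left; apply/eqP.
    by move: (_ ^+ l.+2) (2^-1 ^+ d) => a b; field.
have Dx y : nb x (4 * T)^-1 y -> is_derive y (evec R i) f (g (y - x)).
  move=> yT; have /is_deriveP D1 := D _ yT.
  apply/is_deriveP => e /D1[dd dd0 Hdd]; exists dd => // t /Hdd.
  by rewrite !addrA [x + y]addrC addrK.
split; first by move=> y /Dx[].
exists (fun d => pd i (h d.+1)) => // y yT.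
have -> : pd i f (x + y) = g y.
  have yx : nb x (4 * T)^-1 (x + y) by rewrite /nb /= addrBK.
  have := Dx _ yx; rewrite addrBK => D1; exact: is_derive_pd.
(* The constant term differentiates to 0, so dropping it only shifts the partial sums by one. *)
have -> : series (fun d => pd i (h d.+1) y) = (fun N => series (fun d => pd i (h d) y) N.+1).
  by apply/funext => N; rewrite /series /= big_nat_recl// p0 add0r.
by rewrite (cvg_shiftS (series (fun d => pd i (h d) y))); exact: Hg.
Qed.

Lemma PS_maj L M T l x f : 0 <= M -> 0 < T -> PS M T l x f ->
  maj L (nb x (4 * T)^-1) f (fun j => 2 * M * (l + j)`!%:R * (2 * T) ^+ (l + j)).
Proof.
move=> M0 T0; elim: L l f => [|L IH] l f Hf.
  move=> y yT; have := PS_bound M0 T0 Hf yT.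
  by rewrite addn0 addrC subrK.
split.
  move=> y yT; have := PS_bound M0 T0 Hf yT.
  by rewrite addn0 addrC subrK.
move=> i; have [df Hd] := PS_derivative i M0 T0 Hf; split=> //.
by apply: maj_le (IH _ _ Hd) => j; rewrite addSnnS.
Qed.

Lemma maj_cls k x (r : R) f (c : nat -> R) :
  (forall L, maj L (nb x r) f c) -> cls 0 k (nb x r) f.
Proof.
have a01 : (0 : R) <= (0 : R) <= (1 : R) by rewrite lexx ler01.
elim: k f c => [|k IH] f c H.
  apply: lip_cls0 => // y yr.
  have [d d0 Hd] := open_norm (@nb_open _ _ x r) yr.
  have [_ H1] := H 1%N; exists d => //; exists (n%:R * `|c 1%N|); first by rewrite mulr_ge0.
  move=> u v ur vr.
  have Hb z : `|z - y| < d -> forall i, derivable f z (evec R i) /\ `|pd i f z| <= `|c 1%N|.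
    move=> /Hd zr i; have [df b] := H1 i; split; first exact: df.
    by apply: (le_trans (b z zr)); exact: ler_norm.
  apply: (le_trans (ball_lipschitz Hb vr ur)).
  rewrite -mulr_sumr [n%:R * _]mulrC -mulrA ler_wpM2l//.
  by apply: le_trans (sum_norm_le _); apply: ler_sum => i _; rewrite !mxE.
split.
  by move=> y; exact: cls_continuous (IH f c H).
move=> i; split; first by move=> y; have [_ /(_ i)[+ _]] := H 1%N; exact.
by apply: (IH _ (fun l => c l.+1)) => L; have [_ /(_ i)[_]] := H L.+1.
Qed.

Lemma cls_local k (U : set V) f :
  (forall x, U x -> exists2 W : set V, W x & cls 0 k W f) -> cls 0 k U f.
Proof.
elim: k f => [|k IH] f H.
  by split=> x /H[W Wx [c1 c2]]; [exact: c1|exact: c2].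
split; first by move=> x /H[W Wx [c1 _]]; exact: c1.
move=> i; split; first by move=> x /H[W Wx [_ /(_ i)[c2 _]]]; exact: c2.
by apply: IH => x /H[W Wx [_ /(_ i)[_ c2]]]; exists W.
Qed.

Lemma analytic_on_PS U f x : analytic_on U f -> U x ->
  exists2 M : R, 0 <= M & exists2 T : R, 0 < T & PS M T 0 x f.
Proof.
move=> Hf Ux; have [r [r0 [a Ha]]] := Hf x Ux.
pose rho := r / 2; have rho0 : 0 < rho by rewrite divr_gt0.
have rhor : rho < r by rewrite /rho; lra.
pose P d (beta : {ffun 'I_n -> 'I_d.+1}) := (\sum_(i < n) nat_of_ord (beta i) == d)%N.
pose A (d : nat) : R := \sum_(beta : {ffun 'I_n -> 'I_d.+1} | P d beta) `|a (fun i => nat_of_ord (beta i))|.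
have A0 d : 0 <= A d by apply: sumr_ge0.
(* At this point every monomial of degree d takes the value rho^d, so absolute convergence there
   bounds [A d * rho ^+ d]. *)
pose z : V := \row_i rho.
have [M M0 HM] : exists2 M : R, 0 <= M & forall d, A d * rho ^+ d <= M.
  have zr : ball x r (x + z).
    rewrite (rV_ballE x r) addrBK; apply: norm_lt_coord => // i; rewrite mxE gtr0_norm//.
  have [/cvg_series_cvg_0 cv _] := Ha _ zr.
  have := cvg_seq_bounded (cvgP _ cv) => -[M [Mr HM]].
  exists (`|M| + 1) => [|d]; first by rewrite addr_ge0.
  have Mlt : M < `|M| + 1 by apply: (le_lt_trans (ler_norm M)); rewrite ltrDl.
  have := HM _ Mlt d I.
  apply: le_trans; apply: le_trans (ler_norm _).
  rewrite /A mulr_suml; apply: ler_sum => beta /eqP bd.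
  rewrite normrM; apply: ler_wpM2l => //.
  rewrite /monom (eq_bigr (fun i => rho ^+ (beta i))) => [|i _].
    by rewrite prodrXr bd ger0_norm ?exprn_ge0// ltW.
  by rewrite addrBK mxE.
exists M => //; exists rho^-1; first by rewrite invr_gt0.
exists (fun d y => \sum_(beta : {ffun 'I_n -> 'I_d.+1} | P d beta)
          a (fun i => nat_of_ord (beta i)) * monom (fun i => nat_of_ord (beta i)) y).
  move=> d; rewrite addn0 divff ?mulr1 ?pnatr_eq0 -?lt0n ?fact_gt0//.
  apply: (@HP_le _ _ _ (A d)).
    by rewrite exprVn ler_pdivlMr// exprn_gt0.
  apply: HP_sum => beta /eqP bd.
  by have := HP_scale (a (fun i => nat_of_ord (beta i))) (HP_monom R (fun i => nat_of_ord (beta i))); rewrite mulr1 bd.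
move=> y yr.
have yb : ball x r (x + y).
  rewrite (rV_ballE x r) addrBK; apply: (lt_trans yr).
  by rewrite invfM invrK /rho; lra.
by have [_] := Ha _ yb; rewrite addrBK.
Qed.

Lemma analytic_on_an U f : open U -> analytic_on U f -> an U f.
Proof.
move=> oU Hf.
have key x : U x -> exists2 r : R, 0 < r & exists2 k : R, 0 <= k & exists2 C : R, 0 <= C &
    forall L, maj L (nb x r) f (fun l => C * pgeom k 1 l).
  move=> Ux; have [M M0 [T T0 Hp]] := analytic_on_PS Hf Ux.
  exists (4 * T)^-1; first by rewrite invr_gt0 mulr_gt0.
  exists (2 * T); first by rewrite mulr_ge0// ltW.
  exists (2 * M); first exact: mulr_ge0.
  move=> L; apply: maj_le (PS_maj L M0 T0 Hp) => l.
  by rewrite add0n pgeom_fact [(2 * T) ^+ l * _]mulrC mulrA.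
split=> // k; apply: cls_local => x /key[r r0 [kk kk0 [C C0 HC]]].
by exists (nb x r); [exact: nbxx|exact: maj_cls HC].
Qed.

End AnalyticOn.

(** * Taylor's formula on the unit interval *)

Section Taylor.
Variable R : realType.

Lemma derivative_bound (f df g dg : R -> R) : f 0 = 0 -> g 0 = 0 ->
  (forall t : R, 0 <= t <= 1 -> is_derive t 1 f (df t)) ->
  (forall t : R, 0 <= t <= 1 -> is_derive t 1 g (dg t)) ->
  (forall t : R, 0 <= t <= 1 -> `|df t| <= dg t) ->
  forall t : R, 0 <= t <= 1 -> `|f t| <= g t.
Proof.
move=> f0 g0 Df Dg H.
have mono (p dp : R -> R) (t : R) : 0 <= t <= 1 -> p 0 = 0 ->
    (forall t : R, 0 <= t <= 1 -> is_derive t 1 p (dp t)) ->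
    (forall t : R, 0 <= t <= 1 -> 0 <= dp t) -> 0 <= p t.
  move=> /andP[t0 t1] p0 Dp dp0.
  have sub s : s \in `[0, t] -> 0 <= s <= 1.
    by rewrite in_itv /= => /andP[-> /le_trans]; apply.
  have [||c ct] := @MVT_segment R p dp 0 t t0.
  - by move=> s /subset_itv_oo_cc /sub; exact: Dp.
  - apply: continuous_in_subspaceT => s /set_mem /= /sub sI.
    by apply/differentiable_continuous/derivable1_diffP; case: (Dp s sI).
  rewrite p0 !subr0 => ->; rewrite mulr_ge0//.
  by apply: dp0; exact: sub.
move=> t tI; rewrite ler_norml; apply/andP; split.
  rewrite -subr_ge0 opprK; apply: (mono (fun s => f s + g s) (fun s => df s + dg s)) => //.
  - by rewrite f0 g0 addr0.
  - by move=> s sI; apply: is_deriveD; [exact: Df|exact: Dg].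
  - by move=> s /H; rewrite ler_norml => /andP[]; lra.
rewrite -subr_ge0; apply: (mono (fun s => g s - f s) (fun s => dg s - df s)) => //.
- by rewrite f0 g0 subr0.
- by move=> s sI; apply: is_deriveB; [exact: Dg|exact: Df].
- by move=> s /H; rewrite ler_norml => /andP[]; lra.
Qed.

Lemma is_derive_monom (c : R) (d : nat) (t : R) :
  is_derive t 1 (fun s : R => c * s ^+ d.+1 / d.+1`!%:R) (c * t ^+ d / d`!%:R).
Proof.
have D : is_derive t 1 (fun s : R => s ^+ d.+1) (d.+1%:R * t ^+ d).
  elim: d => [|d IH].
    rewrite expr0 mulr1 (_ : (fun s : R => s ^+ 1) = id); first exact: is_derive_id.
    by apply/funext => s; rewrite expr1.
  rewrite (_ : (fun s : R => s ^+ d.+2) = (fun s => s * s ^+ d.+1)).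
    have := @is_deriveM R R id (fun s : R => s ^+ d.+1) t 1 1 _ (is_derive_id _ _) IH.
    congr (is_derive _ _ _ _); rewrite -[d.+2%:R]natr1 -[LHS]/(t * _ + t ^+ d.+1 * 1) exprS; ring.
  by apply/funext => s; rewrite exprS.
have := @is_deriveZ _ _ _ _ (c / d.+1`!%:R) _ _ _ D.
have -> : (c / d.+1`!%:R) \*: (fun s : R => s ^+ d.+1) = (fun s : R => c * s ^+ d.+1 / d.+1`!%:R).
  by apply/funext => s; rewrite /= -[_ *: _]/(_ * _) mulrAC.
congr (is_derive _ _ _ _).
rewrite -[_ *: _]/(_ * (_ * _)) factS natrM; field.
by rewrite pnatr_eq0 -lt0n fact_gt0 nat1r pnatr_eq0.
Qed.

Lemma taylor_bound L (phi : nat -> R -> R) (M : R) : 0 <= M ->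
  (forall d (t : R), 0 <= t <= 1 -> is_derive t 1 (phi d) (phi d.+1 t)) ->
  (forall t : R, 0 <= t <= 1 -> `|phi L t| <= M) ->
  forall t : R, 0 <= t <= 1 ->
   `|phi 0%N t - \sum_(0 <= d < L) phi d 0 * t ^+ d / d`!%:R| <= M * t ^+ L / L`!%:R.
Proof.
move=> M0; elim: L phi => [|L IH] phi D H t tI.
  by rewrite big_geq// subr0 expr0 fact0 mulr1 divr1; exact: H.
have IH' := IH (fun d => phi d.+1) (fun d => D d.+1) H.
apply: (@derivative_bound (fun t => phi 0%N t - \sum_(0 <= d < L.+1) phi d 0 * t ^+ d / d`!%:R)
   (fun t => phi 1%N t - \sum_(0 <= d < L) phi d.+1 0 * t ^+ d / d`!%:R)
   (fun t => M * t ^+ L.+1 / L.+1`!%:R) (fun t => M * t ^+ L / L`!%:R)) => //.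
- rewrite big_nat_recl// expr0 fact0 mulr1 divr1 big1 ?addr0 ?subrr// => d _.
  by rewrite expr0n mulr0 mul0r.
- by rewrite expr0n mulr0 mul0r.
- move=> s sI.
  have -> : (fun t => phi 0%N t - \sum_(0 <= d < L.+1) phi d 0 * t ^+ d / d`!%:R) =
     (fun t => phi 0%N t - (phi 0%N 0 + \sum_(0 <= d < L) phi d.+1 0 * t ^+ d.+1 / d.+1`!%:R)).
    by apply/funext => u; rewrite big_nat_recl// expr0 fact0 mulr1 divr1.
  apply: is_deriveB; first exact: D.
  rewrite -[\sum_(0 <= d < L) _]add0r; apply: is_deriveD.
  by apply: is_derive_sum_seq => d; exact: is_derive_monom.
- by move=> s _; exact: is_derive_monom.
Qed.

End Taylor.

(** * From Cauchy estimates to power series *)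

Section Words.
Variables (R : realType) (n : nat).
Notation V := 'rV[R]_n.

(** Derivatives of order [d] are indexed by words, as in [iter_partial]; this avoids permuting
    partial derivatives. [sum_multiindex] regroups them by letter counts when the coefficients are
    needed. *)
Fixpoint words (d : nat) : seq (seq 'I_n) :=
  if d is d'.+1 then [seq i :: w | i <- enum 'I_n, w <- words d'] else [:: [::]].

Lemma sum_words d (F : seq 'I_n -> R) :
  \sum_(w <- words d.+1) F w = \sum_i \sum_(w <- words d) F (i :: w).
Proof. by rewrite /= big_allpairs_dep big_enum. Qed.

Lemma words_size d w : w \in words d -> size w = d.
Proof.
elim: d w => [|d IH] w /=; first by rewrite inE => /eqP ->.
by move=> /allpairsP[[i v] /= [_ /IH <- ->]].
Qed.

Lemma sum_words_le d (F : seq 'I_n -> R) (B : R) : (forall w, size w = d -> F w <= B) ->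
  \sum_(w <- words d) F w <= n%:R ^+ d * B.
Proof.
elim: d F => [|d IH] F H; first by rewrite big_seq1 expr0 mul1r; exact: H.
rewrite sum_words exprS -mulrA.
apply: le_trans (_ : \sum_(i < n) n%:R ^+ d * B <= _).
  by apply: ler_sum => i _; apply: IH => w wd; apply: H; rewrite /= wd.
by rewrite sumr_const card_ord -[_ *+ n]mulr_natl.
Qed.

Definition wmon (h : V) (w : seq 'I_n) : R := \prod_(i <- w) h 0 i.

Lemma wmon_le h w : `|wmon h w| <= `|h| ^+ size w.
Proof.
rewrite /wmon; elim: w => [|i w IH]; first by rewrite big_nil normr1 expr0.
by rewrite big_cons normrM exprS; apply: ler_pM => //; exact: coord_norm_le.
Qed.

Lemma wmon_monom h w : wmon h w = monom (fun i => count_mem i w) h.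
Proof.
rewrite /wmon /monom; elim: w => [|i w IH].
  by rewrite big_nil big1 // => i _; rewrite expr0.
rewrite big_cons IH [RHS](eq_bigr (fun j => h 0 j ^+ (i == j) * h 0 j ^+ count_mem j w)).
  rewrite big_split /= [X in _ = X * _](bigD1 i)//= eqxx expr1.
  rewrite [X in _ = (_ * X) * _]big1 ?mulr1// => j ji.
  by rewrite eq_sym (negbTE ji) expr0.
by move=> j _; rewrite /= exprD.
Qed.

Lemma sum_count (w : seq 'I_n) : (\sum_(i < n) count_mem i w)%N = size w.
Proof.
elim: w => [|i w IH]; first by rewrite big1.
rewrite /= big_split /= IH (bigD1 i)//= eqxx big1 ?addn0// => j ji.
by rewrite eq_sym (negbTE ji).
Qed.

Lemma sum_multiindex d (X : seq 'I_n -> R) :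
  \sum_(beta : {ffun 'I_n -> 'I_d.+1} | (\sum_(i < n) nat_of_ord (beta i) == d)%N)
     \sum_(w <- words d | [forall i, count_mem i w == nat_of_ord (beta i)]) X w
  = \sum_(w <- words d) X w.
Proof.
rewrite (exchange_big_dep xpredT)//= big_seq [RHS]big_seq; apply: eq_bigr => w /words_size wd.
rewrite (big_pred1 [ffun i => inord (count_mem i w)])// => beta /=.
have cd i : (count_mem i w < d.+1)%N by rewrite ltnS -wd count_size.
apply/andP/eqP => [[_ /forallP H]|->].
  by apply/ffunP => i; rewrite ffunE; apply: val_inj; rewrite /= inordK// (eqP (H i)).
split; last by apply/forallP => i; rewrite ffunE inordK.
apply/eqP; rewrite -[RHS]wd -sum_count; apply: eq_bigr => i _.
by rewrite ffunE inordK.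
Qed.

Lemma directional_derivative U (f : V -> R) (x h : V) d (t : R) :
  open U -> (forall k, cls 0 k U f) -> U (x + t *: h) ->
  is_derive t 1 (fun s => \sum_(w <- words d) wmon h w * iter_partial w f (x + s *: h))
    (\sum_(w <- words d.+1) wmon h w * iter_partial w f (x + t *: h)).
Proof.
move=> oU cf Ut; rewrite sum_words exchange_big /=.
apply: (@is_derive_sum_seq R R _ (words d)) => w.
have hw := iter_cls (cf (size w).+1) (leqnSn _); rewrite subSnn in hw.
have [D1 E1] := fdiff_is_derive h (cls_fdiff oU hw Ut).
have D2 := is_derive_line D1; rewrite E1 in D2.
have -> : \sum_i wmon h (i :: w) * iter_partial (i :: w) f (x + t *: h) =
   wmon h w * dotv h (gradient (iter_partial w f) (x + t *: h)).
  rewrite dotvE mulr_sumr; apply: eq_bigr => i _.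
  by rewrite gradientE pd_partial /wmon big_cons; ring.
exact: (@is_deriveZ _ _ _ _ (wmon h w) _ _ _ D2).
Qed.

(** Taylor's formula along the segment from [x0] to [x]: there are n^d words of length d, each
    contributing at most C d! (k |h|)^d, so after division by d! the part of degree d is at most C
    (n k |h|)^d. *)
Lemma an_analytic_on U (f : V -> R) : open U -> an U f -> analytic_on U f.
Proof.
move=> oU [cf Hf] x0 Ux0; have [r1 r10 [k k0 [C C0 HC]]] := Hf x0 Ux0.
have [d0 d00 Hd0] := open_norm oU Ux0.
(* Then [|h| < q^-1] gives n k |h| <= 1/2. *)
pose q := 2 * (n%:R * k + 1).
have q0 : 0 < q by rewrite mulr_gt0// ltr_wpDl// mulr_ge0.
pose r := Num.min (Num.min r1 d0) q^-1.
have r0 : 0 < r by rewrite !lt_min r10 d00 invr_gt0.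
exists r; split=> //.
(* Summing over all words with the letter counts [beta] takes the place of a multinomial
   coefficient. *)
pose a (beta : 'I_n -> nat) : R := \sum_(w <- words (\sum_i beta i)%N |
  [forall i, count_mem i w == beta i]) iter_partial w f x0 / (\sum_i beta i)%N`!%:R.
exists a => x; rewrite (rV_ballE x0 r) => xr.
pose h := x - x0.
move: (xr); rewrite !lt_min -/h => /andP[/andP[xr1 xd0] xq].
have hq : n%:R * k * `|h| <= 2^-1.
  have : `|h| * q <= 1 by rewrite -ler_pdivlMr// mul1r ltW.
  by have := normr_ge0 h; rewrite /q; nra.
pose phi d (t : R) := \sum_(w <- words d) wmon h w * iter_partial w f (x0 + t *: h).
have seg (t : R) : 0 <= t <= 1 -> `|t *: h| <= `|h|.
  by move=> /andP[t0 t1]; rewrite normrZ ger0_norm// ler_piMl.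
have phib d (t : R) : 0 <= t <= 1 ->
    \sum_(w <- words d) `|wmon h w * iter_partial w f (x0 + t *: h)| <= C * 2^-1 ^+ d * d`!%:R.
  move=> tI.
  apply: le_trans (_ : n%:R ^+ d * (`|h| ^+ d * (C * d`!%:R * k ^+ d)) <= _).
    apply: sum_words_le => w wd; rewrite normrM -wd; apply: ler_pM => //; first exact: wmon_le.
    apply: maj_pow_bound (HC _) _; rewrite addrBK.
    exact: le_lt_trans (seg t tI) xr1.
  have -> : n%:R ^+ d * (`|h| ^+ d * (C * d`!%:R * k ^+ d)) = C * (n%:R * k * `|h|) ^+ d * d`!%:R.
    by rewrite !exprMn; ring.
  rewrite ler_wpM2r// ler_wpM2l// lerXn2r ?nnegrE ?invr_ge0//.
  by rewrite mulr_ge0// mulr_ge0.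
have Dphi d (t : R) : 0 <= t <= 1 -> is_derive t 1 (phi d) (phi d.+1 t).
  move=> tI; have Ut : U (x0 + t *: h).
    by apply: Hd0; rewrite addrBK; exact: le_lt_trans (seg t tI) xd0.
  exact: (@directional_derivative U f x0 h d t oU cf Ut).
pose term (d : nat) (beta : {ffun 'I_n -> 'I_d.+1}) :=
   a (fun i => nat_of_ord (beta i)) * monom (fun i => nat_of_ord (beta i)) h.
have termE d (beta : {ffun 'I_n -> 'I_d.+1}) : (\sum_(i < n) nat_of_ord (beta i) == d)%N ->
    term d beta = \sum_(w <- words d | [forall i, count_mem i w == nat_of_ord (beta i)])
      wmon h w * iter_partial w f x0 / d`!%:R.
  move=> /eqP bd; rewrite /term /a bd mulr_suml; apply: eq_bigr => w /forallP Hw.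
  have -> : monom (fun i => nat_of_ord (beta i)) h = wmon h w.
    rewrite wmon_monom; apply: eq_bigr => i _; by rewrite (eqP (Hw i)).
  by rewrite mulrAC [X in X / _ = _]mulrC.
have z01 : (0 : R) <= (0 : R) <= (1 : R) by rewrite lexx ler01.
have o01 : (0 : R) <= (1 : R) <= (1 : R) by rewrite lexx ler01.
move=> term' habs hsum; split.
  apply: (@half_series_cvg _ _ C) => d.
  rewrite ger0_norm; last by apply: sumr_ge0.
  have fd : 0 < d`!%:R :> R by rewrite ltr0n fact_gt0.
  rewrite -(ler_pM2r fd); apply: le_trans (phib d 0 z01).
  rewrite -(sum_multiindex d (fun w => `|wmon h w * iter_partial w f (x0 + 0 *: h)|)) mulr_suml.
  apply: ler_sum => beta bd; rewrite -[term' d beta]/(term d beta) termE// -ler_pdivlMr// mulr_suml.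
  apply: (le_trans (ler_norm_sum _ _ _)); apply: ler_sum => w _.
  by rewrite scale0r addr0 normrM ler_wpM2l// ger0_norm ?invr_ge0.
have hsumE d : hsum d = phi d 0 * 1 ^+ d / d`!%:R.
  rewrite expr1n mulr1 /phi mulr_suml -sum_multiindex.
  apply: eq_bigr => beta bd; rewrite -[term' d beta]/(term d beta) termE//; apply: eq_bigr => w _.
  by rewrite scale0r addr0.
have close N : `|f x - series hsum N| <= C * 2^-1 ^+ N.
  have CN : 0 <= C * 2^-1 ^+ N * N`!%:R by rewrite !mulr_ge0// exprn_ge0// invr_ge0.
  have p0 : phi 0%N 1 = f x by rewrite /phi /= big_seq1 /wmon big_nil mul1r scale1r /h addrC subrK.
  have Es : series hsum N = \sum_(0 <= d < N) phi d 0 * 1 ^+ d / d`!%:R.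
    by apply: eq_bigr => d _; exact: hsumE.
  have HN (t : R) : 0 <= t <= 1 -> `|phi N t| <= C * 2^-1 ^+ N * N`!%:R.
    by move=> tI; apply: le_trans (phib N t tI); exact: ler_norm_sum.
  have := taylor_bound CN Dphi HN o01; rewrite -Es p0 => /le_trans; apply.
  by rewrite expr1n mulr1 mulfK// pnatr_eq0 -lt0n fact_gt0.
apply/cvgrPdist_le => e e0.
have := @cvg_geometric R C 2^-1 (@half_lt1 R) => /cvgrPdist_le/(_ e e0)[N _ HN].
exists N => // m /HN; rewrite /= sub0r normrN => Hm.
by apply: (le_trans (close m)); apply: le_trans Hm; exact: ler_norm.
Qed.

End Words.

(** * The inverse function theorem *)

Definition succr (c : reg) : reg := if c is Fin k then Fin k.+1 else c.

Section Reg.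
Variables (R : realType) (alpha : R).
Hypothesis alpha01 : 0 <= alpha <= 1.
Let a01 : (0 : R) <= (0 : R) <= (1 : R). Proof. by rewrite lexx ler01. Qed.

Definition Reg n (c : reg) (U : set 'rV[R]_n) (f : 'rV[R]_n -> R) : Prop :=
  match c with
  | Fin k => cls alpha k U f
  | Inf => forall k, cls 0 k U f
  | Omega => an U f
  end.

Lemma Reg_of_class n c (U : set 'rV[R]_n) f : open U -> Reg c U f <-> of_class c alpha U f.
Proof.
move=> oU; case: c => [k||] /=.
- exact: cls_of_class.
- by split=> H k; apply/Ck_on_cls.
- by split; [exact: an_analytic_on|exact: analytic_on_an].
Qed.

Section OneDim.
Variables (n : nat) (c : reg).
Implicit Types (U : set 'rV[R]_n) (f g : 'rV[R]_n -> R).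

Lemma Reg_ext U f g : open U -> (forall x, U x -> f x = g x) -> Reg c U f -> Reg c U g.
Proof.
case: c => [k||] oU fg; [exact: cls_ext|move=> H k; exact: cls_ext (H k)|exact: an_ext].
Qed.

Lemma Reg_sub U V f : V `<=` U -> Reg c U f -> Reg c V f.
Proof. by case: c => [k||] VU; [exact: cls_sub|move=> H k; exact: cls_sub (H k)|exact: an_sub]. Qed.

Lemma Reg_cst U (a : R) : open U -> Reg c U (fun=> a).
Proof. by case: c => [k||] oU; [exact: cls_cst|move=> k; exact: cls_cst|exact: an_cst]. Qed.

Lemma Reg_add U f g : open U -> Reg c U f -> Reg c U g -> Reg c U (fun x => f x + g x).
Proof.
by case: c => [k||] oU; [exact: cls_add|move=> H K k; exact: cls_add|exact: an_add].
Qed.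

Lemma Reg_mul U f g : open U -> Reg c U f -> Reg c U g -> Reg c U (fun x => f x * g x).
Proof.
by case: c => [k||] oU; [exact: cls_mul|move=> H K k; exact: cls_mul|exact: an_mul].
Qed.

Lemma Reg_inv U f : open U -> Reg c U f -> (forall x, U x -> f x != 0) ->
  Reg c U (fun x => (f x)^-1).
Proof.
by case: c => [k||] oU; [exact: cls_inv|move=> H K k; exact: cls_inv|exact: an_inv].
Qed.

Lemma Reg_opp U f : open U -> Reg c U f -> Reg c U (fun x => - f x).
Proof.
move=> oU hf; apply: Reg_ext (Reg_mul oU (Reg_cst (-1) oU) hf) => // x _.
by rewrite mulN1r.
Qed.

Lemma Reg_sub_fun U f g : open U -> Reg c U f -> Reg c U g -> Reg c U (fun x => f x - g x).
Proof. by move=> oU hf hg; apply: Reg_add => //; exact: Reg_opp. Qed.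

Lemma Reg_sum U (I : Type) (s : seq I) (f : I -> 'rV[R]_n -> R) : open U ->
  (forall i, Reg c U (f i)) -> Reg c U (fun x => \sum_(i <- s) f i x).
Proof.
move=> oU H; elim: s => [|i s IH].
  by under eq_fun do rewrite big_nil; exact: Reg_cst.
by under eq_fun do rewrite big_cons; exact: Reg_add.
Qed.

Lemma Reg_prod U (I : Type) (s : seq I) (f : I -> 'rV[R]_n -> R) : open U ->
  (forall i, Reg c U (f i)) -> Reg c U (fun x => \prod_(i <- s) f i x).
Proof.
move=> oU H; elim: s => [|i s IH].
  by under eq_fun do rewrite big_nil; exact: Reg_cst.
by under eq_fun do rewrite big_cons; exact: Reg_mul.
Qed.

Lemma Reg_det U m (A : 'rV[R]_n -> 'M[R]_m) : open U ->
  (forall i j, Reg c U (fun x => A x i j)) -> Reg c U (fun x => \det (A x)).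
Proof.
move=> oU H; apply: Reg_sum => // s; apply: Reg_mul => //; first exact: Reg_cst.
exact: Reg_prod.
Qed.

Lemma Reg_invmx U m (A : 'rV[R]_n -> 'M[R]_m) i j : open U ->
  (forall i j, Reg c U (fun x => A x i j)) -> (forall x, U x -> \det (A x) != 0) ->
  Reg c U (fun x => invmx (A x) i j).
Proof.
move=> oU H d0.
apply: (@Reg_ext _ (fun x => (\det (A x))^-1 * cofactor (A x) j i)) => //.
  by move=> x Ux; rewrite /invmx unitmxE unitfE d0// !mxE.
apply: Reg_mul => //; first by apply: Reg_inv => //; exact: Reg_det.
apply: Reg_mul => //; first exact: Reg_cst.
apply: Reg_det => // i' j'.
by rewrite (_ : (fun x => _) = (fun x => A x (lift j i') (lift i j'))) //; apply/funext => x; rewrite !mxE.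
Qed.

Lemma cls_dotv (beta : R) k U (a : 'rV[R]_n) : 0 <= beta <= 1 -> open U -> cls beta k U (fun x => dotv x a).
Proof.
move=> b01 oU.
have lip : loc_lip U (fun x => dotv x a).
  move=> x _; exists 1 => //; exists (n%:R * `|a|); first by rewrite mulr_ge0.
  by move=> y z _ _; rewrite -dotvBl (le_trans (dotv_norm_le _ _))// mulrAC.
case: k => [|k]; first exact: lip_cls0.
split; first by have [] := lip_cls0 b01 lip.
move=> i; split; first by move=> x _; case: (is_derive_dotv a x (evec R i)).
apply: (cls_ext _ _ (cls_cst b01 k (dotv (evec R i) a) oU)) => // x _.
by apply/esym/is_derive_pd; exact: is_derive_dotv.
Qed.

Lemma Reg_dotv U (a : 'rV[R]_n) : open U -> Reg c U (fun x => dotv x a).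
Proof.
move=> oU; case: c => [k||]; [exact: cls_dotv|by move=> k; exact: cls_dotv|].
split; first by move=> k; exact: cls_dotv.
move=> x _; exists 1 => //; exists 1 => //.
pose C := n%:R * (`|x| + 1) * `|a| + `|a|.
have C0 : 0 <= C by rewrite addr_ge0// !mulr_ge0// addr_ge0.
exists C => // -[|L].
  move=> y xy; rewrite pgeom0 mulr1 (le_trans (dotv_norm_le _ _))//.
  rewrite /C -[leLHS]addr0; apply: lerD => //; rewrite ler_wpM2r// ler_wpM2l//.
  by rewrite -[y](subrK x) addrC (le_trans (ler_normD _ _))// lerD2l ltW.
split.
  move=> y xy; rewrite pgeom0 mulr1 (le_trans (dotv_norm_le _ _))//.
  rewrite /C -[leLHS]addr0; apply: lerD => //; rewrite ler_wpM2r// ler_wpM2l//.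
  by rewrite -[y](subrK x) addrC (le_trans (ler_normD _ _))// lerD2l ltW.
move=> i; split; first by move=> y _; case: (is_derive_dotv a y (evec R i)).
have -> : pd i (fun x => dotv x a) = (fun=> a 0 i).
  apply/funext => y; apply: is_derive_pd; rewrite -dotv_evec dotvC; exact: is_derive_dotv.
apply: maj_cst; first exact: nb_open.
  rewrite pgeomS pgeom0 !mulr1; apply: (le_trans (coord_norm_le _ _)).
  by rewrite /C lerDr !mulr_ge0// addr_ge0.
by move=> l; rewrite mulr_ge0// pgeom_ge0.
Qed.

Lemma Reg_coord U i : open U -> Reg c U (fun x => x 0 i).
Proof.
by move=> oU; under eq_fun do rewrite -(dotv_evec _ i); exact: Reg_dotv.
Qed.

End OneDim.

Lemma Reg_S n c (U : set 'rV[R]_n) f : open U -> Reg (succr c) U f -> Reg c U f.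
Proof. by move=> oU; case: c => [k||] //; exact: cls_S. Qed.

Lemma Reg_pd n c (U : set 'rV[R]_n) f i : Reg (succr c) U f -> Reg c U (pd i f).
Proof. by case: c => [k||]; [exact: cls_pd|move=> H k; exact: cls_pd (H k.+1)|exact: an_pd]. Qed.

Lemma Reg_cls n c (U : set 'rV[R]_n) f : open U -> Reg (succr c) U f ->
  exists2 beta : R, 0 <= beta <= 1 & cls beta 1 U f.
Proof.
move=> oU; case: c => [k||] H; last by exists 0 => //; case: H.
  by exists alpha => //; exact: cls_le H.
by exists 0.
Qed.

Lemma Reg_integrate n c (U : set 'rV[R]_n) f (G : 'I_n -> 'rV[R]_n -> R) : open U ->
  Reg c U f -> (forall x i, U x -> is_derive x (evec R i) f (G i x)) ->
  (forall i, Reg c U (G i)) -> Reg (succr c) U f.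
Proof.
move=> oU; case: c => [k||] //= hf D hG; split; first by move=> x; exact: cls_continuous hf.
move=> i; split; first by move=> x Ux; case: (D x i Ux).
by apply: cls_ext (hG i) => // x Ux; apply/esym/is_derive_pd; exact: D.
Qed.

Lemma Reg_comp m n c (U : set 'rV[R]_m) (U' : set 'rV[R]_n) f (G : 'rV[R]_m -> 'rV[R]_n) :
  open U -> open U' -> Reg c U' f -> (forall j, Reg c U (fun x => G x 0 j)) -> loc_lip U G ->
  (forall x, U x -> U' (G x)) -> Reg c U (fun x => f (G x)).
Proof.
case: c => [k||] oU oU'; [exact: cls_comp| |exact: an_comp].
by move=> H K lG UU' k; apply: (cls_comp a01 oU oU' (H k)) => // j; exact: K.
Qed.

(* A local inverse Xi of Psi is Lipschitz and solves D Xi = (D Psi)^-1 o Xi, which is how the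
   inverse function theorem gains its regularity, the analytic case included. *)
Lemma Reg_ode m n c (U : set 'rV[R]_m) (U' : set 'rV[R]_n) (G : 'rV[R]_m -> 'rV[R]_n)
    (H : 'I_m -> 'I_n -> 'rV[R]_n -> R) : open U -> open U' ->
  (forall x, U x -> U' (G x)) -> loc_lip U G ->
  (forall x, U x -> forall i j, is_derive x (evec R i) (fun x => G x 0 j) (H i j (G x))) ->
  (forall i j, Reg c U' (H i j)) -> forall j, Reg (succr c) U (fun x => G x 0 j).
Proof.
case: c => [k||] oU oU' UU' lG dG hH j.
- exact: (cls_ode alpha01 oU oU' UU' lG dG hH).
- move=> k; apply: (@cls_le _ _ a01 _ _ k.+1) => //.
  by apply: (cls_ode a01 oU oU' UU' lG dG) => i' j'; exact: hH.
- exact: (an_ode oU oU' UU' lG dG hH).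
Qed.

Lemma entry_norm_le m n (B : 'M[R]_(m, n)) i j : `|B i j| <= `|B|.
Proof.
rewrite [leRHS]/Num.Def.normr/= mx_normrE.
exact: (le_bigmax _ (fun ij : 'I_m * 'I_n => `|B ij.1 ij.2|) (i, j)).
Qed.

Lemma mulmx_norm_le m n (v : 'rV[R]_m) (B : 'M[R]_(m, n)) : `|v *m B| <= m%:R * `|B| * `|v|.
Proof.
apply: norm_le_coord => [|j]; first by rewrite !mulr_ge0.
rewrite mxE (le_trans (ler_norm_sum _ _ _))//.
apply: le_trans (_ : \sum_(i < m) `|v 0 i| * `|B| <= _).
  by apply: ler_sum => i _; rewrite normrM ler_wpM2l// entry_norm_le.
rewrite -mulr_suml mulrAC ler_wpM2r// sum_norm_le//.
Qed.

Section InverseFunction.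
Variables (N : nat) (c : reg) (U : set 'rV[R]_N) (Psi : 'rV[R]_N -> 'rV[R]_N) (X0 : 'rV[R]_N).
Hypotheses (oU : open U) (UX0 : U X0).
Hypothesis RPsi : forall j, Reg (succr c) U (fun X => Psi X 0 j).
Hypothesis ker0 : forall v,
  (forall j, dotv v (gradient (fun X => Psi X 0 j) X0) = 0) -> v = 0.

Let Jac (X : 'rV[R]_N) : 'M[R]_N := \matrix_(i, j) pd i (fun X => Psi X 0 j) X.

Let mulJac v X j : (v *m Jac X) 0 j = dotv v (gradient (fun X => Psi X 0 j) X).
Proof. by rewrite dotvE mxE; apply: eq_bigr => i _; rewrite mxE gradientE. Qed.

Let detJ0 : \det (Jac X0) != 0.
Proof.
apply/negP => /det0P[v v0 vJ]; move: v0; rewrite (ker0 (v := v)) ?eqxx// => j.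
by rewrite -mulJac vJ mxE.
Qed.

Let RJac i j : Reg c U (fun X => Jac X i j).
Proof.
rewrite (_ : (fun X => _) = pd i (fun X => Psi X 0 j)); first exact: Reg_pd.
by apply/funext => X; rewrite mxE.
Qed.

Lemma Reg_continuous n c' (V : set 'rV[R]_n) f x : Reg c' V f -> V x -> {for x, continuous f}.
Proof.
by case: c' => [k||] H; [exact: cls_continuous H|exact: cls_continuous (H 0%N)|
  case: H => /(_ 0%N) H _; exact: cls_continuous H].
Qed.

Let derivPsi X j i : U X -> derivable (fun X => Psi X 0 j) X (evec R i).
Proof. by move=> UX; have [b _ h] := Reg_cls oU (RPsi j); exact: cls_derivable h UX. Qed.

Let fdPsi X j : U X -> fdiff (fun X => Psi X 0 j) X.
Proof. by move=> UX; have [b _ h] := Reg_cls oU (RPsi j); exact: cls_fdiff oU h UX. Qed.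

Let B := invmx (Jac X0).
(** Newton's map with the Jacobian frozen at [X0]. Its partial derivatives vanish at [X0], hence it
    contracts nearby. *)
Let G (X : 'rV[R]_N) : 'rV[R]_N := X - Psi X *m B.

Let G_contract : exists2 d : R, 0 < d &
  [/\ forall X, `|X - X0| < d -> U X, forall X, `|X - X0| < d -> \det (Jac X) != 0 &
   forall X Y, `|X - X0| < d -> `|Y - X0| < d -> `|G X - G Y| <= 2^-1 * `|X - Y|].
Proof.
have [d1 d10 H1] := open_norm oU UX0.
have [d2 d20 H2] : exists2 d : R, 0 < d & forall X, `|X - X0| < d -> \det (Jac X) != 0.
  have : {for X0, continuous (fun X => \det (Jac X))}.
    exact: (Reg_continuous (Reg_det oU RJac) UX0).
  move=> /continuousP_norm/(_ `|\det (Jac X0)|); rewrite normr_gt0 => /(_ detJ0)[d d0 Hd].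
  exists d => // X /Hd; apply: contraTneq => ->.
  by rewrite sub0r normrN ltxx.
pose e : R := (2 * N.+1%:R)^-1.
have e0 : 0 < e by rewrite invr_gt0 mulr_gt0.
have dG X i j : U X -> is_derive X (evec R i) (fun X => G X 0 j)
    ((i == j)%:R - (Jac X *m B) i j).
  move=> UX.
  have -> : (fun X => G X 0 j) = (fun X => X 0 j - \sum_(k <- index_enum 'I_N) B k j * Psi X 0 k).
    apply/funext => Y; rewrite !mxE; congr (_ - _); apply: eq_bigr => k _; exact: mulrC.
  apply: is_deriveB.
    by have := is_derive_coord X (evec R i) j; rewrite mxE eqxx /= eq_sym.
  rewrite mxE; apply: is_derive_sum_seq => k; rewrite mxE mulrC.
  by apply: is_derive_mull; apply: pdP; exact: derivPsi.
have [d3 d30 H3] : exists2 d : R, 0 < d & forall X, `|X - X0| < d ->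
    forall ij : 'I_N * 'I_N, `|(ij.1 == ij.2)%:R - (Jac X *m B) ij.1 ij.2| <= e.
  apply: near_fin => -[i j] /=.
  have RE : Reg c U (fun X => (i == j)%:R - (Jac X *m B) i j).
    apply: (@Reg_ext _ _ _ (fun X => (i == j)%:R - \sum_(k <- index_enum 'I_N) Jac X i k * B k j)) => //.
      by move=> X _; rewrite [in RHS]mxE.
    apply: Reg_sub_fun => //; first exact: Reg_cst.
    by apply: Reg_sum => // k; apply: Reg_mul => //; exact: Reg_cst.
  have /continuousP_norm/(_ e e0)[d d0 Hd] := Reg_continuous RE UX0.
  exists d => // X /Hd; rewrite mulmxV ?unitmxE ?unitfE// [X in _ - (_ - X)]mxE subrr subr0.
  exact: ltW.
pose d := Num.min d1 (Num.min d2 d3).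
exists d; first by rewrite !lt_min d10 d20.
split.
- by move=> X; rewrite !lt_min => /and3P[/H1].
- by move=> X; rewrite !lt_min => /and3P[_ /H2].
move=> X Y Xd Yd; apply: norm_le_coord => [|j]; first by rewrite mulr_ge0 ?invr_ge0.
have Hb Z : `|Z - X0| < d -> forall i, derivable (fun X => G X 0 j) Z (evec R i) /\
    `|pd i (fun X => G X 0 j) Z| <= e.
  rewrite !lt_min => /and3P[/H1 UZ _ /H3 HZ] i.
  have D := dG Z i j UZ; split; first by case: D.
  by rewrite (is_derive_pd D); exact: (HZ (i, j)).
have := ball_lipschitz Hb Yd Xd.
rewrite !mxE => /le_trans; apply; rewrite -mulr_sumr.
apply: le_trans (_ : e * (N%:R * `|X - Y|) <= _).
  rewrite ler_wpM2l ?(ltW e0)//; apply: le_trans (sum_norm_le _).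
  by apply: ler_sum => i _; rewrite !mxE.
rewrite mulrA ler_wpM2r// /e invfM -mulrA ler_piMr ?invr_ge0//.
by rewrite mulrC ler_pdivrMr// mul1r ler_nat.
Qed.

Theorem inverse_function : exists2 d : R, 0 < d & exists2 e : R, 0 < e &
  exists Xi : 'rV[R]_N -> 'rV[R]_N,
  [/\ forall xi, nb (Psi X0) e xi -> U (Xi xi) /\ Psi (Xi xi) = xi,
      forall X, nb X0 d X -> nb (Psi X0) e (Psi X) -> Xi (Psi X) = X,
      loc_lip (nb (Psi X0) e) Xi &
      forall j, Reg (succr c) (nb (Psi X0) e) (fun xi => Xi xi 0 j)].
Proof.
have [d d0 [dU dJ dG]] := G_contract.
pose K := N%:R * `|B| + 1; have K0 : 0 < K by rewrite ltr_wpDl// mulr_ge0.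
have mulB (v : 'rV[R]_N) : `|v *m B| <= K * `|v|.
  by apply: (le_trans (mulmx_norm_le _ _)); rewrite ler_wpM2r// lerDl.
(* With this radius the map [T] below moves [X0] by less than d/4; being a contraction of ratio 1/2,
   it preserves the ball of radius d/2. *)
pose e := d / (4 * K); have e0 : 0 < e by rewrite divr_gt0// mulr_gt0.
have Junit : Jac X0 \in unitmx by rewrite unitmxE unitfE.
have PsiG X : Psi X = (X - G X) *m Jac X0.
  by rewrite /G opprB addrC subrK -mulmxA mulVmx// mulmx1.
have solve xi : nb (Psi X0) e xi -> exists X, nb X0 d X /\ Psi X = xi.
  move=> xie; pose T X := G X + xi *m B.
  have TX0 : `|T X0 - X0| < d / 4.
    rewrite /T /G addrAC addrC -[X0 - _ - X0]addrAC subrr add0r -mulmxBl.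
    apply: (le_lt_trans (mulB _)); move: xie; rewrite /nb /= /e ltr_pdivlMr ?mulr_gt0//; nra.
  have TT X Y : `|X - X0| < d -> `|Y - X0| < d -> `|T X - T Y| <= 2^-1 * `|X - Y|.
    by move=> Xd Yd; rewrite /T opprD addrACA subrr addr0; exact: dG.
  pose D := [set X : 'rV[R]_N | `|X - X0| <= d / 2].
  have Dd X : D X -> `|X - X0| < d by rewrite /D /= => /le_lt_trans; apply; lra.
  have TD X : D X -> D (T X).
    move=> DX; rewrite /D /=; have -> : T X - X0 = (T X - T X0) + (T X0 - X0) by rewrite addrA subrK.
    apply: (le_trans (ler_normD _ _)).
    have := TT X X0 (Dd _ DX); rewrite subrr normr0 => /(_ d0) H.
    by move: DX TX0 H; rewrite /D /= => A1 A2 A3; lra.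
  have cD : compact D.
    apply: bounded_closed_compact.
      exists (`|X0| + d); split; first exact: num_real.
      move=> M HM X DX; apply: le_trans (ltW HM); rewrite -[X](subrK X0) addrC.
      by apply: (le_trans (ler_normD _ _)); rewrite lerD2l ltW// Dd.
    have -> : D = closed_ball X0 (d / 2).
      rewrite closed_ballE ?divr_gt0//; apply/seteqP; split=> X; rewrite /D /closed_ball_ /=; by rewrite distrC.
    exact: closed_ball_closed.
  have D0 : D !=set0 by exists X0; rewrite /D /= subrr normr0 divr_ge0// ltW.
  (* The fixed point is a minimizer of the displacement on a compact ball: since [T] halves
     displacements, the minimum must be 0. *)
  pose m X := `|T X - X|.
  have cm : {within D, continuous m}.
    apply: continuous_in_subspaceT => X /set_mem DX; apply/continuousP_norm => e1 e10.
    exists (Num.min (d - `|X - X0|) (e1 / 2)).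
      by rewrite lt_min subr_gt0 Dd// divr_gt0.
    move=> Y; rewrite lt_min => /andP[Yd Ye].
    have Yd' : `|Y - X0| < d.
      rewrite -(subrK X Y) -addrA; apply: (le_lt_trans (ler_normD _ _)).
      by rewrite -ltrBrDr.
    apply: (le_lt_trans (ler_dist_dist _ _)).
    have -> : T Y - Y - (T X - X) = (T Y - T X) - (Y - X).
      by rewrite !opprB !opprD !opprK; apply/rowP => i; rewrite !mxE; ring.
    apply: (le_lt_trans (ler_normB _ _)); have := TT Y X Yd' (Dd _ DX).
    by move: Ye => A1 A2; lra.
  have [X /set_mem DX Xmin] := EVT_min_rV D0 cD cm.
  exists X; split; first exact: Dd.
  have TXX : T X = X.
    apply/eqP; rewrite -subr_eq0 -normr_le0.
    have := Xmin (T X) (mem_set (TD _ DX)); have := TT _ _ (Dd _ (TD _ DX)) (Dd _ DX).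
    by rewrite /m => A1 A2; lra.
  have EG : X - G X = xi *m B by rewrite -{1}TXX /T addrAC subrr add0r.
  by rewrite PsiG EG -mulmxA mulVmx// mulmx1.
have uniq X Y : nb X0 d X -> nb X0 d Y -> `|X - Y| <= 2 * K * `|Psi X - Psi Y|.
  move=> Xd Yd; have A1 := dG X Y Xd Yd.
  have E : X - Y = (G X - G Y) + (Psi X - Psi Y) *m B.
    by rewrite /G mulmxBl; apply/rowP => i; rewrite !mxE; ring.
  have := ler_normD (G X - G Y) ((Psi X - Psi Y) *m B); rewrite -E => A2.
  by have := mulB (Psi X - Psi Y); lra.
(* [X0] is only a default value; [uniq] makes the chosen solution the only one in the ball. *)
pose Xi xi := xget X0 [set X | nb X0 d X /\ Psi X = xi].
have XiP xi : nb (Psi X0) e xi -> nb X0 d (Xi xi) /\ Psi (Xi xi) = xi.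
  by move=> /solve H; exact: (xgetPex X0 H).
have lipXi xi xi' : nb (Psi X0) e xi -> nb (Psi X0) e xi' -> `|Xi xi - Xi xi'| <= 2 * K * `|xi - xi'|.
  by move=> /XiP[A1 A2] /XiP[B1 B2]; rewrite -{2}A2 -{2}B2; exact: uniq.
exists d => //; exists e => //; exists Xi; split.
- by move=> xi /XiP[A1 A2]; split=> //; exact: dU.
- move=> X Xd /XiP[A1 A2]; apply/eqP; rewrite -subr_eq0 -normr_le0.
  by have := uniq _ _ A1 Xd; rewrite A2 subrr normr0 mulr0.
- move=> xi /(open_norm (@nb_open _ _ _ _))[r r0 Hr]; exists r => //; exists (2 * K).
    by rewrite mulr_ge0// ltW.
  by move=> y z /Hr yr /Hr zr; exact: lipXi.
apply: (@Reg_ode _ _ c _ (nb X0 d) Xi (fun i j X => invmx (Jac X) i j)).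
- exact: nb_open.
- exact: nb_open.
- by move=> xi /XiP[].
- move=> xi /(open_norm (@nb_open _ _ _ _))[r r0 Hr]; exists r => //; exists (2 * K).
    by rewrite mulr_ge0// ltW.
  by move=> y z /Hr yr /Hr zr; exact: lipXi.
(* The Lipschitz bound makes [Y - X] of order [h], so the first-order expansion of [Psi] at [X],
   multiplied by the inverse Jacobian [A], becomes one of [Xi]. *)
- move=> xi xie i j; apply/is_deriveP => e1 e10.
  have [Xd EX] := XiP xi xie; set X := Xi xi in Xd EX *.
  have XJ : Jac X \in unitmx by rewrite unitmxE unitfE dJ.
  set A := invmx (Jac X).
  pose L := N%:R * `|A| * (2 * K) + 1.
  have L0 : 0 < L by rewrite ltr_wpDl// !mulr_ge0// ltW.
  have e2 : 0 < e1 / L by rewrite divr_gt0.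
  have [r r0 Hr] := open_norm (@nb_open _ _ _ _) xie.
  have [r2 r20 Hr2] : exists2 d : R, 0 < d & forall Y, `|Y - X| < d ->
      forall k, `|Psi Y 0 k - Psi X 0 k - dotv (Y - X) (gradient (fun X => Psi X 0 k) X)| <= e1 / L * `|Y - X|.
    by apply: near_fin => k; apply: fdPsi => //; exact: dU.
  exists (Num.min r (r2 / (2 * K))); first by rewrite lt_min r0 divr_gt0// mulr_gt0.
  move=> h; rewrite lt_min ltr_pdivlMr ?mulr_gt0// => /andP[hr hr2].
  have hn : `|h *: evec R i| <= `|h|.
    by rewrite normrZ -[leRHS]mulr1 ler_wpM2l// norm_evec.
  have xie' : nb (Psi X0) e (xi + h *: evec R i).
    by apply: Hr; rewrite addrBK; exact: le_lt_trans hr.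
  have [Yd EY] := XiP _ xie'; set Y := Xi (xi + _) in Yd EY *.
  have YX : `|Y - X| <= 2 * K * `|h|.
    apply: (le_trans (lipXi _ _ xie' xie)); rewrite addrBK ler_wpM2l//.
    by rewrite mulr_ge0// ltW.
  have YX2 : `|Y - X| < r2 by apply: (le_lt_trans YX); rewrite mulrC.
  have Hk := Hr2 Y YX2.
  have E : Y 0 j - X 0 j - h * A i j = ((Y - X - h *: evec R i *m A) : 'rV[R]_N) 0 j.
    by rewrite -scalemxAl -rowE !mxE.
  rewrite E; apply: (le_trans (coord_norm_le _ _)).
  have -> : Y - X - h *: evec R i *m A = ((Y - X) *m Jac X - h *: evec R i) *m A.
    by rewrite mulmxBl -mulmxA mulmxV// mulmx1.
  apply: (le_trans (mulmx_norm_le _ _)).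
  have Q : `|(Y - X) *m Jac X - h *: evec R i| <= e1 / L * (2 * K * `|h|).
    apply: norm_le_coord => [|k]; first by rewrite mulr_ge0 ?(ltW e2)// mulr_ge0// mulr_ge0// ltW.
    have := Hk k; rewrite EY EX -mulJac distrC !mxE => Hk'.
    apply: le_trans (_ : e1 / L * `|Y - X| <= _); last by rewrite ler_wpM2l// ltW.
    apply: le_trans Hk'; rewrite le_eqVlt; apply/orP; left; apply/eqP; congr `|_|.
    by rewrite [xi 0 k + _]addrC addrK.
  apply: le_trans (_ : N%:R * `|A| * (e1 / L * (2 * K * `|h|)) <= _).
    by rewrite ler_wpM2l// mulr_ge0.
  have -> : N%:R * `|A| * (e1 / L * (2 * K * `|h|)) = e1 * `|h| * ((N%:R * `|A| * (2 * K)) / L) by ring.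
  rewrite ler_piMr ?mulr_ge0 ?(ltW e10)// ler_pdivrMr// mul1r lerDl//.
move=> i j; apply: Reg_invmx.
- exact: nb_open.
- by move=> i' j'; apply: Reg_sub (RJac i' j') => X; exact: dU.
- by move=> X; exact: dJ.
Qed.

End InverseFunction.
End Reg.

(** * Minkowski sums *)

Section Minkowski.
Variables (R : realType) (n : nat).
Notation V := 'rV[R]_n.
Implicit Types (A B C : set V).

Lemma mink_sumP A B (x : V) : mink_sum A B x <-> exists a b, [/\ A a, B b & x = a + b].
Proof.
by split=> [[a Aa [b Bb <-]]|[a [b [Aa Bb ->]]]]; [exists a, b|exists a => //; exists b].
Qed.

Lemma mink_compact A B : compact A -> compact B -> compact (mink_sum A B).
Proof.
move=> cA cB.
have -> : mink_sum A B = (fun p : V * V => p.1 + p.2) @` (A `*` B).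
  apply/seteqP; split=> [x /mink_sumP[a [b [Aa Bb ->]]]|x [[a b] /= [Aa Bb] <-]].
    by exists (a, b).
  by apply/mink_sumP; exists a, b.
apply: continuous_compact; last exact: compact_setX.
apply: continuous_subspaceT => p; exact: add_continuous.
Qed.

Lemma mink_convex A B : Defs.convex_set A -> Defs.convex_set B -> Defs.convex_set (mink_sum A B).
Proof.
move=> vA vB x y t /mink_sumP[a [b [Aa Bb ->]]] /mink_sumP[a' [b' [Aa' Bb' ->]]] t01.
apply/mink_sumP; exists (t *: a + (1 - t) *: a'), (t *: b + (1 - t) *: b'); split.
- exact: vA.
- exact: vB.
- by apply/rowP => i; rewrite !mxE; ring.
Qed.

Lemma outer_normal_mink A B a b u : A a -> B b ->
  outer_unit_normal (mink_sum A B) (a + b) u <-> outer_unit_normal A a u /\ outer_unit_normal B b u.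
Proof.
move=> Aa Bb; split=> [[u1 H]|[[u1 HA] [_ HB]]].
  split; split=> // y Cy.
    have /H : mink_sum A B (y + b) by apply/mink_sumP; exists y, b.
    by rewrite opprD addrACA subrr addr0.
  have /H : mink_sum A B (a + y) by apply/mink_sumP; exists a, y.
  by rewrite opprD addrACA subrr add0r.
split=> // y /mink_sumP[a' [b' [/HA Aa' /HB Bb' ->]]].
by rewrite opprD addrACA dotvDr; lra.
Qed.

Lemma bdry_mink A B x : compact A -> compact B -> Defs.convex_set A -> Defs.convex_set B ->
  bdry (mink_sum A B) x -> exists a b u,
    [/\ A a, B b, x = a + b, outer_unit_normal A a u & outer_unit_normal B b u].
Proof.
move=> cA cB vA vB bx; have cAB := mink_compact cA cB.
have xAB := bdry_sub cAB bx; have [a [b [Aa Bb Ex]]] := (mink_sumP _ _ _).1 xAB.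
have [||u un] := @supporting_hyperplane _ _ _ x cAB (mink_convex vA vB).
- by exists x.
- by case: bx.
exists a, b, u; move: un; rewrite Ex => /(outer_normal_mink _ Aa Bb)[uA uB]; split=> //.
Qed.

Lemma grad_continuous W (F : V -> R) x (e : R) : C2on W F -> W x -> 0 < e ->
  exists2 d : R, 0 < d & forall y, `|y - x| < d -> `|gradient F y - gradient F x| <= e.
Proof.
move=> cF Wx e0; have [_ c1 _ _] := cF x Wx.
have [d d0 Hd] : exists2 d : R, 0 < d & forall y, `|y - x| < d -> forall i, `|pd i F y - pd i F x| <= e.
  apply: near_fin => i; have /continuousP_norm/(_ _ e0)[d d0 Hd] := c1 i.
  by exists d => // y /Hd/ltW.
exists d => // y /Hd H; apply: norm_le_coord; first exact: ltW.
by move=> i; rewrite !mxE -!pd_partial.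
Qed.

(** An interior point [q] detects the sign: the gradient points outwards exactly when its product
    with [q - x] is negative, and this is an open condition. *)
Lemma normal_sign_near C W F x u : convex_body C -> C2def (bdry C) W F -> W x -> bdry C x ->
  outer_unit_normal C x u -> 0 < dotv u (gradient F x) ->
  exists2 d : R, 0 < d & forall x' u', `|x' - x| < d -> W x' -> bdry C x' ->
    outer_unit_normal C x' u' -> 0 < dotv u' (gradient F x').
Proof.
move=> [vC [cC [q iq]]] dF Wx bx un c0.
have bC := bdry_sub cC.
have [Eg _] := outer_normal_gradient bC dF Wx bx un.
have gq : 0 < dotv (- gradient F x) (q - x).
  by rewrite dotvNl Eg dotvZl oppr_gt0 pmulr_rlt0//; exact: outer_normal_interior un.
have [d1 d10 H1] := dotv_close gq.
have d12 : 0 < d1 / 2 by rewrite divr_gt0.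
have [oW cF _ _] := dF.
have [d2 d20 H2] := grad_continuous cF Wx d12.
exists (Num.min d1 d2); first by rewrite lt_min d10.
move=> x' u'; rewrite lt_min => /andP[xd1 xd2] Wx' bx' un'.
have [Eg' c0'] := outer_normal_gradient bC dF Wx' bx' un'.
have := H1 (- gradient F x') (q - x').
have -> : - gradient F x' - - gradient F x = - (gradient F x' - gradient F x) by rewrite opprB opprK addrC.
have -> : q - x' - (q - x) = - (x' - x) by rewrite !opprB addrC addrA subrK.
rewrite !normrN (le_lt_trans (H2 _ xd2)) ?ltr_pdivrMr ?ltr_pMr ?ltr1n// => /(_ isT xd1).
set c' := dotv u' _ in Eg' c0' *.
rewrite dotvNl {1}Eg' dotvZl oppr_gt0.
by rewrite nmulr_llt0//; exact: outer_normal_interior un'.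
Qed.

Lemma unit_multiple (u u' : V) (c c' : R) : dotv u u = 1 -> dotv u' u' = 1 -> 0 < c -> 0 < c' ->
  c *: u = c' *: u' -> u = u'.
Proof.
move=> u1 u1' c0 c0' E.
have : dotv (c *: u) (c *: u) = dotv (c' *: u') (c' *: u') by rewrite E.
rewrite !dotvZl !dotvZr u1 u1' !mulr1 -!expr2 => /eqP.
rewrite eqrXn2 ?ltW// => /eqP cc.
by move: E; rewrite cc => /scalerI; apply; rewrite gt_eqF.
Qed.

Lemma face_unique C W F x u : convex_body C -> C2def (bdry C) W F -> W x -> bdry C x ->
  outer_unit_normal C x u ->
  (forall v, dotv u v = 0 -> qf (hess F x) v = 0 -> v = 0) ->
  forall x', C x' -> outer_unit_normal C x' u -> x' = x.
Proof.
move=> [vC [cC _]] dF Wx bx un nd x' Cx' un'.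
have Cx := bdry_sub cC bx.
have [Eg c0] := outer_normal_gradient (bdry_sub cC) dF Wx bx un.
have [u1 H] := un; have [_ H'] := un'.
have uv : dotv u (x' - x) = 0.
  by apply/eqP; rewrite eq_le H//= -oppr_le0 -dotvNr opprB H'.
apply/eqP; rewrite -subr_eq0; apply/eqP; apply: nd => //.
apply: (hess_segment_eq0 dF Wx); last by rewrite Eg dotvZr (dotvC _ u) uv mulr0.
move=> t t01; apply: (@outer_normal_bdry _ _ _ _ u).
  have -> : x + t *: (x' - x) = t *: x' + (1 - t) *: x by apply/rowP => i; rewrite !mxE; ring.
  exact: vC.
split=> // y Cy; rewrite opprD addrA dotvBr dotvZr uv mulr0 subr0; exact: H.
Qed.

(** Both normals are multiples of the gradient, and an interior point excludes opposite signs. *)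
Lemma normal_unique C W F x u u' : convex_body C -> C2def (bdry C) W F -> W x -> bdry C x ->
  outer_unit_normal C x u -> outer_unit_normal C x u' -> u' = u.
Proof.
move=> [vC [cC [q iq]]] dF Wx bx un un'; have bC := bdry_sub cC.
have [E c0] := outer_normal_gradient bC dF Wx bx un.
have [E' c0'] := outer_normal_gradient bC dF Wx bx un'.
set c := dotv u _ in E c0; set c' := dotv u' _ in E' c0'.
have [u1 _] := un; have [u1' _] := un'.
have uq := outer_normal_interior iq un; have uq' := outer_normal_interior iq un'.
have gq : dotv (gradient F x) (q - x) = c * dotv u (q - x) by rewrite {1}E dotvZl.
have gq' : dotv (gradient F x) (q - x) = c' * dotv u' (q - x) by rewrite {1}E' dotvZl.
have cc : c *: u = c' *: u' by rewrite -E.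
have [cp|cn] := ltP 0 c.
  apply/esym/(unit_multiple u1 u1' cp _ cc).
  have : c' * dotv u' (q - x) < 0 by rewrite -gq' gq pmulr_rlt0.
  by rewrite nmulr_llt0.
have cn' : 0 < - c by rewrite oppr_gt0 lt_neqAle c0.
apply/esym/(@unit_multiple u u' (- c) (- c') u1 u1' cn'); last by rewrite !scaleNr cc.
have : 0 < c' * dotv u' (q - x) by rewrite -gq' gq nmulr_rgt0// -oppr_gt0.
by rewrite nmulr_lgt0// oppr_gt0.
Qed.

(** Compactness is applied to pairs (u0, b0) of a direction and a point of [B]. Either one of the
    conditions on a splitting fails in a whole neighbourhood, or [a + b] splits as
    [(a + b - b0) + b0] with common normal [u0]. Then [u0] is also normal at [a] and [b], so it is
    [u], and [face_unique] gives [b0 = b]. *)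
Lemma decomposition_stable A B WA FA WB FB a b u : convex_body A -> convex_body B ->
  C2def (bdry A) WA FA -> C2def (bdry B) WB FB -> WA a -> WB b -> A a -> B b ->
  outer_unit_normal A a u -> outer_unit_normal B b u ->
  (forall v, dotv u v = 0 -> qf (hess FB b) v = 0 -> v = 0) ->
  forall e : R, 0 < e -> exists2 d : R, 0 < d & forall x, `|x - (a + b)| < d ->
    forall a' b' u', A a' -> B b' -> x = a' + b' -> outer_unit_normal A a' u' ->
      outer_unit_normal B b' u' -> `|b' - b| < e.
Proof.
move=> hA hB dA dB WAa WBb Aa Bb uA uB nd e e0.
have [vA [cA _]] := hA; have [vB [cB _]] := hB.
pose P (x : V) (u' : V) (b' : V) := A (x - b') -> outer_unit_normal A (x - b') u' ->
  outer_unit_normal B b' u' -> `|b' - b| < e.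
have bA := outer_normal_bdry Aa uA; have bB := outer_normal_bdry Bb uB.
have loc u0 b0 : dotv u0 u0 = 1 -> B b0 -> exists2 d : R, 0 < d & forall x u' b',
    `|x - (a + b)| < d -> `|u' - u0| < d -> `|b' - b0| < d -> P x u' b'.
  move=> u01 Bb0.
  have [Aab|nA] := pselect (A (a + b - b0)); last first.
    have [d d0 Hd] := closed_norm (compact_closed_rV cA) nA.
    exists (d / 2); first by rewrite divr_gt0.
    move=> x u' b' xd _ bd Axb; exfalso; apply: (Hd (x - b')) => //.
    have -> : x - b' - (a + b - b0) = (x - (a + b)) - (b' - b0).
      by apply/rowP => i; rewrite !mxE; ring.
    by apply: (le_lt_trans (ler_normB _ _)); lra.
  have [nA|] := pselect (exists2 y, A y & dotv u0 (y - (a + b - b0)) > 0).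
    have [y Ay /dotv_close[d d0 Hd]] := nA.
    exists (d / 2); first by rewrite divr_gt0.
    move=> x u' b' xd ud bd _ [_ /(_ y Ay)]; rewrite leNgt => /negP H; exfalso; apply: H.
    apply: Hd; first by lra.
    have -> : y - (x - b') - (y - (a + b - b0)) = (b' - b0) - (x - (a + b)).
      by apply/rowP => i; rewrite !mxE; ring.
    by apply: (le_lt_trans (ler_normB _ _)); lra.
  have [nB _|nB nA] := pselect (exists2 y, B y & dotv u0 (y - b0) > 0).
    have [y By /dotv_close[d d0 Hd]] := nB.
    exists d => // x u' b' xd ud bd _ _ [_ /(_ y By)]; rewrite leNgt => /negP H; exfalso; apply: H.
    apply: Hd => //; have -> : y - b' - (y - b0) = - (b' - b0) by apply/rowP => i; rewrite !mxE; ring.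
    by rewrite normrN.
  have unA : outer_unit_normal A (a + b - b0) u0.
    by split=> // y Ay; rewrite leNgt; apply/negP => H; apply: nA; exists y.
  have unB : outer_unit_normal B b0 u0.
    by split=> // y By; rewrite leNgt; apply/negP => H; apply: nB; exists y.
  have un : outer_unit_normal (mink_sum A B) (a + b) u0.
    by have := (outer_normal_mink u0 Aab Bb0).2 (conj unA unB); rewrite subrK.
  have [unAa unBb] := (outer_normal_mink u0 Aa Bb).1 un.
  have Eu := normal_unique hA dA WAa bA uA unAa.
  rewrite Eu in unB.
  have -> := face_unique hB dB WBb bB uB nd Bb0 unB.
  by exists e => // x u' b' _ _ bd _ _ _.
have key : exists2 d : R, 0 < d & forall (x z : V), `|x - (a + b)| < d -> `|z - 0| < d ->
    forall u', dotv u' u' = 1 -> forall b', B b' -> P x u' b'.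
  apply: (@compact_uniform R n n n [set u : V | dotv u u = 1] (fun x _ u' => forall b', B b' -> P x u' b') (a + b) 0 (@sphere_compact R n)).
  move=> u0 u01.
  have [|d d0 Hd] := @compact_uniform R n n n B (fun x u' b' => P x u' b') (a + b) u0 cB.
    by move=> b0 Bb0; apply: loc.
  by exists d => // x _ u' xd _ ud b'; exact: Hd.
have [d d0 Hd] := key; exists d => // x xd a' b' u' Aa' Bb' Ex uA' uB'.
have Ea : x - b' = a' by rewrite Ex addrK.
have [u1 _] := uA'.
have z0 : `|(0 : V) - 0| < d by rewrite subrr normr0.
by apply: (Hd x 0 xd z0 u' u1 b' Bb'); rewrite ?Ea.
Qed.

End Minkowski.

Lemma half_le_sub (R : realFieldType) (g e : R) : e <= g / 2 -> g / 2 <= g - e.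
Proof. lra. Qed.

Lemma lt_of_half_quarter (R : realFieldType) (g d z : R) : 0 < g -> 0 < d ->
  z * (g / 2) <= d * g / 4 -> z < d.
Proof. by nra. Qed.

(** * A defining function of A + B near a boundary point *)

Section LocalSum.
Variables (R : realType) (n : nat) (alpha : R).
Hypothesis alpha01 : 0 <= alpha <= 1.
Notation V := 'rV[R]_n.
Notation VN := 'rV[R]_(n + n + 1).

(** The unknowns of the implicit system, a point for each body and the ratio of the gradients, are
    packed into one row vector, as [inverse_function] expects. *)
Let pa (X : VN) : V := lsubmx (lsubmx X).
Let py (X : VN) : V := rsubmx (lsubmx X).
Let pl (X : VN) : R := X 0 (rshift (n + n) 0).
Let mk (a y : V) (l : R) : VN := row_mx (row_mx a y) (const_mx l).

Let paE X i : pa X 0 i = X 0 (lshift 1 (lshift n i)). Proof. by rewrite !mxE. Qed.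
Let pyE X i : py X 0 i = X 0 (lshift 1 (rshift n i)). Proof. by rewrite !mxE. Qed.

Let pa_mk a y l : pa (mk a y l) = a. Proof. by rewrite /pa /mk !row_mxKl. Qed.
Let py_mk a y l : py (mk a y l) = y. Proof. by rewrite /py /mk row_mxKl row_mxKr. Qed.
Let pl_mk a y l : pl (mk a y l) = l. Proof. by rewrite /pl /mk row_mxEr mxE. Qed.

Let mk_eta X : X = mk (pa X) (py X) (pl X).
Proof.
apply/rowP => j; rewrite /mk; case: (split_ordP j) => [i ->|i ->].
  rewrite row_mxEl; case: (split_ordP i) => [k ->|k ->].
    by rewrite row_mxEl paE.
  by rewrite row_mxEr pyE.
by rewrite row_mxEr mxE /pl ord1.
Qed.

Let paB X Y : pa (X - Y) = pa X - pa Y. Proof. by apply/rowP => i; rewrite !mxE. Qed.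
Let pyB X Y : py (X - Y) = py X - py Y. Proof. by apply/rowP => i; rewrite !mxE. Qed.
Let plB X Y : pl (X - Y) = pl X - pl Y. Proof. by rewrite /pl !mxE. Qed.

Let pa_le X : `|pa X| <= `|X|.
Proof. by apply: norm_le_coord => // i; rewrite paE; exact: coord_norm_le. Qed.
Let py_le X : `|py X| <= `|X|.
Proof. by apply: norm_le_coord => // i; rewrite pyE; exact: coord_norm_le. Qed.
Let pl_le X : `|pl X| <= `|X|.
Proof. exact: coord_norm_le. Qed.

Let mk_lt a y l (e : R) : 0 < e -> `|a| < e -> `|y| < e -> `|l| < e -> `|mk a y l| < e.
Proof.
move=> e0 ae ye le; apply: norm_lt_coord => // j; rewrite /mk.
case: (split_ordP j) => [i ->|i ->]; last by rewrite row_mxEr mxE.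
rewrite row_mxEl; case: (split_ordP i) => [k ->|k ->].
  by rewrite row_mxEl; exact: le_lt_trans (coord_norm_le _ _) ae.
by rewrite row_mxEr; exact: le_lt_trans (coord_norm_le _ _) ye.
Qed.

Let mkB a y l a' y' l' : mk a y l - mk a' y' l' = mk (a - a') (y - y') (l - l').
Proof. by rewrite [LHS]mk_eta paB pyB plB !(pa_mk, py_mk, pl_mk). Qed.

Lemma Reg_fdiff m c (U : set 'rV[R]_m) f x : open U -> Reg alpha (succr c) U f -> U x -> fdiff f x.
Proof. by move=> oU /(Reg_cls alpha01 oU)[b _ h]; exact: cls_fdiff oU h. Qed.

Lemma Reg_C2on c (W : set V) F : Reg alpha (succr (succr c)) W F -> C2on W F.
Proof.
case: c => [k||]; first exact: cls_C2on.
  by move=> /(_ 2%N); exact: cls_C2on.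
by case=> /(_ 2%N) h _; exact: cls_C2on h.
Qed.

Lemma local_definingP c S W (F : V -> R) : local_defining c alpha S W F <->
  [/\ open W, Reg alpha c W F, forall x, W x -> gradient F x != 0 &
      S `&` W = [set x | W x /\ F x = 0]].
Proof.
split=> [[oW [cF [g0 SW]]]|[oW cF g0 SW]].
  by split=> //; apply/Reg_of_class.
by split=> //; split=> //; apply/Reg_of_class.
Qed.

Variables (c2 : reg) (A B WA WB : set V) (FA FB : V -> R) (a b u : V).
(** Writing the class as a double successor gives the gradients the class [c1] and the Jacobian of
    the system the class [c2], uniformly in the three kinds of regularity. *)
Let c1 := succr c2.
Let c := succr c1.
Hypotheses (hA : convex_body A) (hB : convex_body B).
Hypothesis lA : local_defining c alpha (bdry A) WA FA.
Hypothesis lB : local_defining c alpha (bdry B) WB FB.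
Hypotheses (WAa : WA a) (WBb : WB b) (Aa : A a) (Bb : B b).
Hypotheses (uA : outer_unit_normal A a u) (uB : outer_unit_normal B b u).
Hypotheses (cA0 : 0 < dotv u (gradient FA a)) (cB0 : 0 < dotv u (gradient FB b)).
Hypothesis nd : forall v, dotv u v = 0 -> qf (hess FB b) v = 0 -> v = 0.

Let oWA : open WA. Proof. by case: lA. Qed.
Let oWB : open WB. Proof. by case: lB. Qed.
Let rA : Reg alpha c WA FA. Proof. by have /local_definingP[] := lA. Qed.
Let rB : Reg alpha c WB FB. Proof. by have /local_definingP[] := lB. Qed.
Let gA0 x : WA x -> gradient FA x != 0. Proof. by have /local_definingP[_ _ + _] := lA; exact. Qed.
Let gB0 x : WB x -> gradient FB x != 0. Proof. by have /local_definingP[_ _ + _] := lB; exact. Qed.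
Let C2A : C2on WA FA. Proof. exact: Reg_C2on rA. Qed.
Let C2B : C2on WB FB. Proof. exact: Reg_C2on rB. Qed.
Let dA : C2def (bdry A) WA FA. Proof. by have /local_definingP[] := lA; split. Qed.
Let dB : C2def (bdry B) WB FB. Proof. by have /local_definingP[] := lB; split. Qed.
Let cA : compact A. Proof. by case: hA => _ []. Qed.
Let cB : compact B. Proof. by case: hB => _ []. Qed.
Let vA : Defs.convex_set A. Proof. by case: hA. Qed.
Let vB : Defs.convex_set B. Proof. by case: hB. Qed.
Let FA0 x : WA x -> bdry A x <-> FA x = 0.
Proof.
move=> Wx; have [_ _ _ E] := dA; split=> [bx|Fx].
  by have : (bdry A `&` WA) x by []; rewrite E => -[].
by have : [set x | WA x /\ FA x = 0] x by []; rewrite -E => -[].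
Qed.
Let FB0 x : WB x -> bdry B x <-> FB x = 0.
Proof.
move=> Wx; have [_ _ _ E] := dB; split=> [bx|Fx].
  by have : (bdry B `&` WB) x by []; rewrite E => -[].
by have : [set x | WB x /\ FB x = 0] x by []; rewrite -E => -[].
Qed.
Let bAa : bdry A a. Proof. exact: outer_normal_bdry Aa uA. Qed.
Let bBb : bdry B b. Proof. exact: outer_normal_bdry Bb uB. Qed.

Let cA' := dotv u (gradient FA a).
Let cB' := dotv u (gradient FB b).
Let EgA : gradient FA a = cA' *: u.
Proof. by have [] := outer_normal_gradient (bdry_sub cA) dA WAa bAa uA. Qed.
Let EgB : gradient FB b = cB' *: u.
Proof. by have [] := outer_normal_gradient (bdry_sub cB) dB WBb bBb uB. Qed.
Let l0 := cA' / cB'.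
Let l00 : 0 < l0. Proof. by rewrite divr_gt0. Qed.

Let U : set VN := [set X | WA (pa X) /\ WB (py X)].
Let oU : open U.
Proof.
rewrite openE => X [/(open_norm oWA)[d1 d10 H1] /(open_norm oWB)[d2 d20 H2]].
apply/nbhsE_norm; exists (Num.min d1 d2); first by rewrite lt_min d10.
move=> Y; rewrite lt_min => /andP[Y1 Y2]; split.
  by apply: H1; rewrite -paB; exact: le_lt_trans (pa_le _) Y1.
by apply: H2; rewrite -pyB; exact: le_lt_trans (py_le _) Y2.
Qed.

(* Psi X = (x, 0, 0) says that x is the sum of a point and a boundary point of B with
   parallel gradients; no boundary condition is imposed on the point of A. *)
Let Psi (X : VN) : VN :=
  mk (pa X + py X) (gradient FA (pa X) - pl X *: gradient FB (py X)) (FB (py X)).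

Let Psi1 i : (fun X => Psi X 0 (lshift 1 (lshift n i))) =
  (fun X => X 0 (lshift 1 (lshift n i)) + X 0 (lshift 1 (rshift n i))).
Proof. by apply/funext => X; rewrite /Psi /mk !row_mxEl mxE paE pyE. Qed.

Let Psi2 i : (fun X => Psi X 0 (lshift 1 (rshift n i))) =
  (fun X => pd i FA (pa X) - X 0 (rshift (n + n) 0) * pd i FB (py X)).
Proof.
apply/funext => X; rewrite /Psi /mk row_mxEl row_mxEr.
by rewrite [LHS]mxE gradientE [X in _ + X]mxE [X in _ - X]mxE gradientE.
Qed.

Let Psi3 k : (fun X => Psi X 0 (rshift (n + n) k)) = (fun X => FB (py X)).
Proof. by apply/funext => X; rewrite /Psi /mk row_mxEr mxE. Qed.

Let lip_pa W : loc_lip W pa.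
Proof.
move=> x _; exists 1 => //; exists 1 => // y z _ _; rewrite mul1r -paB; exact: pa_le.
Qed.
Let lip_py W : loc_lip W py.
Proof.
move=> x _; exists 1 => //; exists 1 => // y z _ _; rewrite mul1r -pyB; exact: py_le.
Qed.

Let Reg_pa f : Reg alpha c1 WA f -> Reg alpha c1 U (fun X => f (pa X)).
Proof.
move=> rf; apply: (Reg_comp alpha01 oU oWA rf) => //; last by move=> X [].
by move=> j; under eq_fun do rewrite paE; exact: Reg_coord.
Qed.
Let Reg_py f : Reg alpha c1 WB f -> Reg alpha c1 U (fun X => f (py X)).
Proof.
move=> rf; apply: (Reg_comp alpha01 oU oWB rf) => //; last by move=> X [].
by move=> j; under eq_fun do rewrite pyE; exact: Reg_coord.
Qed.

Let RPsi j : Reg alpha c1 U (fun X => Psi X 0 j).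
Proof.
case: (split_ordP j) => [i ->|i ->].
  case: (split_ordP i) => [k ->|k ->].
    by rewrite Psi1; apply: Reg_add => //; exact: Reg_coord.
  rewrite Psi2; apply: Reg_sub_fun => //; first by apply: Reg_pa; exact: Reg_pd.
  by apply: Reg_mul => //; [exact: Reg_coord|apply: Reg_py; exact: Reg_pd].
by rewrite Psi3; apply: Reg_py; exact: Reg_S.
Qed.

Let X0 := mk a b l0.
Let UX0 : U X0. Proof. by split; rewrite ?pa_mk ?py_mk. Qed.

Let D_pa (f : V -> R) X v : fdiff f (pa X) ->
  is_derive X v (fun X => f (pa X)) (dotv (pa v) (gradient f (pa X))).
Proof.
move=> df; apply: is_derive_comp => // j; rewrite paE.
by under eq_fun do rewrite paE; exact: is_derive_coord.
Qed.
Let D_py (f : V -> R) X v : fdiff f (py X) ->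
  is_derive X v (fun X => f (py X)) (dotv (py v) (gradient f (py X))).
Proof.
move=> df; apply: is_derive_comp => // j; rewrite pyE.
by under eq_fun do rewrite pyE; exact: is_derive_coord.
Qed.

Let hessE (F : V -> R) x v i : dotv v (gradient (pd i F) x) = (v *m hess F x) 0 i.
Proof. by rewrite dotvE mxE; apply: eq_bigr => k _; rewrite gradientE mxE. Qed.

Let ker0 v : (forall j, dotv v (gradient (fun X => Psi X 0 j) X0) = 0) -> v = 0.
Proof.
move=> H.
have HD j l : is_derive X0 v (fun X => Psi X 0 j) l -> l = 0.
  move=> [_ <-]; have [_ ->] := fdiff_is_derive v (Reg_fdiff oU (RPsi j) UX0); exact: H.
have fA i : fdiff (pd i FA) (pa X0) by rewrite pa_mk; exact: C2_fdiff_pd oWA C2A WAa.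
have fB i : fdiff (pd i FB) (py X0) by rewrite py_mk; exact: C2_fdiff_pd oWB C2B WBb.
have fB0 : fdiff FB (py X0) by rewrite py_mk; exact: C2_fdiff oWB C2B WBb.
have e1 i : pa v 0 i + py v 0 i = 0.
  apply: (HD (lshift 1 (lshift n i))); rewrite Psi1 paE pyE.
  by apply: is_deriveD; exact: is_derive_coord.
have e2 i : (pa v *m hess FA a) 0 i - (l0 * (py v *m hess FB b) 0 i + pd i FB b * pl v) = 0.
  apply: (HD (lshift 1 (rshift n i))); rewrite Psi2 -!hessE.
  apply: is_deriveB; first by have := D_pa v (fA i); rewrite pa_mk.
  have := is_derive_mul (is_derive_coord X0 v (rshift (n + n) 0)) (D_py v (fB i)).
  by rewrite !py_mk -/(pl X0) pl_mk.
have e3 : dotv (py v) (gradient FB b) = 0.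
  apply: (HD (rshift (n + n) 0)); rewrite Psi3.
  by have := D_py v fB0; rewrite py_mk.
have Ea : pa v = - py v.
  by apply/rowP => i; rewrite [RHS]mxE; apply/eqP; rewrite -addr_eq0 e1.
have uy : dotv u (py v) = 0.
  move: e3; rewrite EgB dotvZr dotvC => /eqP; rewrite mulf_eq0 gt_eqF//= => /eqP; exact.
have eq2 : pa v *m hess FA a = l0 *: (py v *m hess FB b) + pl v *: gradient FB b.
  apply/rowP => i; have /eqP := e2 i; rewrite -gradientE subr_eq0 => /eqP ->.
  by rewrite [RHS]mxE [X in _ = X + _]mxE [X in _ = _ + X]mxE [pl v * _]mulrC.
(* Pairing with [py v], which is orthogonal to the gradient, eliminates [pl v]. *)
have qs : qf (hess FA a) (py v) + l0 * qf (hess FB b) (py v) = 0.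
  have := congr1 (fun w => dotv w (py v)) eq2.
  rewrite Ea mulNmx dotvNl dotvDl !dotvZl (dotvC (gradient FB b)) e3 mulr0 addr0 /qf => E.
  by rewrite -[X in X + _]opprK E addNr.
have qA : 0 <= qf (hess FA a) (py v).
  by have := hess_tangent_ge0 (bdry_sub cA) dA WAa bAa uA uy; rewrite pmulr_rge0.
have qB : 0 <= qf (hess FB b) (py v).
  by have := hess_tangent_ge0 (bdry_sub cB) dB WBb bBb uB uy; rewrite pmulr_rge0.
have y0 : py v = 0.
  apply: nd => //; apply/eqP; rewrite eq_le qB andbT -(pmulr_rle0 _ l00).
  by move: qs qA; move: (qf _ _) (l0 * _) => p q; lra.
have a0 : pa v = 0 by rewrite Ea y0 oppr0.
have l_0 : pl v = 0.
  move: eq2; rewrite a0 y0 !mul0mx scaler0 add0r => /esym/eqP.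
  by rewrite scaler_eq0 (negbTE (gB0 WBb)) orbF => /eqP.
rewrite [v]mk_eta a0 y0 l_0; apply/rowP => j; rewrite [RHS]mxE /mk.
case: (split_ordP j) => [i ->|i ->]; last by rewrite row_mxEr mxE.
by rewrite row_mxEl row_mx0 mxE.
Qed.

Let p := a + b.
Let PsiX0 : Psi X0 = mk p 0 0.
Proof.
rewrite /Psi pa_mk py_mk pl_mk EgA EgB scalerA /l0 divfK ?gt_eqF// subrr.
by rewrite (_ : FB b = 0)//; apply/FB0.
Qed.

Lemma local_sum : exists W F, W (a + b) /\ local_defining c alpha (bdry (mink_sum A B)) W F.
Proof.
have [d d0 [e e0 [Xi [XiU XiK lipXi RXi]]]] := inverse_function alpha01 oU UX0 RPsi ker0.
rewrite PsiX0 in XiU XiK lipXi RXi.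
(* Restricted to these values, the local inverse imposes parallel gradients and [FB = 0], and only
   the sum remains free. *)
pose emb (x : V) := mk x 0 0.
have embB x y : emb x - emb y = emb (x - y) by rewrite /emb mkB !subrr.
have emb_nb x : nb p e x -> nb (mk p 0 0) e (emb x).
  by rewrite /nb /= -/(emb p) embB => xe; apply: mk_lt => //; rewrite normr0.
have emb_le x : `|emb x| <= `|x|.
  apply: norm_le_coord => // j; rewrite /emb /mk; case: (split_ordP j) => [i ->|i ->].
    rewrite row_mxEl; case: (split_ordP i) => [k ->|k ->].
      by rewrite row_mxEl; exact: coord_norm_le.
    by rewrite row_mxEr mxE normr0.
  by rewrite row_mxEr mxE normr0.
pose aa x := pa (Xi (emb x)); pose yy x := py (Xi (emb x)); pose ll x := pl (Xi (emb x)).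
have solP x : nb p e x -> [/\ WA (aa x), WB (yy x), aa x + yy x = x,
    gradient FA (aa x) = ll x *: gradient FB (yy x) & FB (yy x) = 0].
  move=> /emb_nb/XiU[[wa wb] E]; split=> //.
  - by have := congr1 pa E; rewrite /Psi !pa_mk.
  - by have := congr1 py E; rewrite /Psi !py_mk => /eqP; rewrite subr_eq0 => /eqP.
  - by have := congr1 pl E; rewrite /Psi !pl_mk.
have Xip : Xi (emb p) = X0 by rewrite /emb -PsiX0 XiK ?PsiX0//; exact: nbxx.
have lipE : loc_lip (nb p e) (fun x => Xi (emb x)).
  move=> x /emb_nb/lipXi[r r0 [C C0 HC]]; exists r => //; exists C => // y z yr zr.
  apply: (le_trans (HC _ _ _ _)); rewrite ?embB.
  - exact: le_lt_trans (emb_le _) yr.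
  - exact: le_lt_trans (emb_le _) zr.
  - by rewrite ler_wpM2l//; exact: emb_le.
have oN : open (nb p e) by exact: nb_open.
have lipaa : loc_lip (nb p e) aa.
  move=> x /lipE[r r0 [C C0 HC]]; exists r => //; exists C => // y z yr zr.
  by rewrite /aa -paB (le_trans (pa_le _))//; exact: HC.
have Raa j : Reg alpha c1 (nb p e) (fun x => aa x 0 j).
  under eq_fun do rewrite /aa paE.
  apply: (Reg_comp (G := emb) alpha01 oN (@nb_open _ _ (mk p 0 0) e) (RXi _)) => //.
  - move=> k; rewrite /emb /mk; case: (split_ordP k) => [i ->|i ->].
      case: (split_ordP i) => [l ->|l ->].
        by under eq_fun do rewrite !row_mxEl; exact: Reg_coord.
      by under eq_fun do rewrite row_mxEl row_mxEr mxE; exact: Reg_cst.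
    by under eq_fun do rewrite row_mxEr mxE; exact: Reg_cst.
  - move=> x _; exists 1 => //; exists 1 => // y z _ _; rewrite mul1r embB; exact: emb_le.
pose F x := FA (aa x).
have DF x i : nb p e x -> is_derive x (evec R i) F (pd i FA (aa x)).
  move=> xe; have [wa wb Es Eg _] := solP x xe.
  pose l : V := \row_j pd i (fun x => aa x 0 j) x.
  have Da j : is_derive x (evec R i) (fun x => aa x 0 j) (l 0 j).
    rewrite mxE; apply: pdP; have [be _ h] := Reg_cls alpha01 oN (Raa j).
    exact: cls_derivable h xe.
  have fa : fdiff FA (aa x) by exact: C2_fdiff oWA C2A wa.
  have D1 := is_derive_comp (G := aa) fa Da.
  (* The point of [B] is treated as [x - aa x], so that its derivative is read off that of [aa]. *)
  pose l' : V := evec R i - l.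
  have Dy j : is_derive x (evec R i) (fun x => (x - aa x) 0 j) (l' 0 j).
    rewrite (_ : (fun x : V => _) = (fun x : V => x 0 j - aa x 0 j)); last by apply/funext => z; rewrite !mxE.
    rewrite (_ : l' 0 j = evec R i 0 j - l 0 j); last by rewrite !mxE.
    by apply: is_deriveB; exact: is_derive_coord.
  have Ey z : nb p e z -> z - aa z = yy z by move=> /solP[_ _ E _ _]; rewrite -{1}E addrAC subrr add0r.
  have fb : fdiff FB (x - aa x) by rewrite Ey//; exact: C2_fdiff oWB C2B wb.
  have D2 := is_derive_comp (G := fun x => x - aa x) fb Dy.
  (* The point of [B] stays on the zero set of [FB]. As the two gradients are parallel, its motion
     contributes nothing to the derivative of [FA o aa] either. *)
  have z0 : dotv l' (gradient FB (x - aa x)) = 0.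
    have [_ <-] := D2; rewrite (@near_eq_derive _ _ _ _ (fun=> 0)); last first.
      apply/nbhsE_norm; have [r r0 Hr] := open_norm oN xe; exists r => // z /Hr ze.
      by rewrite Ey//; have [] := solP z ze.
    exact: derive_cst.
  have -> : pd i FA (aa x) = dotv l (gradient FA (aa x)).
    rewrite -gradientE -(dotv_evec _ i) dotvC.
    rewrite -[X in dotv X _](subrK l) dotvDl -/l' Eg dotvZr -Ey// z0 mulr0 add0r.
    by rewrite Ey// -Eg.
  exact: D1.
(* aa is only of the class of gradient FA, one derivative short, but so is the gradient of
   F = FA o aa, which equals (gradient FA) o aa: this recovers the lost derivative. *)
have RF : Reg alpha c (nb p e) F.
  apply: (@Reg_integrate _ _ _ _ _ _ (fun i x => pd i FA (aa x))) => //.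
  - by apply: (Reg_comp alpha01 oN oWA (Reg_S alpha01 oWA rA) Raa lipaa) => x /solP[].
  - by move=> i; apply: (Reg_comp alpha01 oN oWA (Reg_pd i rA) Raa lipaa) => x /solP[].
have gF x : nb p e x -> gradient F x = gradient FA (aa x).
  by move=> xe; apply/rowP => i; rewrite !gradientE; apply: is_derive_pd; exact: DF.
have [sA sA0 HsA] := normal_sign_near hA dA WAa bAa uA cA0.
have [sB sB0 HsB] := normal_sign_near hB dB WBb bBb uB cB0.
have Eg0 : gradient FA a = l0 *: gradient FB b by rewrite EgA EgB scalerA /l0 divfK ?gt_eqF.
have g0 : 0 < `|gradient FB b| by rewrite normr_gt0 gB0.
(* The first bound keeps the gradient of [FB] at nearby points at least half as long as at [b]; the
   second then makes the change of the gradient ratio less than [d]. *)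
have [ep ep0 [ep1 ep2]] : exists2 ep : R, 0 < ep & ep <= `|gradient FB b| / 2 /\
    ep * (1 + l0) <= d * `|gradient FB b| / 4.
  move: g0; move: `|_| => g g0; have l1 : 0 < 1 + l0 by rewrite addr_gt0.
  exists (Num.min (g / 2) (d * g / 4 / (1 + l0))).
    by rewrite lt_min !divr_gt0//= mulr_gt0.
  by split; [rewrite ge_min lexx|rewrite -ler_pdivlMr// ge_min lexx orbT].
have [rgA rgA0 HgA] := grad_continuous C2A WAa ep0.
have [rgB rgB0 HgB] := grad_continuous C2B WBb ep0.
have [wA wA0 HwA] := open_norm oWA WAa.
have [wB wB0 HwB] := open_norm oWB WBb.
have [m m0 [[ms1 ms2] [mg1 mg2] [mw1 mw2] md]] : exists2 m : R, 0 < m &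
    [/\ m <= sA /\ m <= sB, m <= rgA /\ m <= rgB, m <= wA /\ m <= wB & m <= d].
  exists (Num.min (Num.min sA sB) (Num.min (Num.min rgA rgB) (Num.min (Num.min wA wB) d))).
    by rewrite !lt_min sA0 sB0 rgA0 rgB0 wA0 wB0 d0.
  by rewrite !ge_min !lexx !orbT.
(* Uniqueness of the local inverse: a splitting near (a, b) with a common normal solves the system,
   with a ratio [l'] near [l0], so it is the one that [Xi] finds. *)
have key x a' b' u' : nb p e x -> x = a' + b' -> `|a' - a| < m -> `|b' - b| < m -> A a' -> B b' ->
    outer_unit_normal A a' u' -> outer_unit_normal B b' u' -> aa x = a'.
  move=> xe Ex am bm Aa' Bb' uA' uB'.
  have WAa' : WA a' by apply: HwA; exact: lt_le_trans mw1.
  have WBb' : WB b' by apply: HwB; exact: lt_le_trans mw2.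
  have bA' := outer_normal_bdry Aa' uA'; have bB' := outer_normal_bdry Bb' uB'.
  have pA := HsA a' u' (lt_le_trans am ms1) WAa' bA' uA'.
  have pB := HsB b' u' (lt_le_trans bm ms2) WBb' bB' uB'.
  have [EA' _] := outer_normal_gradient (bdry_sub cA) dA WAa' bA' uA'.
  have [EB' _] := outer_normal_gradient (bdry_sub cB) dB WBb' bB' uB'.
  set k1 := dotv u' _ in pA EA'; set k2 := dotv u' _ in pB EB'.
  pose l' := k1 / k2.
  have El : gradient FA a' = l' *: gradient FB b' by rewrite EA' EB' scalerA /l' divfK ?gt_eqF.
  have ld : `|l' - l0| < d.
    have E1 : (l' - l0) *: gradient FB b' = (gradient FA a' - gradient FA a) -
        l0 *: (gradient FB b' - gradient FB b).
      by rewrite El Eg0 scalerBl scalerBr opprB addrA subrK.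
    have b1 := HgA a' (lt_le_trans am mg1); have b2 := HgB b' (lt_le_trans bm mg2).
    have b3 : `|l' - l0| * `|gradient FB b'| <= ep * (1 + l0).
      rewrite -normrZ E1 (le_trans (ler_normB _ _))// normrZ (gtr0_norm l00).
      rewrite mulrDr mulr1; apply: lerD b1 _; rewrite [ep * _]mulrC.
      exact: ler_wpM2l (ltW l00) _ _ b2.
    have b4 : `|gradient FB b| - ep <= `|gradient FB b'|.
      have := ler_normD (gradient FB b') (gradient FB b - gradient FB b').
      by rewrite addrC subrK lerBlDr => /le_trans; apply; rewrite lerD2l distrC.
    have b5 : `|l' - l0| * (`|gradient FB b| / 2) <= d * `|gradient FB b| / 4.
      apply: (le_trans _ (le_trans b3 ep2)); apply: ler_wpM2l => //.
      exact: le_trans (half_le_sub ep1) b4.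
    exact: lt_of_half_quarter g0 d0 b5.
  have PX : Psi (mk a' b' l') = emb x.
    by rewrite /Psi pa_mk py_mk pl_mk El subrr -Ex (_ : FB b' = 0)//; apply/FB0.
  have : Xi (Psi (mk a' b' l')) = mk a' b' l'.
    apply: XiK; last by rewrite PX; exact: emb_nb.
    by rewrite /nb /= /X0 mkB; apply: mk_lt => //; exact: lt_le_trans md.
  by rewrite PX /aa => ->; rewrite pa_mk.
(* The bound [l0] keeps the ratio [ll x] positive, so that parallel gradients mean equal, and not
   opposite, outer normals. *)
have [rho rho0 Hrho] : exists2 rho : R, 0 < rho & forall x, `|x - p| < rho ->
    `|Xi (emb x) - X0| < Num.min m l0.
  have [r r0 [C C0 HC]] := lipE p (nbxx p e0).
  have ml : 0 < Num.min m l0 by rewrite lt_min m0.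
  have C1 : 0 < C + 1 by lra.
  exists (Num.min r (Num.min m l0 / (C + 1))); first by rewrite lt_min r0 divr_gt0.
  move=> x; rewrite lt_min => /andP[xr]; rewrite ltr_pdivlMr// => xm.
  have := HC x p xr; rewrite subrr normr0 Xip => /(_ r0) H.
  apply: le_lt_trans H _; apply: le_lt_trans xm; rewrite mulrDr mulr1 mulrC lerDl//.
have m2 : 0 < m / 2 by rewrite divr_gt0.
have [dd dd0 Hdd] := decomposition_stable hA hB dA dB WAa WBb Aa Bb uA uB nd m2.
pose e' := Num.min (Num.min e rho) (Num.min (m / 2) dd).
have e'0 : 0 < e' by rewrite !lt_min e0 rho0 m2.
have e'P x : nb p e' x -> [/\ nb p e x, `|x - p| < rho, `|x - p| < m / 2 & `|x - p| < dd].
  by rewrite /nb /= /e' !lt_min => /andP[/andP[? ?] /andP[]].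
exists (nb p e'), F; split; first exact: nbxx.
apply/local_definingP; split.
- exact: nb_open.
- by apply: (Reg_sub _ RF) => x /e'P[].
- by move=> x /e'P[xe _ _ _]; rewrite gF// gA0//; have [] := solP x xe.
apply/seteqP; split=> x.
  move=> [bx xe']; split=> //; have [xe _ xm xd] := e'P x xe'.
  have [a' [b' [u' [Aa' Bb' Ex uA' uB']]]] := bdry_mink cA cB vA vB bx.
  have bm := Hdd x xd a' b' u' Aa' Bb' Ex uA' uB'.
  have am : `|a' - a| < m.
    have -> : a' - a = (x - p) - (b' - b) by rewrite Ex /p; apply/rowP => i; rewrite !mxE; ring.
    by apply: (le_lt_trans (ler_normB _ _)); lra.
  have bm' : `|b' - b| < m by lra.
  rewrite /F (key x a' b' u')//; apply/FA0; first by apply: HwA; exact: lt_le_trans mw1.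
  exact: outer_normal_bdry uA'.
move=> [xe' Fx]; split=> //; have [xe xr _ _] := e'P x xe'.
have [wa wb Es Eg Fb] := solP x xe.
have := Hrho x xr; rewrite lt_min => /andP[Xm Xl].
have am : `|aa x - a| < m.
  have -> : aa x - a = pa (Xi (emb x) - X0) by rewrite paB pa_mk.
  exact: le_lt_trans (pa_le _) Xm.
have bm : `|yy x - b| < m.
  have -> : yy x - b = py (Xi (emb x) - X0) by rewrite pyB py_mk.
  exact: le_lt_trans (py_le _) Xm.
have lp : 0 < ll x.
  have : `|ll x - l0| < l0.
    have -> : ll x - l0 = pl (Xi (emb x) - X0) by rewrite plB pl_mk.
    exact: le_lt_trans (pl_le _) Xl.
  by rewrite ltr_norml => /andP[]; lra.
have bA : bdry A (aa x) by apply/FA0.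
have bB : bdry B (yy x) by apply/FB0.
have [iA iB] : A !=set0 /\ B !=set0 by split; [exists a|exists b].
have [u1 un1] := supporting_hyperplane cA vA iA (proj2 bA).
have [u2 un2] := supporting_hyperplane cB vB iB (proj2 bB).
have p1 := HsA _ _ (lt_le_trans am ms1) wa bA un1.
have p2 := HsB _ _ (lt_le_trans bm ms2) wb bB un2.
have [E1 _] := outer_normal_gradient (bdry_sub cA) dA wa bA un1.
have [E2 _] := outer_normal_gradient (bdry_sub cB) dB wb bB un2.
have Eu : u1 = u2.
  apply: (unit_multiple (proj1 un1) (proj1 un2) p1 (mulr_gt0 lp p2)).
  by rewrite -E1 Eg {1}E2 scalerA.
rewrite -Eu in un2; rewrite -Es.
have Ax := bdry_sub cA bA; have Bx := bdry_sub cB bB.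
apply: (@outer_normal_bdry _ _ _ _ u1); first by apply/mink_sumP; exists (aa x), (yy x).
exact: (outer_normal_mink u1 Ax Bx).2 (conj un1 un2).
Qed.
End LocalSum.

(** * Normals of nonzero curvature *)

Section Zset.
Variables (R : realType) (n : nat).
Notation V := 'rV[R]_n.
Implicit Types (C W : set V).

Lemma local_defining_C2def (alpha : R) c (S W : set V) (F : V -> R) : reg_ge2 c ->
  local_defining c alpha S W F -> C2def S W F /\ local_defining (Fin 2) 0 S W F.
Proof.
move=> c2 [oW [cF [g0 E]]].
have k2 : Ck_on 2 W F.
  case: c c2 cF => [k /= k2 [h _]|_ /(_ 2%N)//|_].
    by move=> s s2 x Wx; have [h1 h2] := h s (leq_trans s2 k2) x Wx; split=> // s2'; apply: h2; apply: leq_trans k2.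
  by move=> /(analytic_on_an oW)[/(_ 2%N)/Ck_on_cls].
have h2 : cls 0 2 W F by apply/Ck_on_cls.
split; first by split=> //; exact: cls_C2on h2.
by split=> //; split=> //; apply/cls_of_class.
Qed.

Lemma tangent_normal C W (F : V -> R) x u v : compact C -> C2def (bdry C) W F -> W x ->
  bdry C x -> outer_unit_normal C x u -> dotv v (gradient F x) = 0 <-> dotv u v = 0.
Proof.
move=> cC dF Wx bx un; have [Eg k0] := outer_normal_gradient (bdry_sub cC) dF Wx bx un.
rewrite {1}Eg dotvZr (dotvC v); split=> [/eqP|->]; last by rewrite mulr0.
by rewrite mulf_eq0 (negbTE k0) => /eqP.
Qed.

(** Quantified over all defining functions, so that it can be verified with one and applied with
    another. *)
Definition nondegenerate C x u := forall W F, C2def (bdry C) W F -> W x ->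
  forall v, dotv u v = 0 -> qf (hess F x) v = 0 -> v = 0.

Lemma nondegenerateP C W (F : V -> R) x u : compact C -> C2def (bdry C) W F -> W x ->
  bdry C x -> outer_unit_normal C x u ->
  (forall v, dotv u v = 0 -> qf (hess F x) v = 0 -> v = 0) -> nondegenerate C x u.
Proof.
move=> cC dF Wx bx un H W' F' dF' Wx' v uv q0; apply: H => //.
exact: hess_tangent_eq0 (bdry_sub cC) dF dF' Wx Wx' bx un uv q0.
Qed.

Lemma notin_Zset_nondegenerate (alpha : R) c C x u : reg_ge2 c -> reg_convex_body c alpha C ->
  bdry C x -> outer_unit_normal C x u -> ~ Zset C u -> nondegenerate C x u.
Proof.
move=> c2 [[_ [cC _]] hC] bx un nZ.
have [W [F [Wx lF]]] := hC x bx.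
have [dF lF2] := local_defining_C2def c2 lF.
apply: (nondegenerateP cC dF Wx bx un) => v uv q0.
apply/eqP; apply: contrapT => /negP v0; apply: nZ; exists x; split=> //; split=> //.
exists W, F; split=> //; split=> //.
have [oW cF g0 _] := dF.
have [_ k0] := outer_normal_gradient (bdry_sub cC) dF Wx bx un.
have tan w := tangent_normal w cC dF Wx bx un.
apply: (eq0_gauss_curv oW cF Wx (g0 x Wx) k0 _ v0 _ q0).
  by move=> w /tan uw; exact: hess_tangent_ge0 (bdry_sub cC) dF Wx bx un uw.
exact/tan.
Qed.

Lemma dotv_neq0_close (u v : V) : dotv u v != 0 ->
  exists2 d : R, 0 < d & forall u' v', `|u' - u| < d -> `|v' - v| < d -> dotv u' v' != 0.
Proof.
rewrite neq_lt => /orP[uv|/dotv_close[d d0 H]]; last first.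
  by exists d => // u' v' ud /(H _ _ ud) uv; rewrite gt_eqF.
have [|d d0 H] := @dotv_close _ _ (- u) v 0; first by rewrite dotvNl oppr_gt0.
exists d => // u' v' ud vd; have := H (- u') v'.
by rewrite -opprD normrN dotvNl oppr_gt0 => /(_ ud vd) uv'; rewrite lt_eqF.
Qed.

Lemma qf_neq0_close W (F : V -> R) x v : C2on W F -> W x -> qf (hess F x) v != 0 ->
  exists2 d : R, 0 < d & forall x' v', `|x' - x| < d -> `|v' - v| < d -> qf (hess F x') v' != 0.
Proof.
move=> cF Wx /dotv_neq0_close[e e0 He].
pose K := n%:R * (`|hess F x| + 1) + n%:R * `|v| + 1.
have K0 : 0 < K by rewrite ltr_wpDl// addr_ge0// ?mulr_ge0// addr_ge0.
pose e' := Num.min 1 (e / 2 / K).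
have e'0 : 0 < e' by rewrite lt_min ltr01 !divr_gt0.
have [d d0 Hd] : exists2 d : R, 0 < d & forall y, `|y - x| < d -> forall ij : 'I_n * 'I_n,
    `|hess F y ij.1 ij.2 - hess F x ij.1 ij.2| < e'.
  apply: near_fin => -[i j]; have [_ _ _ /(_ i j)/continuousP_norm/(_ _ e'0)[d d0 Hd]] := cF x Wx.
  by exists d => // y /Hd; rewrite !mxE.
exists (Num.min d (Num.min e' e)); first by rewrite lt_min d0 lt_min e0 e'0.
move=> x' v'; rewrite !(lt_min _ d) => /andP[xd _] /andP[_]; rewrite (lt_min _ e') => /andP[ve' ve].
apply: (He _ _ _ ve).
have Hn : `|hess F x' - hess F x| <= e'.
  rewrite [leLHS]/Num.Def.normr/= mx_normrE; apply/bigmax_leP; split; first exact: ltW.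
  by move=> ij _; have /ltW := Hd x' xd ij; rewrite !mxE.
have -> : v' *m hess F x' - v *m hess F x =
    (v' - v) *m hess F x' + v *m (hess F x' - hess F x).
  by rewrite mulmxBl mulmxBr addrA subrK.
apply: (le_lt_trans (ler_normD _ _)).
have h1 : `|hess F x'| <= `|hess F x| + 1.
  rewrite -[X in `|X|](subrK (hess F x)) addrC (le_trans (ler_normD _ _))// lerD2l.
  by rewrite (le_trans Hn)// ge_min lexx.
have t1 : `|(v' - v) *m hess F x'| <= n%:R * (`|hess F x| + 1) * e'.
  apply: (le_trans (mulmx_norm_le _ _)); apply: ler_pM => //; last exact: ltW.
  by rewrite ler_wpM2l.
have t2 : `|v *m (hess F x' - hess F x)| <= n%:R * `|v| * e'.
  apply: (le_trans (mulmx_norm_le _ _)); by rewrite mulrAC ler_wpM2l// mulr_ge0.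
apply: (le_lt_trans (lerD t1 t2)); rewrite -mulrDl.
have Ke : K * e' <= e / 2 by rewrite mulrC -ler_pdivlMr// ge_min lexx orbT.
apply: le_lt_trans (_ : e / 2 < e); last by rewrite ltr_pdivrMr// ltr_pMr// ltr1n.
by apply: le_trans Ke; apply: ler_wpM2r; [exact: ltW|rewrite lerDl].
Qed.

(** Compactness of the unit sphere shows that nondegeneracy persists for points near [x] and
    directions near [u]; compactness of [C] shows that points with normal near [u] are near [x], the
    only point with normal [u]. So no direction near [u] is a normal at a point of zero
    curvature. *)
Lemma nondegenerate_interior C W (F : V -> R) x u : convex_body C -> C2def (bdry C) W F -> W x ->
  bdry C x -> outer_unit_normal C x u -> nondegenerate C x u -> interior (~` Zset C) u.
Proof.
move=> hC dF Wx bx un nd; have [vC [cC _]] := hC; have [oW cF _ _] := dF.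
have [d d0 Hd] : exists2 d : R, 0 < d & forall x' u', `|x' - x| < d -> `|u' - u| < d ->
    forall v, dotv v v = 1 -> ~ (dotv u' v = 0 /\ qf (hess F x') v = 0).
  apply: (@compact_uniform R n n n [set v : V | dotv v v = 1]
    (fun x' u' v => ~ (dotv u' v = 0 /\ qf (hess F x') v = 0))); first exact: sphere_compact.
  move=> v v1; have [uv|/eqP/dotv_neq0_close[d d0 Hd]] := pselect (dotv u v = 0); last first.
    by exists d => // x' u' v' _ ud vd [/eqP]; rewrite (negbTE (Hd _ _ ud vd)).
  have [|d d0 Hd] := @qf_neq0_close _ _ x v cF Wx.
    by apply/negP => /eqP/(nd W F dF Wx v uv) v0; move: v1; rewrite /= v0 dotv0l => /esym/eqP; rewrite oner_eq0.
  by exists d => // x' u' v' xd _ vd [_ /eqP]; rewrite (negbTE (Hd _ _ xd vd)).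
have [w w0 Hw] := open_norm oW Wx.
have e0 : 0 < Num.min d w by rewrite lt_min d0.
have z0 : `|(0 : V) - 0| < 1 by rewrite subrr normr0.
have [f f0 Hf] : exists2 f : R, 0 < f & forall u' (z : V), `|u' - u| < f -> `|z - 0| < f ->
    forall x', C x' -> outer_unit_normal C x' u' -> `|x' - x| < Num.min d w.
  apply: (@compact_uniform R n n n C
    (fun u' _ x' => outer_unit_normal C x' u' -> `|x' - x| < Num.min d w)) => // x0 Cx0.
  have [[y Cy /dotv_close[f f0 Hf]]|nC] := pselect (exists2 y, C y & dotv u (y - x0) > 0).
    exists f => // u' _ x' ud _ xd [_ /(_ y Cy)]; rewrite leNgt => /negP H; exfalso; apply: H.
    apply: Hf => //; have -> : y - x' - (y - x0) = - (x' - x0).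
      by apply/rowP => i; rewrite !mxE; ring.
    by rewrite normrN.
  have un0 : outer_unit_normal C x0 u.
    by have [u1 _] := un; split=> // y Cy; rewrite leNgt; apply/negP => H; apply: nC; exists y.
  rewrite (face_unique hC dF Wx bx un _ Cx0 un0); last exact: nd dF Wx.
  by exists (Num.min d w).
apply/nbhsE_norm; exists (Num.min d f); first by rewrite lt_min d0.
move=> u'; rewrite lt_min => /andP[ud uf] [x' [bx' [un' [W' [F' [Wx' [lF' g0]]]]]]].
have [dF' _] := @local_defining_C2def 0 (Fin 2) (bdry C) W' F' isT lF'.
have [oW' cF' gr' _] := dF'.
have Cx' := bdry_sub cC bx'.
have := Hf u' 0 uf; rewrite subrr normr0 => /(_ f0 x' Cx' un'); rewrite lt_min => /andP[xd xw].
have Wx1 : W x' by exact: Hw.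
have [v [v0 tv qv]] := gauss_curv_eq0 oW' cF' Wx' (gr' _ Wx') g0.
have uv : dotv u' v = 0 by apply/(tangent_normal v cC dF' Wx' bx' un').
have qv' := hess_tangent_eq0 (bdry_sub cC) dF dF' Wx1 Wx' bx' un' uv qv.
have vv := dotv_gt0 v0; pose k := (Num.sqrt (dotv v v))^-1.
have kk : k ^+ 2 * dotv v v = 1 by rewrite exprVn sqr_sqrtr ?ltW// mulVf ?gt_eqF.
apply: (Hd x' u' xd ud (k *: v)).
  by rewrite dotvZl dotvZr mulrA -expr2.
by rewrite dotvZr uv mulr0 qfZ qv' mulr0.
Qed.

End Zset.

(** Applied with r = |x - z|, D = |u - u0|^2 and M a bound of the squared norm on the body: the
    first inequality is then |x|^2 <= M for x = r u - t u0. It forces r > t/2 and then t^2 D <= 2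
    M. *)
Lemma far_estimate (R : realFieldType) (r t M D f : R) : 0 <= D ->
  (r - t) ^+ 2 + r * t * D <= M -> 4 * M < t ^+ 2 -> 2 * M < f * t ^+ 2 -> 1 <= t -> 0 < r -> D < f.
Proof.
move=> D0 H h1 h2 t1 r0; have t0 : 0 < t by lra.
have rt : t / 2 < r.
  rewrite ltNge; apply/negP => rt.
  have : 0 <= r * t * D by rewrite !mulr_ge0// ltW.
  have : (t / 2) ^+ 2 <= (t - r) ^+ 2 by apply: lerXn2r; rewrite ?nnegrE; lra.
  by move: (r * t * D) H h1 => k; nra.
have k1 : r * t * D <= M by have := sqr_ge0 (r - t); lra.
have k2 : t / 2 * t * D <= r * t * D by rewrite ler_wpM2r// ler_wpM2r// ltW.
have k3 : t ^+ 2 * D < t ^+ 2 * f by lra.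
by rewrite ltr_pM2l ?exprn_gt0 in k3.
Qed.

(** * Density of the normals of nonzero curvature *)

Section Density.
Variables (R : realType) (n : nat).
Notation V := 'rV[R]_n.
Implicit Types (C W : set V).

Lemma farthest_point C (z : V) : compact C -> C !=set0 ->
  exists2 x, C x & forall y, C y -> dotv (y - z) (y - z) <= dotv (x - z) (x - z).
Proof.
move=> cC C0.
have [|x /set_mem Cx xmax] := @EVT_max_rV R n (fun y : V => dotv (y - z) (y - z)) C C0 cC.
  by apply: continuous_subspaceT; exact: continuous_dotv_sqr.
by exists x => // y Cy; apply: xmax; exact: mem_set.
Qed.

(* The farthest point x of C from z = - t u0 has normal u = (x - z) / |x - z|, close to u0
   for t large, and C is at least as curved at x as the sphere of radius |x - z|. *)
Lemma notin_Zset_dense C (alpha : R) c u0 (e : R) : reg_ge2 c -> reg_convex_body c alpha C ->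
  dotv u0 u0 = 1 -> 0 < e ->
  exists u, [/\ dotv u u = 1, `|u - u0| < e & interior (~` Zset C) u].
Proof.
move=> c2 [hC sC] u01 e0; have [vC [cC [q iq]]] := hC.
have C0 : C !=set0 by exists q; exact: interior_subset.
have [m Cm Hm] := farthest_point 0 cC C0.
pose M := dotv m m.
have HM y : C y -> dotv y y <= M by move=> /Hm; rewrite !subr0.
have M0 : 0 <= M by exact: dotv_ge0.
have e20 : 0 < e ^+ 2 by rewrite exprn_gt0.
(* As [1 <= t], also [t <= t ^+ 2], and the summands yield the two inequalities [tM]. *)
pose t := 4 * M + 1 + 2 * M / e ^+ 2.
have M2 : 0 <= 2 * M / e ^+ 2 by rewrite divr_ge0 ?mulr_ge0// ltW.
have t1 : 1 <= t by rewrite /t; move: M0 M2; clear; move: (_ / _) => z; lra.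
have tM : 4 * M < t ^+ 2 /\ 2 * M < e ^+ 2 * t ^+ 2.
  have tt : t <= t ^+ 2 by rewrite expr2 ler_peMl// (le_trans ler01).
  split; first by apply: lt_le_trans tt; rewrite /t; move: M0 M2; clear; move: (_ / _) => z; lra.
  apply: (lt_le_trans _ (ler_wpM2l (ltW e20) tt)).
  rewrite [X in _ < X]mulrC -ltr_pdivrMr// /t; move: M0 M2; clear; move: (_ / _) => z; lra.
pose z := - (t *: u0).
have [x Cx Hx] := farthest_point z cC C0.
(* If the largest distance to [z] were 0, [C] would be a single point, which has empty interior. *)
have xz0 : x - z != 0.
  apply/negP => /eqP xz; have : dotv (q - z) (q - z) <= 0 by have := Hx q (interior_subset iq); rewrite xz dotv0l.
  rewrite leNgt => /negP; apply; apply: dotv_gt0; apply/negP => /eqP qz.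
  have : forall y, C y -> y = z.
    move=> y /Hx; rewrite xz dotv0l => H; apply/eqP; rewrite -subr_eq0 -dotv_eq0.
    by rewrite eq_le H dotv_ge0.
  move=> sing; move: iq => /nbhsE_norm[d d0 Hd].
  have /Hd/sing : `|q + (d / 2) *: u0 - q| < d.
    rewrite addrC addKr normrZ gtr0_norm ?divr_gt0//.
    have : `|u0| <= 1.
      by rewrite -(@ler_pXn2r _ 2) ?nnegrE// expr1n -u01 norm_sqr_le_dotv.
    move=> u1; apply: (@le_lt_trans _ _ (d / 2)); first by rewrite ler_piMr// divr_ge0// ltW.
    by rewrite ltr_pdivrMr// ltr_pMr// ltr1n.
  move: qz => /eqP; rewrite subr_eq0 => /eqP <- /eqP; rewrite -subr_eq0 addrC addKr scaler_eq0.
  rewrite mulf_eq0 gt_eqF//= invr_eq0 pnatr_eq0/= => /eqP u00.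
  by move: u01; rewrite u00 dotv0l => /esym/eqP; rewrite oner_eq0.
have rr := dotv_gt0 xz0; set rho := dotv (x - z) (x - z) in rr Hx.
pose r := Num.sqrt rho; have r0 : 0 < r by rewrite sqrtr_gt0.
have rE : r ^+ 2 = rho by rewrite sqr_sqrtr// ltW.
pose u := r^-1 *: (x - z).
have u1 : dotv u u = 1 by rewrite dotvZl dotvZr mulrA -/rho -rE expr2 -invfM mulVf// mulf_neq0 ?gt_eqF.
have xru : x - z = r *: u by rewrite scalerA divff ?gt_eqF// scale1r.
have un : outer_unit_normal C x u.
  split=> // y Cy; rewrite dotvZl pmulr_rle0 ?invr_gt0//.
  have := Hx y Cy; have -> : y - z = (y - x) + (x - z) by rewrite addrA subrK.
  have := dotv_ge0 (y - x); rewrite /rho; move: (y - x) (x - z) => k w; clear.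
  by rewrite dotvDl !dotvDr (dotvC k w); move: (dotv k k) (dotv w w) (dotv w k) => k1 k2 k3; lra.
have bx := outer_normal_bdry Cx un.
have [W [F [Wx lF]]] := sC x bx.
have [dF _] := local_defining_C2def c2 lF.
exists u; split=> //.
- have xx : x = r *: u - t *: u0 by rewrite -xru /z opprK addrK.
  have E : dotv x x = (r - t) ^+ 2 + r * t * dotv (u - u0) (u - u0).
    rewrite xx; move: (u) u1 (r) (t) => w w1 r' t'.
    by rewrite !(dotvBl, dotvBr, dotvZl, dotvZr) w1 u01 (dotvC u0 w); ring.
  have := HM x Cx; rewrite E => H.
  have D0 := dotv_ge0 (u - u0).
  have : `|u - u0| ^+ 2 < e ^+ 2.
    apply: (le_lt_trans (norm_sqr_le_dotv _)).
    exact: far_estimate D0 H tM.1 tM.2 t1 r0.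
  by rewrite ltr_pXn2r ?nnegrE// ltW.
- apply: (nondegenerate_interior hC dF Wx bx un).
  apply: (nondegenerateP cC dF Wx bx un) => v uv q0; apply/eqP; apply: contrapT => /negP v0.
  have := hess_far_neq0 (bdry_sub cC) dF Wx bx un uv v0 r0 xru; rewrite rE => /(_ Hx).
  by rewrite q0 eqxx.
Qed.

End Density.

(** * Rotations *)

Section Rotations.
Variables (R : realType) (n : nat).
Notation V := 'rV[R]_n.
Implicit Types (Q M N : 'M[R]_n).

Lemma norm_le_entry N (e : R) : 0 <= e -> (forall i j, `|N i j| <= e) -> `|N| <= e.
Proof.
move=> e0 H; rewrite [leLHS]/Num.Def.normr/= mx_normrE; apply/bigmax_leP; split=> // ij _; exact: H.
Qed.

Lemma norm_lt_entry N (e : R) : 0 < e -> (forall i j, `|N i j| < e) -> `|N| < e.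
Proof.
move=> e0 H; rewrite [ltLHS]/Num.Def.normr/= mx_normrE; apply/bigmax_ltP; split=> // ij _; exact: H.
Qed.

Lemma norm_trmx_le N : `|N^T| <= `|N|.
Proof. by apply: norm_le_entry => // i j; rewrite mxE; exact: entry_norm_le. Qed.

Lemma mulmx_sq_norm_le M N : `|M *m N| <= n%:R * `|N| * `|M|.
Proof.
apply: norm_le_entry => [|i j]; first by rewrite !mulr_ge0.
have -> : (M *m N) i j = (row i M *m N) 0 j by rewrite -row_mul [RHS]mxE.
apply: (le_trans (coord_norm_le _ _)); apply: (le_trans (mulmx_norm_le _ _)).
apply: ler_wpM2l; first by rewrite mulr_ge0.
by apply: norm_le_coord => // k; rewrite mxE; exact: entry_norm_le.
Qed.

Lemma SOn_mulVmx Q : SOn Q -> Q^T *m Q = 1%:M. Proof. by case. Qed.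
Lemma SOn_mulmxV Q : SOn Q -> Q *m Q^T = 1%:M. Proof. by case=> /mulmx1C. Qed.

Lemma SOn_tr Q : SOn Q -> SOn Q^T.
Proof. by move=> sQ; split; rewrite ?trmxK ?det_tr ?SOn_mulmxV//; case: sQ. Qed.

Lemma SOn_mul Q M : SOn Q -> SOn M -> SOn (Q *m M).
Proof.
move=> [Q1 dQ] [M1 dM]; split; last by rewrite det_mulmx dQ dM mul1r.
by rewrite trmx_mul mulmxA -(mulmxA M^T) Q1 mulmx1.
Qed.

Lemma dotv_mulmx_tr (u v : V) Q : dotv (u *m Q) v = dotv u (v *m Q^T).
Proof. by rewrite /dotv trmx_mul trmxK mulmxA. Qed.

Lemma dotv_SOn Q (u v : V) : SOn Q -> dotv (u *m Q) (v *m Q) = dotv u v.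
Proof. by move=> sQ; rewrite dotv_mulmx_tr -mulmxA SOn_mulmxV// mulmx1. Qed.

(** Two block factorizations of one bordered matrix compare an n x n determinant with a 1 x 1
    determinant. *)
Lemma det_sub_rank1 (k : R) (w : V) : \det (1%:M - k *: (w^T *m w)) = 1 - k * dotv w w.
Proof.
have E1 : block_mx (1%:M : 'M[R]_n) (k *: w^T) w (1%:M : 'M[R]_1) =
    block_mx 1%:M 0 w 1%:M *m block_mx 1%:M (k *: w^T) 0 (1%:M - k *: (w *m w^T)).
  by rewrite mulmx_block !mul1mx !mul0mx !mulmx1 !addr0 -scalemxAr addrC subrK.
have E2 : block_mx (1%:M : 'M[R]_n) (k *: w^T) w (1%:M : 'M[R]_1) =
    block_mx 1%:M (k *: w^T) 0 1%:M *m block_mx (1%:M - k *: (w^T *m w)) 0 w 1%:M.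
  by rewrite mulmx_block !mul1mx !mul0mx !mulmx1 !add0r -scalemxAl subrK.
have := congr1 determinant (etrans (esym E1) E2).
rewrite !det_mulmx !det_ublock !det_lblock !det1 !mul1r mulr1 => <-.
by rewrite det_mx11 mxE [X in X + _]mxE eqxx [X in _ + X]mxE [X in _ - X]mxE.
Qed.

Definition householder (w : V) : 'M[R]_n := 1%:M - (2 / dotv w w) *: (w^T *m w).

Lemma mul_householder (x w : V) : x *m householder w = x - (2 / dotv w w * dotv x w) *: w.
Proof.
rewrite mulmxBr mulmx1 -scalemxAr mulmxA; congr (_ - _).
by rewrite -scalerA; congr (_ *: _); apply/rowP => j; rewrite !mxE big_ord1.
Qed.

Lemma householder_tr w : (householder w)^T = householder w.
Proof. by rewrite /householder linearB/= linearZ/= trmx1 trmx_mul trmxK. Qed.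

Lemma householder_sqr (w : V) : w != 0 -> householder w *m householder w = 1%:M.
Proof.
move=> w0; apply/row_matrixP => i; rewrite row_mul row1.
set x := row i _; have -> : x = delta_mx 0 i *m householder w by rewrite /x rowE.
rewrite mul_householder; set e := delta_mx 0 i; rewrite mul_householder.
rewrite !dotvBl !dotvZl; have := dotv_gt0 w0; move: (dotv w w) (dotv e w) => a b a0.
rewrite -addrA -opprD -scalerDl [X in X *: _](_ : _ = 0) ?scale0r ?subr0//.
by field; rewrite gt_eqF.
Qed.

Lemma householder_det w : w != 0 -> \det (householder w) = -1.
Proof.
by move=> w0; rewrite det_sub_rank1 divfK ?dotv_eq0// opprD addrA; ring.
Qed.

(** For unit vectors the first reflection sends [w] to [- w] and the second sends [- w] to [u]. The
    product is a rotation, and it tends to the identity as [u] tends to [w]. *)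
Definition turn (w u : V) : 'M[R]_n := householder w *m householder (w + u).

Lemma turn_SOn w u : w != 0 -> w + u != 0 -> SOn (turn w u).
Proof.
move=> w0 s0; split; last by rewrite det_mulmx !householder_det// mulrNN mulr1.
by rewrite trmx_mul !householder_tr mulmxA -(mulmxA (householder (w + u))) householder_sqr// mulmx1 householder_sqr.
Qed.

Lemma dotv_add_unit (w u : V) : dotv w w = 1 -> dotv u u = 1 ->
  dotv (w + u) (w + u) = 2 * (1 + dotv w u).
Proof. by move=> w1 u1; rewrite dotvDl !dotvDr w1 u1 (dotvC u w); ring. Qed.

Lemma mul_turn w u : dotv w w = 1 -> dotv u u = 1 -> 1 + dotv w u != 0 -> w *m turn w u = u.
Proof.
move=> w1 u1 s0; rewrite mulmxA !mul_householder w1 divr1 mulr1.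
have -> : w - 2 *: w = - w by apply/rowP => i; rewrite !mxE; ring.
rewrite dotv_add_unit// dotvNl dotvDr w1.
have -> : 2 / (2 * (1 + dotv w u)) * - (1 + dotv w u) = -1.
  by move: (dotv w u) s0 => d s0; field.
by rewrite scaleN1r opprK addKr.
Qed.

Lemma turn_sub1 w u i j : dotv w w = 1 -> dotv u u = 1 -> 1 + dotv w u != 0 ->
  (turn w u - 1%:M) i j = 2 * w 0 i * u 0 j - (1 + dotv w u)^-1 * ((w 0 i + u 0 i) * (w 0 j + u 0 j)).
Proof.
move=> w1 u1 s0.
have Er : row i (turn w u) = delta_mx 0 i *m turn w u by rewrite rowE.
rewrite [LHS]mxE [X in _ + X]mxE.
have -> : turn w u i j = row i (turn w u) 0 j by rewrite [RHS]mxE.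
rewrite Er mulmxA !mul_householder w1 divr1 dotv_add_unit//.
have Ew z : dotv (delta_mx 0 i : V) z = z 0 i by rewrite dotvC -(dotv_evec z i).
rewrite dotvBl dotvZl !Ew dotvDr w1 [LHS]/= !mxE eqxx/=.
rewrite [(j == i)]eq_sym; move: (_%:R) (w 0 i) (w 0 j) (u 0 i) (u 0 j) (dotv w u) s0 => k a b c d f f0.
by field.
Qed.

Lemma rotation_near w (e : R) : dotv w w = 1 -> 0 < e -> exists2 d : R, 0 < d &
  forall u, dotv u u = 1 -> `|u - w| < d -> exists M, [/\ SOn M, w *m M = u & `|M - 1%:M| < e].
Proof.
move=> w1 e0; have a01 : (0 : R) <= (0 : R) <= (1 : R) by rewrite lexx ler01.
pose U := [set u : V | 0 < dotv w u].
have oU : open U.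
  rewrite openE => u /dotv_close[d d0 Hd]; apply/nbhsE_norm; exists d => // y yd.
  by apply: Hd => //; rewrite subrr normr0.
have Uw : U w by rewrite /U /= w1.
have [d d0 Hd] := open_norm oU Uw.
pose G ij (u : V) := 2 * w 0 ij.1 * u 0 ij.2 -
  (1 + dotv w u)^-1 * ((w 0 ij.1 + u 0 ij.1) * (w 0 ij.2 + u 0 ij.2)).
have G0 ij : G ij w = 0.
  by rewrite /G w1; move: (w 0 _) (w 0 _) => a b; field.
have [f f0 Hf] : exists2 f : R, 0 < f & forall u, `|u - w| < f -> forall ij : 'I_n * 'I_n, `|G ij u| < e.
  apply: near_fin => -[i j]; have /continuousP_norm/(_ e e0) : {for w, continuous (G (i, j))}.
    (* Continuity of this rational expression is read off the closure properties of the class of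
       level 0. *)
    apply: (Reg_continuous (alpha := 0) (c' := Fin 0) (V := U)) => //.
    have Rc k : Reg 0 (Fin 0) U (fun u : V => u 0 k) by exact: Reg_coord.
    apply: Reg_sub_fun => //; apply: Reg_mul => //; first exact: Reg_cst.
      apply: Reg_inv => //; last by move=> u Uu; rewrite gt_eqF// addr_gt0.
      apply: Reg_add => //; first exact: Reg_cst.
      by apply: (@Reg_ext _ _ _ _ _ (fun u => dotv u w)) => //; [move=> u _; exact: dotvC|exact: Reg_dotv].
    by apply: Reg_mul => //; apply: Reg_add => //; exact: Reg_cst.
  by move=> [f f0 Hf]; exists f => // u /Hf; rewrite G0 subr0.
exists (Num.min d f); first by rewrite lt_min d0.
move=> u u1; rewrite lt_min => /andP[/Hd Uu /Hf Gu].
have s0 : 0 < 1 + dotv w u by rewrite addr_gt0.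
have w0 : w != 0 by rewrite -dotv_eq0 w1 oner_eq0.
exists (turn w u); split.
- apply: turn_SOn => //; rewrite -dotv_eq0 dotv_add_unit// mulf_neq0// gt_eqF//.
- by apply: mul_turn => //; rewrite gt_eqF.
- apply: norm_lt_entry => // i j; rewrite turn_sub1// ?gt_eqF//; exact: (Gu (i, j)).
Qed.

(** [Q] is followed by a small rotation that carries [w *m Q] into [O]. *)
Lemma SOn_dense (O : set V) w Q (e : R) :
  (forall u0 (d : R), dotv u0 u0 = 1 -> 0 < d -> exists u, [/\ dotv u u = 1, `|u - u0| < d & O u]) ->
  dotv w w = 1 -> SOn Q -> 0 < e -> exists Q', [/\ SOn Q', `|Q' - Q| < e & O (w *m Q')].
Proof.
move=> HO w1 sQ e0.
have K0 : 0 < n%:R * `|Q| + 1 by rewrite ltr_wpDl// mulr_ge0.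
have u1 : dotv (w *m Q) (w *m Q) = 1 by rewrite dotv_SOn.
have [d d0 Hd] := rotation_near u1 (divr_gt0 e0 K0).
have [u [uu ud Ou]] := HO _ d u1 d0.
have [M [sM wM nM]] := Hd u uu ud.
exists (Q *m M); split; [exact: SOn_mul| |by rewrite mulmxA wM].
have -> : Q *m M - Q = Q *m (M - 1%:M) by rewrite mulmxBr mulmx1.
apply: (le_lt_trans (mulmx_sq_norm_le _ _)).
move: nM; rewrite ltr_pdivlMr//; apply: le_lt_trans; rewrite mulrDr mulr1 mulrAC [leLHS]mulrC.
by rewrite lerDl.
Qed.

End Rotations.

(** * Generic rotations *)

Section Comeager.
Variables (R : realType) (n : nat).
Notation V := 'rV[R]_n.
Implicit Types (Q M N : 'M[R]_n).

Lemma nbhs_mxE Q (P : set 'M[R]_n) :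
  nbhs Q P <-> exists2 e : R, 0 < e & forall Q', `|Q' - Q| < e -> P Q'.
Proof.
split=> [/nbhs_ballP[e e0 H]|[e e0 H]].
  by exists e => // Q' QQ; apply: H; rewrite -ball_normE /= distrC.
by apply/nbhs_ballP; exists e => // Q'; rewrite -ball_normE /= distrC; exact: H.
Qed.

(** [phi] is transposition or the identity, according to which body has the countable set of
    normals. Entries [a k] that are not unit vectors impose no condition. *)
Lemma comeager_rotations (phi : 'M[R]_n -> 'M[R]_n) (a : nat -> V) (O : set V) (G : set 'M[R]_n) :
  involutive phi -> (forall Q, SOn Q -> SOn (phi Q)) ->
  (forall Q N, `|phi Q - phi N| <= `|Q - N|) -> open O ->
  (forall u0 (d : R), dotv u0 u0 = 1 -> 0 < d -> exists u, [/\ dotv u u = 1, `|u - u0| < d & O u]) ->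
  (forall Q, SOn Q -> (forall k, dotv (a k) (a k) = 1 -> O (a k *m phi Q)) -> G Q) ->
  @comeager_in 'M[R]_n (@SOn R n) G.
Proof.
move=> phiK phiS phiB oO dO HG.
pose T k : set 'M[R]_n := [set Q | dotv (a k) (a k) = 1 -> O (a k *m phi Q)].
exists (fun k => T k `&` @SOn R n); split=> [k|]; last first.
  move=> Q H; apply: HG => [|k]; first by case: (H 0%N I).
  by case: (H k I) => Tk _ /Tk.
split; first by move=> Q [].
split.
  exists (T k); split=> //; rewrite openE => Q TQ; apply/nbhs_mxE.
  have [a1|a1] := pselect (dotv (a k) (a k) = 1); last by exists 1 => // Q' _ /a1.
  have [d d0 Hd] := open_norm oO (TQ a1).
  have K0 : 0 < n%:R * `|a k| + 1 by rewrite ltr_wpDl// mulr_ge0.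
  exists (d / (n%:R * `|a k| + 1)); first by rewrite divr_gt0.
  move=> Q' QQ _; apply: Hd; rewrite -mulmxBr (le_lt_trans (mulmx_norm_le _ _))//.
  move: QQ; rewrite ltr_pdivlMr//; apply: le_lt_trans.
  rewrite mulrAC [leLHS]mulrC; apply: ler_pM => //.
  by rewrite lerDl.
move=> Q sQ B /nbhs_mxE[e e0 He].
have [a1|a1] := pselect (dotv (a k) (a k) = 1); last first.
  by exists Q; split; [split=> // /a1|apply: He; rewrite subrr normr0].
have [Q' [sQ' QQ OQ']] := SOn_dense dO a1 (phiS _ sQ) e0.
exists (phi Q'); split; first by split; [rewrite /T /= phiK|exact: phiS].
by apply: He; rewrite -{1}[Q]phiK; apply: le_lt_trans QQ; exact: phiB.
Qed.

(** The default value 0 pads the enumeration of a finite or empty set; as it is not a unit vector,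
    it adds no condition in [comeager_rotations]. *)
Lemma countable_range (Z : set V) : countable Z ->
  exists a : nat -> V, forall z, Z z -> exists k, a k = z.
Proof.
move=> /countable_injP[f finj]; exists (fun k => xget 0 [set z | Z z /\ f z = k]) => z Zz.
exists (f z); have [Zx fx] := @xgetI _ 0 [set z' | Z z' /\ f z' = f z] z (conj Zz erefl).
by apply: finj => //; exact: mem_set.
Qed.

End Comeager.

(** * Transport by rotations and the regularity of R(A) + B *)

Section Transport.
Variables (R : realType) (n : nat) (alpha : R) (c : reg).
Hypotheses (alpha01 : 0 <= alpha <= 1) (c2 : reg_ge2 c).
Notation V := 'rV[R]_n.
Implicit Types (S C A B W : set V) (Q : 'M[R]_n).

(** Regularity at a single point, because different boundary points of the sum are handled through
    different bodies. *)
Definition hypersurface_at S (p : V) := exists W F, W p /\ local_defining c alpha S W F.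

Lemma rot_imageP Q S (y : V) : SOn Q -> rot_image Q S y <-> S (y *m Q).
Proof.
move=> sQ; split=> [[x Sx <-]|Sy]; first by rewrite -mulmxA SOn_mulVmx// mulmx1.
by exists (y *m Q) => //; rewrite -mulmxA SOn_mulmxV// mulmx1.
Qed.

Lemma mulmx_lip Q (x y : V) : `|x *m Q - y *m Q| <= n%:R * `|Q| * `|x - y|.
Proof. by rewrite -mulmxBl mulmx_norm_le. Qed.

Lemma mulmx_continuous Q : continuous (fun x : V => x *m Q).
Proof.
move=> x P /nbhsE_norm[e e0 He]; apply/nbhsE_norm.
have K0 : 0 < n%:R * `|Q| + 1 by rewrite ltr_wpDl// mulr_ge0.
exists (e / (n%:R * `|Q| + 1)); first by rewrite divr_gt0.
move=> y yx; apply: He; apply: (le_lt_trans (mulmx_lip _ _ _)).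
move: yx; rewrite ltr_pdivlMr//; apply: le_lt_trans; rewrite [leRHS]mulrC.
by apply: ler_wpM2r => //; rewrite lerDl.
Qed.

Lemma open_mulmx Q W : open W -> open [set y | W (y *m Q)].
Proof. by move=> oW; apply: open_comp => // x _; exact: mulmx_continuous. Qed.

Lemma rot_hypersurface_at Q S (p : V) : SOn Q -> hypersurface_at S (p *m Q) ->
  hypersurface_at (rot_image Q S) p.
Proof.
move=> sQ [W [F [Wp lF]]].
have [[oW cF _ _] _] := local_defining_C2def c2 lF.
have /local_definingP[_ RF g0 E] := lF.
exists [set y | W (y *m Q)], (fun y => F (y *m Q)); split=> //.
have oW' := open_mulmx (Q := Q) oW.
have DF y i : W (y *m Q) -> gradient (fun y => F (y *m Q)) y 0 i = (gradient F (y *m Q) *m Q^T) 0 i.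
  move=> Wy; rewrite gradientE; apply/is_derive_pd.
  have -> : (gradient F (y *m Q) *m Q^T) 0 i = dotv (row i Q) (gradient F (y *m Q)).
    by rewrite dotvC dotvE mxE; apply: eq_bigr => k _; rewrite !mxE.
  apply: (is_derive_comp (G := fun y => y *m Q)); first exact: C2_fdiff oW cF Wy.
  move=> j; have -> : row i Q 0 j = dotv (evec R i) (col j Q)^T.
    by rewrite dotvC dotv_evec !mxE.
  rewrite (_ : (fun z : V => _) = fun z => dotv z (col j Q)^T); first exact: is_derive_dotv.
  by apply/funext => z; rewrite dotvE mxE; apply: eq_bigr => k _; rewrite !mxE.
apply/local_definingP; split=> //.
- apply: (Reg_comp (G := fun y => y *m Q) alpha01 oW' oW RF) => //.
    move=> j; rewrite (_ : (fun z : V => _) = fun z => dotv z (col j Q)^T); first exact: Reg_dotv.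
    by apply/funext => z; rewrite dotvE mxE; apply: eq_bigr => k _; rewrite !mxE.
  move=> x _; exists 1 => //; exists (n%:R * `|Q|); first by rewrite mulr_ge0.
  by move=> y z _ _; exact: mulmx_lip.
- move=> y Wy; have -> : gradient (fun y => F (y *m Q)) y = gradient F (y *m Q) *m Q^T.
    by apply/rowP => i; exact: DF.
  apply/negP => /eqP gQ; have /negP := g0 _ Wy; apply.
  by rewrite -[gradient _ _]mulmx1 -(SOn_mulVmx sQ) mulmxA gQ mul0mx.
- apply/seteqP; split=> y /=.
    move=> [/(rot_imageP _ _ sQ) Sy Wy]; split=> //.
    by have : (S `&` W) (y *m Q) by []; rewrite E => -[].
  move=> [Wy Fy]; split=> //; apply/(rot_imageP _ _ sQ).
  by have : [set x | W x /\ F x = 0] (y *m Q) by []; rewrite -E => -[].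
Qed.

Lemma rot_compact Q C : compact C -> compact (rot_image Q C).
Proof.
move=> cC; apply: continuous_compact => //; apply: continuous_subspaceT; exact: mulmx_continuous.
Qed.

Lemma rot_interior Q C (y : V) : SOn Q -> interior (rot_image Q C) y <-> interior C (y *m Q).
Proof.
move=> sQ; have key (M : 'M[R]_n) (D : set V) z : SOn M -> interior D (z *m M) -> interior (rot_image M D) z.
  move=> sM iD; have H : nbhs z (fun x => D (x *m M)) := @mulmx_continuous M z D iD.
  by apply: (filterS _ H) => x /= Dx; apply/(rot_imageP _ _ sM).
split=> [iy|]; last exact: key.
have := key Q^T (rot_image Q C) (y *m Q) (SOn_tr sQ).
rewrite -mulmxA SOn_mulmxV// mulmx1 => /(_ iy); apply: filterS => x.
move=> /(rot_imageP _ _ (SOn_tr sQ))/(rot_imageP _ _ sQ).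
by rewrite -mulmxA SOn_mulVmx// mulmx1.
Qed.

Lemma rot_bdry Q C (y : V) : SOn Q -> compact C -> bdry (rot_image Q C) y <-> bdry C (y *m Q).
Proof.
move=> sQ cC; have cQ := rot_compact (Q := Q) cC.
have cl (D : set V) : compact D -> closure D = D by move=> /compact_closed_rV/closure_id <-.
rewrite /bdry !cl//.
split=> -[Cy iy]; split.
- exact/(rot_imageP _ _ sQ).
- by move=> /(rot_interior _ _ sQ).
- exact/(rot_imageP _ _ sQ).
- by move=> /(rot_interior _ _ sQ).
Qed.

Lemma rot_reg_convex_body Q C : SOn Q -> reg_convex_body c alpha C ->
  reg_convex_body c alpha (rot_image Q C).
Proof.
move=> sQ [[vC [cC [q iq]]] sC]; split; first split; [|split|].
- move=> x y t /(rot_imageP _ _ sQ) Cx /(rot_imageP _ _ sQ) Cy t01.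
  by apply/(rot_imageP _ _ sQ); rewrite mulmxDl -!scalemxAl; exact: vC.
- exact: rot_compact.
- by exists (q *m Q^T); apply/(rot_interior _ _ sQ); rewrite -mulmxA SOn_mulVmx// mulmx1.
- move=> p bp; have -> : bdry (rot_image Q C) = rot_image Q (bdry C).
    apply/seteqP; split=> y.
      by move=> /(rot_bdry _ sQ cC) ?; apply/(rot_imageP _ _ sQ).
    by move=> /(rot_imageP _ _ sQ) ?; apply/(rot_bdry _ sQ cC).
  by apply: rot_hypersurface_at => //; apply: sC; apply/(rot_bdry _ sQ cC).
Qed.

Lemma rot_outer_normal Q C (x u : V) : SOn Q -> outer_unit_normal (rot_image Q C) x u ->
  outer_unit_normal C (x *m Q) (u *m Q).
Proof.
move=> sQ [u1 H]; split; first by rewrite dotv_SOn.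
move=> y Cy; have -> : y - x *m Q = (y *m Q^T - x) *m Q.
  by rewrite mulmxBl -mulmxA SOn_mulVmx// mulmx1.
by rewrite dotv_SOn//; apply: H; exists y.
Qed.

(** Turning the whole sum back puts [A] in its original position, the one to which its [Zset]
    refers. *)
Lemma mink_rot Q A B : SOn Q ->
  mink_sum (rot_image Q A) B = rot_image Q (mink_sum A (rot_image Q^T B)).
Proof.
move=> sQ; have sQ' := SOn_tr sQ; apply/seteqP; split=> x.
  move=> /mink_sumP[a [b [/(rot_imageP _ _ sQ) Aa Bb ->]]]; apply/(rot_imageP _ _ sQ)/mink_sumP.
  exists (a *m Q), (b *m Q); split=> //; last by rewrite mulmxDl.
  by apply/(rot_imageP _ _ sQ'); rewrite -mulmxA SOn_mulmxV// mulmx1.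
move=> /(rot_imageP _ _ sQ)/mink_sumP[a [b [Aa /(rot_imageP _ _ sQ') Bb E]]]; apply/mink_sumP.
exists (a *m Q^T), (b *m Q^T); split=> //.
  by exists a.
by rewrite -mulmxDl -E -mulmxA SOn_mulmxV// mulmx1.
Qed.

Lemma mink_sumC A B : mink_sum A B = mink_sum B A.
Proof.
by apply/seteqP; split=> x /mink_sumP[a [b [? ? ->]]]; apply/mink_sumP; exists b, a; rewrite addrC.
Qed.

(** [local_sum] asks for outward gradients; [F] is replaced by [- F] where necessary. *)
Lemma positive_defining S W F (a u : V) : local_defining c alpha S W F -> W a ->
  dotv u (gradient F a) != 0 ->
  exists F', local_defining c alpha S W F' /\ 0 < dotv u (gradient F' a).
Proof.
move=> lF Wa; rewrite neq_lt => /orP[gn|gp]; last by exists F.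
have [[oW cF _ _] _] := local_defining_C2def c2 lF.
have /local_definingP[_ RF g0 E] := lF.
have gN x : W x -> gradient (fun y => - F y) x = - gradient F x.
  move=> Wx; apply/rowP => i; rewrite gradientE [RHS]mxE gradientE; apply: is_derive_pd.
  by have [dF _ _ _] := cF x Wx; apply: is_deriveN; exact: pdP.
exists (fun y => - F y); split; last by rewrite gN// dotvNr oppr_gt0.
apply/local_definingP; split=> //; first exact: Reg_opp.
  by move=> x Wx; rewrite gN// oppr_eq0 g0.
by rewrite E; apply/seteqP; split=> x [Wx /eqP Fx]; split=> //; apply/eqP; move: Fx; rewrite oppr_eq0.
Qed.

Lemma mink_hypersurface_at A B a b u : reg_convex_body c alpha A -> reg_convex_body c alpha B ->
  A a -> B b -> outer_unit_normal A a u -> outer_unit_normal B b u -> ~ Zset B u ->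
  hypersurface_at (bdry (mink_sum A B)) (a + b).
Proof.
move=> rA rB Aa Bb uA uB nZ; have [hA sA] := rA; have [hB sB] := rB.
have bA := outer_normal_bdry Aa uA; have bB := outer_normal_bdry Bb uB.
have cA : compact A by case: hA => _ []. have cB : compact B by case: hB => _ [].
have nd := notin_Zset_nondegenerate c2 rB bB uB nZ.
have [WA [F [WAa lF]]] := sA a bA; have [WB [G [WBb lG]]] := sB b bB.
have [dF _] := local_defining_C2def c2 lF; have [dG _] := local_defining_C2def c2 lG.
have [_ kF] := outer_normal_gradient (bdry_sub cA) dF WAa bA uA.
have [_ kG] := outer_normal_gradient (bdry_sub cB) dG WBb bB uB.
have [FA [lA pA]] := positive_defining lF WAa kF.
have [FB [lB pB]] := positive_defining lG WBb kG.
have [dB _] := local_defining_C2def c2 lB.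
have [c' Ec] : exists c', c = succr (succr c').
  by case: (c) c2 => [[|[|k]]//||] _; [exists (Fin k)|exists Inf|exists Omega].
move: lA lB; rewrite /hypersurface_at Ec => lA lB.
apply: (local_sum alpha01 hA hB lA lB WAa WBb Aa Bb uA uB pA pB).
by move=> v; exact: nd dB WBb v.
Qed.

(** At each boundary point of the sum one of the two bodies is nondegenerate for the common normal
    [u]. If it is [B], the local result applies at once; if it is [A], for which the normal is
    [u *m Q], the picture is rotated back and the summands are exchanged. *)
Lemma hypersurface_mink_rot Q A B : SOn Q -> reg_convex_body c alpha A -> reg_convex_body c alpha B ->
  (forall u, Zset A (u *m Q) -> Zset B u -> False) ->
  hypersurface c alpha (bdry (mink_sum (rot_image Q A) B)).
Proof.
move=> sQ rA rB nZ p; have sQ' := SOn_tr sQ.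
have [[vA [cA _]] sA] := rA; have [[vB [cB _]] sB] := rB.
have rA' := rot_reg_convex_body sQ rA; have rB' := rot_reg_convex_body sQ' rB.
have [[vA' [cA' _]] _] := rA'; have [[_ [cB' _]] _] := rB'.
move=> /(bdry_mink cA' cB vA' vB)[a [b [u [Aa Bb -> uA uB]]]].
have [ZB|] := pselect (Zset B u); last exact: mink_hypersurface_at rA' rB Aa Bb uA uB.
have nZA : ~ Zset A (u *m Q) by move=> /nZ; exact.
have cAB : compact (mink_sum A (rot_image Q^T B)) by exact: mink_compact.
rewrite mink_rot// (_ : bdry _ = rot_image Q (bdry (mink_sum A (rot_image Q^T B)))); last first.
  apply/seteqP; split=> y.
    by move=> /(rot_bdry _ sQ cAB) ?; apply/(rot_imageP _ _ sQ).
  by move=> /(rot_imageP _ _ sQ) ?; apply/(rot_bdry _ sQ cAB).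
apply: rot_hypersurface_at => //; rewrite mink_sumC mulmxDl addrC.
have Aa' : A (a *m Q) by apply/(rot_imageP _ _ sQ).
have uA' := rot_outer_normal sQ uA.
have EB : B = rot_image Q (rot_image Q^T B).
  apply/seteqP; split=> y; first move=> By.
    by apply/(rot_imageP _ _ sQ)/(rot_imageP _ _ sQ'); rewrite -mulmxA SOn_mulmxV// mulmx1.
  by move=> /(rot_imageP _ _ sQ)/(rot_imageP _ _ sQ'); rewrite -mulmxA SOn_mulmxV// mulmx1.
have Bb' : rot_image Q^T B (b *m Q) by apply/(rot_imageP _ _ sQ); rewrite -EB.
have uB' : outer_unit_normal (rot_image Q^T B) (b *m Q) (u *m Q).
  by apply: rot_outer_normal => //; rewrite -EB.
exact: mink_hypersurface_at rB' rA Bb' Aa' uB' uA' nZA.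
Qed.

End Transport.

Theorem theorem1p2 (R : realType) (n : nat) (c : reg) (alpha : R)
    (A B : set 'rV[R]_n) :
  reg_ge2 c -> 0 <= alpha <= 1 ->
  reg_convex_body c alpha A -> reg_convex_body c alpha B ->
  countable (Zset A) \/ countable (Zset B) ->
  @comeager_in 'M[R]_n (@SOn R n)
    [set Q | hypersurface c alpha (bdry (mink_sum (rot_image Q A) B))].
Proof.
move=> c2 a01 rA rB.
have unitZ C (u : 'rV[R]_n) : Zset C u -> dotv u u = 1 by case=> x [_ [[]]].
have dense C : reg_convex_body c alpha C -> forall u0 (d : R), dotv u0 u0 = 1 -> 0 < d ->
    exists u, [/\ dotv u u = 1, `|u - u0| < d & interior (~` Zset C) u].
  by move=> rC u0 d u01 d0; exact: notin_Zset_dense c2 rC u01 d0.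
move=> [/countable_range[a Ha]|/countable_range[a Ha]].
  (* The rotation takes a normal [a k] of [A] to [a k *m Q^T], hence the transposition. *)
  apply: (@comeager_rotations _ _ trmx a (interior (~` Zset B))) => //.
  - exact: trmxK.
  - exact: SOn_tr.
  - move=> Q N; have -> : Q^T - N^T = (Q - N)^T by rewrite linearB.
    exact: norm_trmx_le.
  - exact: open_interior.
  - exact: dense.
  - move=> Q sQ H; apply: hypersurface_mink_rot => // u ZA ZB.
    have [k ak] := Ha _ ZA; have := unitZ _ _ ZA; rewrite -ak => /H/interior_subset.
    by rewrite ak -mulmxA SOn_mulmxV// mulmx1; exact.
(* A normal [a k] of [B] is compared with [A] in its original position, where it becomes
   [a k *m Q]. *)
apply: (@comeager_rotations _ _ id a (interior (~` Zset A))) => //.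
- exact: open_interior.
- exact: dense.
- move=> Q sQ H; apply: hypersurface_mink_rot => // u ZA ZB.
  have [k ak] := Ha _ ZB; have := unitZ _ _ ZB; rewrite -ak => /H/interior_subset.
  by rewrite ak; exact.
Qed.
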